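(* Let $u$ be a bounded solution of $\mathcal{L}u=0$ in $(0,\infty)\times\mathbb{S}^1$. Then \[ u(r,t)=\sum_{\mathrm{Re}(\sigma_j^\pm)=0}a_j^\pm w_j^\pm(r,t),\qquad a_j^\pm\in\mathbb{R}, \] (a finite sum over the basic solutions whose exponents lie on $i\mathbb{R}$). In particular, if $\mathcal{L}$ has no spectral values in $i\mathbb{R}$, then $u\equiv0$.
   Context: Fix $a>0$, $b\in\mathbb{R}\setminus\{0\}$, $\lambda=a+ib$, $\nu\in[0,1)$, an integer $k\ge2$ and $c\in C^k(\mathbb{S}^1,\mathbb{C})$. On $(0,\infty)\times\mathbb{S}^1$ (coordinates $(r,t)$) let $\mathcal{L}u=\lambda u_t-iru_r+i\lambda\nu u-c(t)\bar u$. A basic solution of $\mathcal{L}$ is a nontrivial solution of $\mathcal{L}w=0$ on $(0,\infty)\times\mathbb{S}^1$ of the form $w=r^\sigma\phi(t)+\overline{r^\sigma\psi(t)}$, $\sigma\in\mathbb{C}$, $\phi,\psi$ $2\pi$-periodic, written with $|\phi|>|\psi|$ when $\sigma\notin\mathbb{R}$ and as $r^\sigma f$ when $\sigma\in\mathbb{R}$; $\sigma$ is its exponent (a spectral value of $\mathcal{L}$) and the winding number of $\phi$ (resp. $f$) is its winding number. For each $j\in\mathbb{Z}$, $w_j^\pm$ denote the two $\mathbb{R}$-independent basic solutions with winding number $j$, with exponents $\sigma_j^\pm$; these exhaust the spectral values. *)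

(* Defs.v *)
From Stdlib Require Import Reals List.
Open Scope R_scope.

Definition CC := (R * R)%type.
Definition Cre (z : CC) : R := fst z.
Definition Cim (z : CC) : R := snd z.
Definition C0 : CC := (0, 0).
Definition Ci : CC := (0, 1).
Definition RtoC (x : R) : CC := (x, 0).
Definition Cadd (z w : CC) : CC := (fst z + fst w, snd z + snd w).
Definition Cmul (z w : CC) : CC :=
  (fst z * fst w - snd z * snd w, fst z * snd w + snd z * fst w).
Definition Cconj (z : CC) : CC := (fst z, - snd z).
Definition Cnorm (z : CC) : R := sqrt (fst z * fst z + snd z * snd z).

(* r^sigma := exp(sigma * ln r) for r > 0 *)
Definition Cpow (r : R) (s : CC) : CC :=
  (exp (fst s * ln r) * cos (snd s * ln r),
   exp (fst s * ln r) * sin (snd s * ln r)).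

(* 2*pi-periodic functions: functions on S^1 = R / 2 pi Z *)
Definition periodic (f : R -> CC) : Prop := forall t, f (t + 2 * PI) = f t.

Definition Cderiv_at (f : R -> CC) (x : R) (d : CC) : Prop :=
  derivable_pt_lim (fun s => fst (f s)) x (fst d) /\
  derivable_pt_lim (fun s => snd (f s)) x (snd d).

Definition Ccontinuous (f : R -> CC) : Prop :=
  continuity (fun s => fst (f s)) /\ continuity (fun s => snd (f s)).

Fixpoint Ck (k : nat) (f : R -> CC) : Prop :=
  match k with
  | O => Ccontinuous f
  | S n => exists f' : R -> CC, (forall x, Cderiv_at f x (f' x)) /\ Ck n f'
  end.

(* Classical solution of L u = 0 on (0,oo) x S^1, where
   L u = lambda u_t - i r u_r + i lambda nu u - c(t) conj(u),
   lambda = a + i b.  u : r -> t -> CC, 2 pi periodic in t. *)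
Definition is_solution (a b nu : R) (c : R -> CC) (u : R -> R -> CC) : Prop :=
  (forall r t, 0 < r -> u r (t + 2 * PI) = u r t) /\
  exists ur ut : R -> R -> CC,
    forall r t, 0 < r ->
      Cderiv_at (fun s => u s t) r (ur r t) /\
      Cderiv_at (fun s => u r s) t (ut r t) /\
      Cadd (Cadd (Cmul (a, b) (ut r t))
                 (Cmul (0, - r) (ur r t)))
           (Cadd (Cmul (Cmul Ci (Cmul (a, b) (RtoC nu))) (u r t))
                 (Cmul (RtoC (-1)) (Cmul (c t) (Cconj (u r t))))) = C0.

Definition bounded_on_half_cyl (u : R -> R -> CC) : Prop :=
  exists M, forall r t, 0 < r -> Cnorm (u r t) <= M.

Definition basic_solution (a b nu : R) (c : R -> CC)
    (w : R -> R -> CC) (sigma : CC) : Prop :=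
  is_solution a b nu c w /\
  (exists r t, 0 < r /\ w r t <> C0) /\
  exists phi psi : R -> CC, periodic phi /\ periodic psi /\
    forall r t, 0 < r ->
      w r t = Cadd (Cmul (Cpow r sigma) (phi t))
                   (Cconj (Cmul (Cpow r sigma) (psi t))).

Definition spectral_value (a b nu : R) (c : R -> CC) (sigma : CC) : Prop :=
  exists w, basic_solution a b nu c w sigma.

Definition lin_comb (l : list ((R -> R -> CC) * CC * R)) (r t : R) : CC :=
  fold_right (fun x acc => Cadd (Cmul (RtoC (snd x)) (fst (fst x) r t)) acc) C0 l.

(* Main.v *)
(** In the coordinate [x = ln r] the equation reads [v_x = - i lambda v_t + lambda nu v + i c conj(v)],
    which is invariant under translations in [x].

    A solution is only separately differentiable, so the first point is a divergence theorem for bounded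
    separately differentiable pairs [P], [S] with [P_x + S_t = g], in the manner of Looman and Menchoff: the set
    where it fails locally is closed, and if it were not empty, Baire's theorem would give a portion of it on which
    [P] and [S] are Lipschitz; comparing with Lipschitz extensions shows that there is no defect there.

    The Fourier modes of a bounded solution therefore satisfy
    [v_n' = lambda (n + nu) v_n + sum_k e_k conj(v_(k-n))] with [e = i c] and [e_k = O(k^-2)]. For [|N|] large the
    energy [E = exp (- gam x) (sum_(n>N) |v_n|^2 - sum_(n<=N) |v_n|^2)], [gam = a (2 N + 1 + 2 nu)], is increasing:
    the coupling is symmetric, so its terms between [n > N] and [m <= N] cancel and the others are small. Using one
    large positive and one large negative [N], a bounded solution whose modes [|n| <= N0] vanish at [x = 0] vanishes
    identically, hence the bounded solutions form a finite-dimensional space [B].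

    [B] is closed under pointwise limits, hence under [d/dx]; each [v] in [B] is annihilated by some
    [prod_i (d/dx - z_i)], and solving these first order equations one after the other within bounded functions
    leaves only sums of [exp (i tau x) phi(t)] with [tau] real, that is, of basic solutions with imaginary exponent. *)

(* The coupling [e conj(v)] is not small against the diagonal part, and it links all modes. The
   energy argument works because [e_(n+m)] is concentrated where [m] is close to [- n]. Two such
   indices on the same side of [N] have distances to [N] that add up to about [2 |N|], and the
   factor [exp (- gam x)] gives the mode [n] the rate [a |2 n - 2 N - 1|] in the derivative of [E];
   for [|N|] large the geometric mean of the two rates outweighs the coefficient. Coefficients far
   from [n + m = 0] are small because [c] has two continuous derivatives. The energies are truncated
   to [|n| <= L], which avoids differentiating an infinite sum; the truncation costs [O(1 / L)], and
   [L] is chosen last. Conjugation makes the equation linear over the reals only. Hence [B] is a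
   real space, and eigenvectors of [d/dx] are sought in its complexification, as pairs of members of
   [B]. The real part of such a vector has a term in [exp (i tau x)] and one in [exp (- i tau x)]:
   these are the terms with [phi] and [psi] of a basic solution. *)
Require Import Defs.
From HB Require structures.
From mathcomp Require all_boot all_order all_algebra all_classical all_reals all_analysis.
From mathcomp Require measurable_realfun ring lra complex Rstruct Rstruct_topology.
From Stdlib Require Import Reals Lra Lia ZArith Arith List Permutation Classical ClassicalEpsilon FunctionalExtensionality.
Open Scope R_scope.

(** * Integration of bounded measurable functions *)

Module MeasureTools.
Import HB.structures all_boot all_order all_algebra all_classical all_reals all_analysis.
Import measurable_realfun mathcomp.algebra_tactics.ring mathcomp.algebra_tactics.lra.
Set Implicit Arguments. Unset Strict Implicit. Unset Printing Implicit Defensive.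
Import Order.TTheory GRing.Theory Num.Theory numFieldNormedType.Exports.
Local Open Scope classical_set_scope.
Local Open Scope ring_scope.

Section Toolkit.
Variable R : realType.
Local Notation mu := (@lebesgue_measure R).
Definition bdm d (T : measurableType d) (f : T -> R) : Prop :=
  measurable_fun setT f /\ exists M : R, forall x, `|f x| <= M.
Definition I1 (a b : R) (f : R -> R) : R := \int[mu]_(x in `[a, b]) f x.

Lemma bdm_integrable a b (f : R -> R) : bdm (f : measurableTypeR R -> R) -> mu.-integrable `[a, b] (EFin \o f).
Proof.
move=> [mf [M fM]].
apply: measurable_bounded_integrable => //.
- by rewrite /= lebesgue_measure_itv/=; case: ifP => _; rewrite ?ltry.
- exact: measurable_funTS.
- exists M; split; first exact: num_real.
  by move=> x Mx y _; exact: le_trans (fM y) (ltW Mx).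
Qed.

Section alg.
Context d (T : measurableType d).
Implicit Types f g : T -> R.
Lemma bdm_cst c : bdm (fun _ : T => c).
Proof. by split; [exact: measurable_cst|exists `|c|]. Qed.

Lemma bdmD f g : bdm f -> bdm g -> bdm (fun x => f x + g x).
Proof.
move=> [mf [M fM]] [mg [N gN]]; split; first exact: measurable_funD.
by exists (M + N) => x; apply: le_trans (ler_normD _ _) _; exact: lerD.
Qed.

Lemma bdmM f g : bdm f -> bdm g -> bdm (fun x => f x * g x).
Proof.
move=> [mf [M fM]] [mg [N gN]]; split; first exact: measurable_funM.
by exists (M * N) => x; rewrite normrM ler_pM.
Qed.

Lemma bdm_abs f : bdm f -> bdm (fun x => `|f x|).
Proof.
move=> [mf [M fM]]; split; first exact: measurableT_comp.
by exists M => x; rewrite normr_id.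
Qed.

Lemma bdm_lim (h : nat -> T -> R) f (M : R) : (forall n, bdm (h n)) ->
  (forall x, h ^~ x @ \oo --> f x) -> (forall x, `|f x| <= M) -> bdm f.
Proof.
move=> hb hf fM; split; last by exists M.
by apply: (measurable_fun_cvg (h := h)) => // n; exact: (hb n).1.
Qed.
End alg.

Lemma I1D a b f g : bdm (f : measurableTypeR R -> R) -> bdm (g : measurableTypeR R -> R) ->
  I1 a b (fun x => f x + g x) = I1 a b f + I1 a b g.
Proof. by move=> bf bg; apply: RintegralD => //; exact: bdm_integrable. Qed.

Lemma I1Z a b f c : bdm (f : measurableTypeR R -> R) ->
  I1 a b (fun x => c * f x) = c * I1 a b f.
Proof. by move=> bf; apply: RintegralZl => //; exact: bdm_integrable. Qed.

Lemma I1_le a b f g : bdm (f : measurableTypeR R -> R) -> bdm (g : measurableTypeR R -> R) ->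
  (forall x, a <= x <= b -> f x <= g x) -> I1 a b f <= I1 a b g.
Proof.
move=> bf bg fg; apply: le_Rintegral => //; exact: bdm_integrable.
Qed.

Lemma I1_cst a b c : a <= b -> I1 a b (fun _ => c) = c * (b - a).
Proof.
move=> ab; rewrite /I1 Rintegral_cst//= lebesgue_measure_itv/= lte_fin.
by move: ab; rewrite le_eqVlt => /predU1P[->|->//]; rewrite ltxx subrr.
Qed.

Lemma I1_chasles a b c f : bdm (f : measurableTypeR R -> R) -> a <= b -> b <= c ->
  I1 a c f = I1 a b f + I1 b c f.
Proof.
move=> bf ab bc; apply/eqP; rewrite addrC -subr_eq; apply/eqP.
rewrite /I1 Rintegral_itvB ?bnd_simp//; last exact: bdm_integrable.
rewrite Rintegral_itv_obnd_cbnd//.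
apply: integrableS (bdm_integrable b c bf) => //.
by apply: subset_itvr; rewrite bnd_simp.
Qed.

Lemma I1_lim (a b : R) (h : nat -> R -> R) (f : R -> R) (M : R) :
  (forall n, bdm (h n : measurableTypeR R -> R)) -> bdm (f : measurableTypeR R -> R) ->
  (forall n x, a <= x <= b -> `|h n x| <= M) ->
  (forall x, a <= x <= b -> h ^~ x @ \oo --> f x) ->
  (fun n => I1 a b (h n)) @ \oo --> I1 a b f.
Proof.
move=> bh bf hM hf.
have [] := @dominated_convergence _ _ _ mu `[a, b] _ (fun n => EFin \o h n) (EFin \o f) (cst M%:E) _ _ _ _ _ => //.
- by move=> n; apply/measurable_EFinP; apply: measurable_funTS; exact: (bh n).1.
- by apply/measurable_EFinP; apply: measurable_funTS; exact: bf.1.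
- apply: aeW => x /=; rewrite in_itv/= => xab.
  by apply: cvg_EFin; [exact: nearW|exact: hf].
- exact: (bdm_integrable a b (bdm_cst _ M)).
- by apply: aeW => x n /=; rewrite in_itv/= lee_fin; exact: hM.
move=> if1 _ hc.
rewrite /I1 /Rintegral; apply: fine_cvg; rewrite fineK//.
exact: integrable_fin_num.
Qed.

Lemma shift_measurable (h : R) : measurable_fun setT ((fun x => x + h) : measurableTypeR R -> measurableTypeR R).
Proof. by apply: measurable_funD => //; exact: measurable_cst. Qed.

(** Lebesgue measure is determined by its values on the intervals []a, b]], and a translation
    preserves their lengths. *)
Lemma mu_shift h (A : set R) : measurable A ->
  pushforward mu ((fun x => x + h) : measurableTypeR R -> measurableTypeR R) A = mu A.
Proof.
move=> mA.
pose phi := HB.pack_for {mfun measurableTypeR R >-> measurableTypeR R} ((fun x => x + h) : measurableTypeR R -> measurableTypeR R)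
  (isMeasurableFun.Build _ _ _ _ _ (shift_measurable h)).
rewrite -[LHS]/(pushforward mu phi A).
apply/esym/lebesgue_measure_unique => //= _ [[a b]] _ <-.
rewrite /pushforward.
have -> : (fun x => x + h) @^-1` `]a, b] = `]a - h, b - h]%classic.
  by apply/seteqP; split => x /=; rewrite !in_itv/= ltrBlDr lerBrDr.
rewrite !lebesgue_measure_itv/= !lte_fin ltrD2r; case: ifP => // _.
by congr (_%:E); ring.
Qed.

Lemma I1_shift a b h f : bdm (f : measurableTypeR R -> R) ->
  I1 a b (fun x => f (x + h)) = I1 (a + h) (b + h) f.
Proof.
move=> bf; rewrite /I1 /Rintegral; congr fine.
have -> : `[a, b]%classic = (fun x => x + h) @^-1` `[a + h, b + h].
  by apply/seteqP; split => x /=; rewrite !in_itv/= !lerD2r.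
have icf : mu.-integrable ((fun x => x + h) @^-1` `[a + h, b + h]) ((EFin \o f) \o (fun x => x + h)).
  rewrite (_ : _ @^-1` _ = `[a, b]%classic); last first.
    by apply/seteqP; split => x /=; rewrite !in_itv/= !lerD2r.
  apply: (@bdm_integrable a b (fun x => f (x + h))).
  split; first by apply: measurableT_comp; [exact: bf.1|exact: shift_measurable].
  by have [_ [M fM]] := bf; exists M.
rewrite -[LHS](@integral_pushforward _ _ _ _ _ _ (shift_measurable h) mu `[a + h, b + h] (EFin \o f))//.
- apply: eq_measure_integral => [|mphi B mB _]; [exact: shift_measurable|exact: mu_shift].
- by apply/measurable_EFinP; exact: bf.1.
Qed.

Local Notation T2 := (measurableTypeR R * measurableTypeR R)%type.

Lemma bdm_sec1 (f : R -> R -> R) y : bdm (fun z : T2 => f z.1 z.2) -> bdm ((fun x => f x y) : measurableTypeR R -> R).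
Proof.
move=> [mf [M fM]]; split; last by exists M => x; exact: (fM (x, y)).
exact: (measurableT_comp mf (pair2_measurable y)).
Qed.

Lemma bdm_sec2 (f : R -> R -> R) x : bdm (fun z : T2 => f z.1 z.2) -> bdm (f x : measurableTypeR R -> R).
Proof.
move=> [mf [M fM]]; split; last by exists M => y; exact: (fM (x, y)).
exact: (measurableT_comp mf (pair1_measurable x)).
Qed.

Lemma bdm_swap (f : R -> R -> R) : bdm (fun z : T2 => f z.1 z.2) -> bdm (fun z : T2 => f z.2 z.1).
Proof.
move=> [mf [M fM]]; split; last by exists M => -[x y]; exact: (fM (y, x)).
exact: (measurableT_comp mf (@measurable_swap _ _ _ _)).
Qed.

Lemma bdm_shift (f : R -> R -> R) h : bdm (fun z : T2 => f z.1 z.2) -> bdm (fun z : T2 => f (z.1 + h) z.2).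
Proof.
move=> [mf [M fM]]; split; last by exists M => -[x y]; exact: (fM (x + h, y)).
apply: (measurableT_comp (f := fun z : T2 => f z.1 z.2) (g := fun z : T2 => ((z.1 + h, z.2) : T2)) mf).
apply: measurable_fun_pair; last exact: measurable_snd.
by apply: (measurableT_comp (shift_measurable h)); exact: measurable_fst.
Qed.

Lemma bdm_comp1 (f : R -> R) : bdm (f : measurableTypeR R -> R) -> bdm (fun z : T2 => f z.1).
Proof.
move=> [mf [M fM]]; split; last by exists M => -[x y]; exact: fM.
exact: (measurableT_comp mf measurable_fst).
Qed.

Lemma bdm_comp2 (f : R -> R) : bdm (f : measurableTypeR R -> R) -> bdm (fun z : T2 => f z.2).
Proof.
move=> [mf [M fM]]; split; last by exists M => -[x y]; exact: fM.
exact: (measurableT_comp mf measurable_snd).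
Qed.

Lemma bdm_itv a b : bdm (\1_(`[a, b]%classic) : measurableTypeR R -> R).
Proof.
split; first by apply: measurable_indic.
by exists 1 => x; rewrite indicE; case: (_ \in _); rewrite ?normr1 ?normr0.
Qed.

(** The indicator moves the domain into the integrand, so that Tonelli's theorem on the whole
    product space can be applied. *)
Lemma I1_ge0E a b (f : R -> R) : bdm (f : measurableTypeR R -> R) ->
  (I1 a b f)%:E = (\int[mu]_x (\1_(`[a, b]%classic) x * f x)%:E)%E.
Proof.
move=> bf; rewrite /I1 /Rintegral fineK; last first.
  by apply: integrable_fin_num => //; exact: bdm_integrable.
rewrite integral_mkcond; apply: eq_integral => x _.
rewrite patchE indicE; case: ifPn => xab; by rewrite ?mul1r ?mul0r.
Qed.

(** Tonelli's measurability statement concerns nonnegative integrands; the bound [M] is added to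
    [f], and its integral is subtracted at the end. *)
Lemma bdm_I1 c d (f : R -> R -> R) : bdm (fun z : T2 => f z.1 z.2) ->
  bdm ((fun x => I1 c d (f x)) : measurableTypeR R -> R).
Proof.
move=> bf; have [mf [M fM]] := bf.
have [cd|dc] := leP c d; last first.
  (* For [d < c] the interval is empty and the integral is 0. *)
  rewrite (_ : (fun _ => _) = cst 0); first exact: bdm_cst.
  by apply/funext => x; rewrite /I1 set_itv_ge -?ltNge ?bnd_simp// Rintegral_set0.
split; last first.
  exists (M * (d - c)) => x.
  have bfx := bdm_sec2 x bf.
  have fMx y : - M <= f x y <= M by rewrite -ler_norml; exact: (fM (x, y)).
  rewrite ler_norml -[M in X in _ && X]mul1r; apply/andP; split.
    rewrite -mulNr -I1_cst//; apply: I1_le => //; first exact: bdm_cst.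
    by move=> y _; case/andP: (fMx y).
  rewrite mul1r -I1_cst//; apply: I1_le => //; first exact: bdm_cst.
  by move=> y _; case/andP: (fMx y).
have M0 z : 0 <= f z.1 z.2 + M by have := fM z; rewrite ler_norml => /andP[? _]; lra.
pose g (z : T2) := (\1_(`[c, d]%classic) z.2 * (f z.1 z.2 + M))%:E.
have bg : bdm (fun z : T2 => f z.1 z.2 + M) by apply: bdmD => //; exact: bdm_cst.
have mg : measurable_fun setT g.
  apply/measurable_EFinP.
  exact: (bdmM (bdm_comp2 (bdm_itv c d)) bg).1.
have := @measurable_fun_fubini_tonelli_F _ _ _ _ _ mu g mg.
have g0 z : (0 <= g z)%E by rewrite lee_fin mulr_ge0// indicE.
move=> /(_ g0) mF.
have FE : fubini_F mu g = fun x => (I1 c d (f x) + M * (d - c))%:E.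
  apply/funext => x; rewrite /fubini_F -I1_cst// -I1D//; last exact: bdm_cst.
    by rewrite I1_ge0E//; exact: (bdmD (bdm_sec2 x bf) (bdm_cst _ M)).
  exact: bdm_sec2.
have := mF; rewrite FE => /measurable_EFinP mF'.
rewrite (_ : (fun x => _) = (fun x => (I1 c d (f x) + M * (d - c)) - M * (d - c))); last first.
  by apply/funext => x; rewrite addrK.
by apply: measurable_funB => //; exact: measurable_cst.
Qed.

(** Tonelli's theorem for [f + M], which is nonnegative; the contribution of the constant is the
    same in both orders. *)
Lemma I1_fubini a b c d (f : R -> R -> R) : bdm (fun z : T2 => f z.1 z.2) ->
  a <= b -> c <= d ->
  I1 a b (fun x => I1 c d (f x)) = I1 c d (fun y => I1 a b (fun x => f x y)).
Proof.
move=> bf ab cd; have [mf [M fM]] := bf.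
have M0 z : 0 <= f z.1 z.2 + M by have := fM z; rewrite ler_norml => /andP[? _]; lra.
pose k x y := f x y + M.
have bk : bdm (fun z : T2 => k z.1 z.2) by apply: bdmD => //; exact: bdm_cst.
suff key : I1 a b (fun x => I1 c d (k x)) = I1 c d (fun y => I1 a b (fun x => k x y)).
  have e1 : I1 a b (fun x => I1 c d (k x)) = I1 a b (fun x => I1 c d (f x)) + M * (d - c) * (b - a).
    rewrite -I1_cst// -I1D; [|exact: bdm_I1|exact: bdm_cst].
    congr (I1 _ _ _); apply/funext => x.
    by rewrite -I1_cst// -I1D//; [exact: bdm_sec2|exact: bdm_cst].
  have e2 : I1 c d (fun y => I1 a b (fun x => k x y)) = I1 c d (fun y => I1 a b (fun x => f x y)) + M * (b - a) * (d - c).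
    rewrite -I1_cst// -I1D; [|exact: (@bdm_I1 a b (fun y x => f x y) (bdm_swap bf))|exact: bdm_cst].
    congr (I1 _ _ _); apply/funext => y.
    by rewrite -I1_cst// -I1D//; [exact: bdm_sec1|exact: bdm_cst].
  have : M * (d - c) * (b - a) = M * (b - a) * (d - c) by ring.
  move=> e3; apply: (addIr (M * (d - c) * (b - a))).
  by rewrite -e1 key e2 e3.
pose g (z : T2) := (\1_(`[a, b]%classic) z.1 * (\1_(`[c, d]%classic) z.2 * k z.1 z.2))%:E.
have mg : measurable_fun setT g.
  apply/measurable_EFinP.
  exact: (bdmM (bdm_comp1 (bdm_itv a b)) (bdmM (bdm_comp2 (bdm_itv c d)) bk)).1.
have g0 z : (0 <= g z)%E by rewrite lee_fin; apply: mulr_ge0; [rewrite indicE|apply: mulr_ge0; [rewrite indicE|exact: M0]].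
have := @fubini_tonelli _ _ _ _ _ mu mu g mg g0.
have -> : (\int[mu]_x \int[mu]_y g (x, y) = (I1 a b (fun x => I1 c d (k x)))%:E)%E.
  rewrite I1_ge0E; last exact: bdm_I1.
  apply: eq_integral => x _.
  rewrite /g /= EFinM I1_ge0E; last exact: (bdm_sec2 x bk).
  under eq_integral do rewrite EFinM.
  rewrite ge0_integralZl//.
  - by apply/measurable_EFinP; exact: (bdmM (bdm_itv c d) (bdm_sec2 x bk)).1.
  - by move=> y _; rewrite lee_fin mulr_ge0// ?indicE//; exact: (M0 (x, y)).
have -> : (\int[mu]_y \int[mu]_x g (x, y) = (I1 c d (fun y => I1 a b (fun x => k x y)))%:E)%E.
  rewrite I1_ge0E; last exact: (@bdm_I1 a b (fun y x => k x y) (bdm_swap bk)).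
  apply: eq_integral => y _.
  rewrite EFinM I1_ge0E; last exact: (bdm_sec1 y bk).
  rewrite -ge0_integralZl//.
  - by apply: eq_integral => x _; rewrite /g /= -EFinM mulrCA.
  - by apply/measurable_EFinP; exact: (bdmM (bdm_itv a b) (bdm_sec1 y bk)).1.
  - by move=> x _; rewrite lee_fin mulr_ge0// ?indicE//; exact: (M0 (x, y)).
by move=> [].
Qed.

Lemma bdm_continuous (f : R -> R) (M : R) : continuous f -> (forall x, `|f x| <= M) -> bdm (f : measurableTypeR R -> R).
Proof. by move=> cf fM; split; [exact: continuous_measurable_fun|exists M]. Qed.

(** Rounding [x] down to a multiple of [1 / (n + 1)] makes the function constant in [x] on countably
    many strips and continuous in [y] on each, hence measurable; continuity in [x] makes these
    functions converge to [f]. *)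
Lemma bdm_sepcont (f : R -> R -> R) (M : R) : (forall y, continuous (fun x => f x y)) ->
  (forall x, continuous (f x)) -> (forall x y, `|f x y| <= M) ->
  bdm (fun z : T2 => f z.1 z.2).
Proof.
move=> c1 c2 fM.
pose q (n : nat) (x : R) : R := (Num.floor (n.+1%:R * x))%:~R / n.+1%:R.
have qx x : q ^~ x @ \oo --> x.
  apply/cvgrPdist_le => e e0; near=> n.
  have n0 : 0 < n.+1%:R :> R by rewrite ltr0n.
  have := ge_floor (n.+1%:R * x); have := lt_succ_floor (n.+1%:R * x).
  rewrite /q; set k := (Num.floor _)%:~R; rewrite intrD -/k => h1 h2.
  have h3 : k / n.+1%:R <= x by rewrite ler_pdivrMr// mulrC.
  have h4 : x <= (k + 1) / n.+1%:R by rewrite ler_pdivlMr// mulrC ltW.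
  have h5 : n.+1%:R^-1 < e by near: n; exact: (near_infty_natSinv_lt (PosNum e0)).
  by rewrite ger0_norm ?subr_ge0// lerBlDr (le_trans h4)// mulrDl mul1r addrC lerD2r ltW.
apply: (@bdm_lim _ _ (fun n z => f (q n z.1) z.2) _ M) => //.
- move=> n; split; last by exists M.
  move=> _ Y mY; rewrite setTI.
  rewrite (_ : _ @^-1` _ = \bigcup_(k : int) ((fst @^-1` ((fun x => Num.floor (n.+1%:R * x)) @^-1` [set k])) `&`
    (snd @^-1` (f (k%:~R / n.+1%:R) @^-1` Y)) : set T2)); last first.
    by apply/seteqP; split => [[x y] /= h|[x y] [k _ [/= <-]]//]; exists (Num.floor (n.+1%:R * x)).
  apply: countable_bigcupT_measurable => // k.
  apply: measurableI; rewrite -[X in measurable X]setTI.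
    apply: measurable_fst => //.
    have -> : (fun x : R => Num.floor (n.+1%:R * x)) @^-1` [set k] = `[k%:~R / n.+1%:R, (k + 1)%:~R / n.+1%:R[%classic.
      apply/seteqP; split => x /=; rewrite in_itv/= ler_pdivrMr// ltr_pdivlMr// (mulrC x).
        by move=> <-; rewrite ge_floor lt_succ_floor.
      by move=> h; apply/eqP; rewrite floor_eq.
    exact: measurable_itv.
  apply: measurable_snd => //.
  rewrite -[X in measurable X]setTI; exact: continuous_measurable_fun.
- move=> [x y] /=.
  by apply: (@cvg_comp _ _ _ (q ^~ x) (fun x => f x y)); [exact: qx|exact: c1].
Unshelve. all: by end_near.
Qed.
End Toolkit.
End MeasureTools.

(** * Transfer of the integral to the Stdlib reals *)

Module Integral.
Import all_boot all_order all_algebra all_classical all_reals all_analysis.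
Import measurable_realfun Rstruct Rstruct_topology MeasureTools.
Import Order.TTheory GRing.Theory Num.Theory numFieldNormedType.Exports.

(* Lebesgue integration on the Stdlib reals; [J a b f] is meaningful only for [Bm1 f], i.e. [f] bounded and
   measurable, and [a <= b]. *)
Definition RR : realType := Rdefinitions.R.
Definition J (a b : R) (f : R -> R) : R := @I1 RR a b f.
Definition Bm1 (f : R -> R) : Prop := @bdm RR _ (measurableTypeR RR) f.
Definition Bm2 (f : R -> R -> R) : Prop :=
  @bdm RR _ (measurableTypeR RR * measurableTypeR RR)%type (fun z => f z.1 z.2).

Lemma Un_cvE (u : nat -> R) (l : R) : Un_cv u l <-> (u @ \oo --> (l : RR))%classic.
Proof.
split.
- move=> h; apply/(@cvgrPdist_lt RR RR) => e e0.
  have /RltP e0' := e0; have [N hN] := h e e0'.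
  exists N => // n /= Nn; rewrite distrC -RdistE; apply/RltP; apply: hN; exact/ssrnat.leP.
- move=> /(@cvgrPdist_lt RR RR) h e /RltP e0; have [N _ hN] := h e e0.
  exists N => n Nn; apply/RltP; rewrite RdistE distrC; apply: hN => /=; exact/ssrnat.leP.
Qed.

Lemma J_plus a b f g : Bm1 f -> Bm1 g -> J a b (fun x => f x + g x) = J a b f + J a b g.
Proof. exact: (@I1D RR). Qed.

Lemma J_scal a b f c : Bm1 f -> J a b (fun x => c * f x) = c * J a b f.
Proof. exact: (@I1Z RR). Qed.

Lemma J_le a b f g : Bm1 f -> Bm1 g -> (forall x, a <= x <= b -> f x <= g x) -> J a b f <= J a b g.
Proof.
move=> bf bg fg; apply/RleP; apply: (@I1_le RR) => // x /andP[/RleP ? /RleP ?]; apply/RleP; exact: fg.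
Qed.

Lemma J_const a b c : a <= b -> J a b (fun _ => c) = c * (b - a).
Proof. by move=> /RleP ab; exact: (@I1_cst RR). Qed.

Lemma J_chasles a b c f : Bm1 f -> a <= b -> b <= c -> J a c f = J a b f + J b c f.
Proof. by move=> bf /RleP ab /RleP bc; exact: (@I1_chasles RR). Qed.

Lemma J_lim a b (h : nat -> R -> R) f M : (forall n, Bm1 (h n)) -> Bm1 f ->
  (forall n x, a <= x <= b -> Rabs (h n x) <= M) ->
  (forall x, a <= x <= b -> Un_cv (fun n => h n x) (f x)) ->
  Un_cv (fun n => J a b (h n)) (J a b f).
Proof.
move=> bh bf hM hf; apply/Un_cvE; apply: (@I1_lim RR a b h f M) => //.
- by move=> n x /andP[/RleP ? /RleP ?]; rewrite -RabsE; apply/RleP; apply: hM.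
- by move=> x /andP[/RleP ? /RleP ?]; apply/Un_cvE; apply: hf.
Qed.

Lemma J_shift a b h f : Bm1 f -> J a b (fun x => f (x + h)) = J (a + h) (b + h) f.
Proof. exact: (@I1_shift RR). Qed.

Lemma J_fubini a b c d f : Bm2 f -> a <= b -> c <= d ->
  J a b (fun x => J c d (fun y => f x y)) = J c d (fun y => J a b (fun x => f x y)).
Proof. by move=> bf /RleP ab /RleP cd; exact: (@I1_fubini RR). Qed.

Lemma Bm1_const c : Bm1 (fun _ => c).
Proof. exact: (@bdm_cst RR). Qed.

Lemma Bm1_plus f g : Bm1 f -> Bm1 g -> Bm1 (fun x => f x + g x).
Proof. exact: (@bdmD RR). Qed.

Lemma Bm1_mult f g : Bm1 f -> Bm1 g -> Bm1 (fun x => f x * g x).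
Proof. exact: (@bdmM RR). Qed.

Lemma Bm1_cont f M : continuity f -> (forall x, Rabs (f x) <= M) -> Bm1 f.
Proof.
move=> cf fM; apply: (@bdm_continuous RR f M); last by move=> x; rewrite -RabsE; apply/RleP.
by move=> x; apply/continuity_ptE/cf.
Qed.

Lemma Bm2_const c : Bm2 (fun _ _ => c).
Proof. exact: (@bdm_cst RR). Qed.

Lemma Bm2_plus f g : Bm2 f -> Bm2 g -> Bm2 (fun x y => f x y + g x y).
Proof. exact: (@bdmD RR). Qed.

Lemma Bm2_mult f g : Bm2 f -> Bm2 g -> Bm2 (fun x y => f x y * g x y).
Proof. exact: (@bdmM RR). Qed.

Lemma Bm2_abs f : Bm2 f -> Bm2 (fun x y => Rabs (f x y)).
Proof.
move=> bf; rewrite (_ : (fun x y => _) = (fun x y => (`|f x y|)%R)); first exact: (@bdm_abs RR).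
by apply/funext => x; apply/funext => y; rewrite RabsE.
Qed.

Lemma Bm2_lim (h : nat -> R -> R -> R) f M : (forall n, Bm2 (h n)) ->
  (forall x y, Un_cv (fun n => h n x y) (f x y)) -> (forall x y, Rabs (f x y) <= M) -> Bm2 f.
Proof.
move=> bh hf fM; apply: (@bdm_lim RR _ (measurableTypeR RR * measurableTypeR RR)%type (fun n z => h n z.1 z.2) (fun z => f z.1 z.2) M) => //.
- by move=> z; apply/Un_cvE.
- by move=> z; rewrite -RabsE; apply/RleP.
Qed.

Lemma Bm2_sepcont f M : (forall y, continuity (fun x => f x y)) ->
  (forall x, continuity (f x)) -> (forall x y, Rabs (f x y) <= M) -> Bm2 f.
Proof.
move=> c1 c2 fM; apply: (@bdm_sepcont RR f M).
- by move=> y x; apply/continuity_ptE/c1.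
- by move=> y x; apply/continuity_ptE/c2.
- by move=> x y; rewrite -RabsE; apply/RleP.
Qed.

Lemma Bm2_sec1 f y : Bm2 f -> Bm1 (fun x => f x y).
Proof. exact: (@bdm_sec1 RR). Qed.

Lemma Bm2_sec2 f x : Bm2 f -> Bm1 (fun y => f x y).
Proof. exact: (@bdm_sec2 RR). Qed.

Lemma Bm2_swap f : Bm2 f -> Bm2 (fun x y => f y x).
Proof. exact: (@bdm_swap RR). Qed.

Lemma Bm2_shift f h : Bm2 f -> Bm2 (fun x y => f (x + h) y).
Proof. exact: (@bdm_shift RR). Qed.

Lemma Bm2_J f c d : Bm2 f -> Bm1 (fun x => J c d (fun y => f x y)).
Proof. exact: (@bdm_I1 RR). Qed.

Lemma Bm1_bounded f : Bm1 f -> exists M, forall x, Rabs (f x) <= M.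
Proof. by case=> _ [M fM]; exists M => x; apply/RleP; rewrite RabsE; exact: fM. Qed.
End Integral.
#[global] Opaque Integral.J Integral.Bm1 Integral.Bm2.
Import Integral ListNotations.

Lemma Rabs_bnd x K : Rabs x <= K -> - K <= x <= K.
Proof. intros h. pose proof (Rle_abs x). pose proof (Rle_abs (- x)). rewrite Rabs_Ropp in H0. lra. Qed.

Lemma J_ext a b f g : (forall x, f x = g x) -> J a b f = J a b g.
Proof.
intros h. replace g with f; [reflexivity|]. apply functional_extensionality; exact h.
Qed.

Lemma Bm1_ext f g : (forall x, f x = g x) -> Bm1 f -> Bm1 g.
Proof.
intros h. replace g with f; [tauto|]. apply functional_extensionality; exact h.
Qed.

Lemma Bm2_ext f g : (forall x y, f x y = g x y) -> Bm2 f -> Bm2 g.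
Proof.
intros h. replace g with f; [tauto|].
apply functional_extensionality; intros x; apply functional_extensionality; exact (h x).
Qed.

Lemma Bm1_scal c f : Bm1 f -> Bm1 (fun x => c * f x).
Proof. intros; apply Bm1_mult; [apply Bm1_const|assumption]. Qed.

Lemma Bm1_opp f : Bm1 f -> Bm1 (fun x => - f x).
Proof. intros h; apply (Bm1_ext (fun x => (-1) * f x)); [intros; ring|apply Bm1_scal; exact h]. Qed.

Lemma Bm1_minus f g : Bm1 f -> Bm1 g -> Bm1 (fun x => f x - g x).
Proof. intros; unfold Rminus; apply Bm1_plus; [|apply Bm1_opp]; assumption. Qed.

Lemma Bm2_scal c f : Bm2 f -> Bm2 (fun x y => c * f x y).
Proof. intros; apply Bm2_mult; [apply Bm2_const|assumption]. Qed.

Lemma Bm2_opp f : Bm2 f -> Bm2 (fun x y => - f x y).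
Proof. intros h; apply (Bm2_ext (fun x y => (-1) * f x y)); [intros; ring|apply Bm2_scal; exact h]. Qed.

Lemma Bm2_minus f g : Bm2 f -> Bm2 g -> Bm2 (fun x y => f x y - g x y).
Proof. intros; unfold Rminus; apply Bm2_plus; [|apply Bm2_opp]; assumption. Qed.

Lemma J_minus a b f g : Bm1 f -> Bm1 g -> J a b (fun x => f x - g x) = J a b f - J a b g.
Proof.
intros hf hg. rewrite (J_ext a b _ (fun x => f x + (-1) * g x)) by (intros; ring).
rewrite J_plus; [|assumption|apply Bm1_scal; assumption]. rewrite J_scal by assumption. ring.
Qed.

Lemma J_abs_le a b f K : Bm1 f -> a <= b -> (forall x, a <= x <= b -> Rabs (f x) <= K) ->
  Rabs (J a b f) <= K * (b - a).
Proof.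
intros hf ab h. apply Rabs_le. split.
- replace (- (K * (b - a))) with (- K * (b - a)) by ring.
  rewrite <- (J_const a b (- K) ab). apply J_le; [apply Bm1_const|assumption|].
  intros x hx; specialize (h x hx); apply Rabs_bnd in h; lra.
- rewrite <- (J_const a b K ab). apply J_le; [assumption|apply Bm1_const|].
  intros x hx; specialize (h x hx); apply Rabs_bnd in h; lra.
Qed.

Lemma J_abs_le_fun a b f g : Bm1 f -> Bm1 g -> (forall x, a <= x <= b -> Rabs (f x) <= g x) ->
  Rabs (J a b f) <= J a b g.
Proof.
intros hf hg h. apply Rabs_le. split.
- replace (- J a b g) with (J a b (fun x => (-1) * g x)) by (rewrite J_scal; [ring|assumption]).
  apply J_le; [apply Bm1_scal; assumption|assumption|].
  intros x hx; specialize (h x hx); apply Rabs_bnd in h; lra.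
- apply J_le; try assumption.
  intros x hx; specialize (h x hx); apply Rabs_bnd in h; lra.
Qed.

Lemma J_ge0 a b f : Bm1 f -> a <= b -> (forall x, a <= x <= b -> 0 <= f x) -> 0 <= J a b f.
Proof.
intros hf ab h. replace 0 with (0 * (b - a)) by ring. rewrite <- (J_const a b 0 ab).
apply J_le; [apply Bm1_const|assumption|exact h].
Qed.

(** * Iterated integrals over rectangles *)

Definition JJ a b c d (f : R -> R -> R) := J c d (fun t => J a b (fun x => f x t)).

Lemma Bm2_J1 f a b : Bm2 f -> Bm1 (fun t => J a b (fun x => f x t)).
Proof. intros h. apply (Bm2_J (fun t x => f x t)). apply Bm2_swap. exact h. Qed.

Lemma JJ_ext a b c d f g : (forall x t, f x t = g x t) -> JJ a b c d f = JJ a b c d g.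
Proof. intros h. apply J_ext; intros t; apply J_ext; intros x; apply h. Qed.

Lemma JJ_plus a b c d f g : Bm2 f -> Bm2 g ->
  JJ a b c d (fun x t => f x t + g x t) = JJ a b c d f + JJ a b c d g.
Proof.
intros hf hg. unfold JJ. rewrite <- J_plus by (apply Bm2_J1; assumption).
apply J_ext; intros t. apply (J_plus a b (fun x => f x t) (fun x => g x t)); apply Bm2_sec1; assumption.
Qed.

Lemma JJ_scal a b c d f k : Bm2 f -> JJ a b c d (fun x t => k * f x t) = k * JJ a b c d f.
Proof.
intros hf. unfold JJ. rewrite <- J_scal by (apply Bm2_J1; assumption).
apply J_ext; intros t. apply (J_scal a b (fun x => f x t)); apply Bm2_sec1; assumption.
Qed.

Lemma JJ_minus a b c d f g : Bm2 f -> Bm2 g ->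
  JJ a b c d (fun x t => f x t - g x t) = JJ a b c d f - JJ a b c d g.
Proof.
intros hf hg. rewrite (JJ_ext a b c d _ (fun x t => f x t + (-1) * g x t)) by (intros; ring).
rewrite JJ_plus; [|assumption|apply Bm2_scal; assumption]. rewrite JJ_scal by assumption. ring.
Qed.

Lemma JJ_le a b c d f g : Bm2 f -> Bm2 g ->
  (forall x t, a <= x <= b -> c <= t <= d -> f x t <= g x t) -> JJ a b c d f <= JJ a b c d g.
Proof.
intros hf hg h. apply J_le; try (apply Bm2_J1; assumption). intros t ht.
apply J_le; try (apply (Bm2_sec1 _ t); assumption). intros x hx; apply h; assumption.
Qed.

Lemma JJ_const a b c d k : a <= b -> c <= d -> JJ a b c d (fun _ _ => k) = k * (b - a) * (d - c).
Proof.
intros ab cd. unfold JJ. rewrite (J_ext c d _ (fun _ => k * (b - a))).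
- apply J_const; exact cd.
- intros t; apply (J_const a b k ab).
Qed.

Lemma JJ_abs_le_fun a b c d f g : Bm2 f -> Bm2 g ->
  (forall x t, a <= x <= b -> c <= t <= d -> Rabs (f x t) <= g x t) -> Rabs (JJ a b c d f) <= JJ a b c d g.
Proof.
intros hf hg h. apply J_abs_le_fun; try (apply Bm2_J1; assumption). intros t ht.
apply J_abs_le_fun; try (apply (Bm2_sec1 _ t); assumption). intros x hx; apply h; assumption.
Qed.

Lemma JJ_ge0 a b c d f : Bm2 f -> a <= b -> c <= d ->
  (forall x t, a <= x <= b -> c <= t <= d -> 0 <= f x t) -> 0 <= JJ a b c d f.
Proof.
intros hf ab cd h. apply J_ge0; [apply Bm2_J1; assumption|assumption|]. intros t ht.
apply J_ge0; [apply (Bm2_sec1 _ t); assumption|assumption|]. intros x hx; apply h; assumption.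
Qed.

Lemma JJ_chasles1 a m b c d f : Bm2 f -> a <= m -> m <= b -> JJ a b c d f = JJ a m c d f + JJ m b c d f.
Proof.
intros hf h1 h2. unfold JJ. rewrite <- J_plus by (apply Bm2_J1; assumption).
apply J_ext; intros t. apply J_chasles; try assumption. apply (Bm2_sec1 f t hf).
Qed.

Lemma JJ_chasles2 a b c m d f : Bm2 f -> c <= m -> m <= d -> JJ a b c d f = JJ a b c m f + JJ a b m d f.
Proof.
intros hf h1 h2. unfold JJ. apply J_chasles; try assumption. apply Bm2_J1; assumption.
Qed.

Lemma JJ_fubini a b c d f : Bm2 f -> a <= b -> c <= d -> JJ a b c d f = JJ c d a b (fun t x => f x t).
Proof. intros hf ab cd. unfold JJ. symmetry. apply J_fubini; assumption. Qed.

Lemma JJ_lim a b c d (h : nat -> R -> R -> R) f M : a <= b -> (forall n, Bm2 (h n)) -> Bm2 f ->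
  (forall n x t, a <= x <= b -> c <= t <= d -> Rabs (h n x t) <= M) ->
  (forall x t, a <= x <= b -> c <= t <= d -> Un_cv (fun n => h n x t) (f x t)) ->
  Un_cv (fun n => JJ a b c d (h n)) (JJ a b c d f).
Proof.
intros ab bh bf hM hf. unfold JJ.
apply (J_lim c d (fun n t => J a b (fun x => h n x t)) _ (M * (b - a))).
- intros n; apply Bm2_J1; apply bh.
- apply Bm2_J1; assumption.
- intros n t ht. apply J_abs_le; [apply (Bm2_sec1 _ t); apply bh|assumption|]. intros x hx; apply hM; assumption.
- intros t ht. apply (J_lim a b (fun n x => h n x t) _ M).
  + intros n; apply (Bm2_sec1 _ t); apply bh.
  + apply (Bm2_sec1 _ t); assumption.
  + intros n x hx; apply hM; assumption.
  + intros x hx; apply hf; assumption.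
Qed.

Lemma JJ_mono a b c d a' b' c' d' f : Bm2 f -> (forall x t, 0 <= f x t) ->
  a <= a' -> a' <= b' -> b' <= b -> c <= c' -> c' <= d' -> d' <= d -> JJ a' b' c' d' f <= JJ a b c d f.
Proof.
intros hf h0 h1 h2 h3 h4 h5 h6.
rewrite (JJ_chasles1 a a' b) by (assumption || lra).
rewrite (JJ_chasles1 a' b' b) by (assumption || lra).
rewrite (JJ_chasles2 a' b' c c' d) by (assumption || lra).
rewrite (JJ_chasles2 a' b' c' d' d) by (assumption || lra).
assert (H : forall a b c d, a <= b -> c <= d -> 0 <= JJ a b c d f).
{ intros; apply JJ_ge0; try assumption; intros; apply h0. }
pose proof (H a a' c d ltac:(lra) ltac:(lra)). pose proof (H b' b c d ltac:(lra) ltac:(lra)).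
pose proof (H a' b' c c' ltac:(lra) ltac:(lra)). pose proof (H a' b' d' d ltac:(lra) ltac:(lra)). lra.
Qed.

(** The supremum [s] of the points reachable from [a] can be crossed by the local hypothesis at [s].
    That hypothesis concerns only intervals containing [x], which is exactly what differentiability
    at [x] controls. *)
Lemma cousin (Phi : R -> R -> Prop) a b : a <= b ->
  (forall p m q, a <= p -> p <= m -> m <= q -> q <= b -> Phi p m -> Phi m q -> Phi p q) ->
  (forall x, a <= x <= b -> exists rho, 0 < rho /\
     forall p q, a <= p -> x - rho <= p -> p <= x -> x <= q -> q <= x + rho -> q <= b -> Phi p q) ->
  Phi a b.
Proof.
intros ab hadd hloc.
set (E := fun y => a <= y <= b /\ Phi a y).
assert (Ea : E a).
{ split; [lra|]. destruct (hloc a ltac:(lra)) as [rho [r0 h]]. apply h; lra. }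
destruct (completeness E) as [s [hs1 hs2]].
{ exists b. intros y [hy _]. lra. }
{ exists a; exact Ea. }
assert (sa : a <= s) by (apply hs1; exact Ea).
assert (sb : s <= b) by (apply hs2; intros y [hy _]; lra).
destruct (hloc s ltac:(lra)) as [rho [r0 h]].
assert (exists y, E y /\ s - rho < y) as [y [[hy1 hy2] hy3]].
{ apply NNPP; intros hn. assert (s <= s - rho); [|lra]. apply hs2. intros y hy.
  destruct (Rle_lt_dec y (s - rho)); [assumption|]. exfalso; apply hn; exists y; split; assumption. }
assert (ys : y <= s) by (apply hs1; split; assumption).
set (q := Rmin b (s + rho)).
assert (hq : s <= q /\ q <= b /\ q <= s + rho).
{ unfold q; repeat split; [apply Rmin_glb; lra|apply Rmin_l|apply Rmin_r]. }
assert (Eq : E q).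
{ split; [lra|]. apply (hadd a y q); try lra; [assumption|].
  apply h; lra. }
assert (q <= s) by (apply hs1; exact Eq).
assert (q = b).
{ unfold q in *. unfold Rmin in *. destruct (Rle_dec b (s + rho)); lra. }
rewrite <- H0. apply Eq.
Qed.

(** * Closed sets in the plane, distance to them and Lipschitz extension *)

Definition closed2 (F : R -> R -> Prop) := forall x t, ~ F x t ->
  exists rho, 0 < rho /\ forall y s, Rabs (y - x) <= rho -> Rabs (s - t) <= rho -> ~ F y s.

(** Cousin's lemma along the vertical segment; at each junction the smaller of the two radii is
    kept. *)
Lemma tube (F : R -> R -> Prop) x c d : closed2 F -> c <= d ->
  (forall t, c <= t <= d -> ~ F x t) ->
  exists rho, 0 < rho /\ forall y t, Rabs (y - x) <= rho -> c <= t <= d -> ~ F y t.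
Proof.
intros hF cd h.
apply (cousin (fun c d => exists rho, 0 < rho /\ forall y t, Rabs (y - x) <= rho -> c <= t <= d -> ~ F y t)); [assumption| |].
- intros p m q _ _ _ _ [r1 [h1 k1]] [r2 [h2 k2]]. exists (Rmin r1 r2).
  split; [apply Rmin_pos; assumption|]. intros y t hy ht.
  pose proof (Rmin_l r1 r2); pose proof (Rmin_r r1 r2).
  destruct (Rle_dec t m); [apply k1|apply k2]; lra.
- intros t ht. destruct (hF x t (h t ht)) as [rho [r0 k]]. exists rho; split; [assumption|].
  intros p q h1 h2 h3 h4 h5 h6. exists rho; split; [assumption|]. intros y s hy hs. apply k; [assumption|].
  apply Rabs_le; lra.
Qed.

(** The infimum of the abscissae is attained: if the column over it missed [F], [tube] would clear a
    neighbourhood of this column. The supremum of the opposites stands for the infimum. *)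
Lemma leftmost (F : R -> R -> Prop) a b c d : closed2 F -> c <= d ->
  (exists x t, a <= x <= b /\ c <= t <= d /\ F x t) ->
  exists x1 t1, a <= x1 <= b /\ c <= t1 <= d /\ F x1 t1 /\
    forall x t, a <= x <= b -> c <= t <= d -> F x t -> x1 <= x.
Proof.
intros hF cd [x [t [hx [ht hxt]]]].
set (E := fun y => exists x t, a <= x <= b /\ c <= t <= d /\ F x t /\ y = - x).
destruct (completeness E) as [s [hs1 hs2]].
{ exists (- a). intros y [x' [t' [h1 [h2 [h3 h4]]]]]. lra. }
{ exists (- x), x, t; auto. }
assert (s1 : - x <= s) by (apply hs1; exists x, t; auto).
assert (s2 : s <= - a) by (apply hs2; intros y [x' [t' [h1 [h2 [h3 h4]]]]]; lra).
destruct (classic (exists t, c <= t <= d /\ F (- s) t)) as [[t1 [ht1 hF1]]|hn].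
- exists (- s), t1. repeat split; try lra; try assumption.
  intros x' t' h1 h2 h3. assert (- x' <= s); [|lra]. apply hs1. exists x', t'; auto.
- exfalso. destruct (tube F (- s) c d hF cd) as [rho [r0 k]].
  { intros t' ht' hf; apply hn; exists t'; auto. }
  assert (s <= s - rho); [|lra]. apply hs2. intros y [x' [t' [h1 [h2 [h3 h4]]]]].
  destruct (Rle_lt_dec y (s - rho)); [assumption|]. exfalso. apply (k x' t'); try assumption.
  assert (y <= s) by (apply hs1; exists x', t'; auto). apply Rabs_le; lra.
Qed.

Lemma closed2_swap F : closed2 F -> closed2 (fun x t => F t x).
Proof. intros h x t hn. destruct (h t x hn) as [r [r0 k]]. exists r; split; [assumption|]; intros; apply k; assumption. Qed.

Lemma closed2_flip F : closed2 F -> closed2 (fun x t => F (- x) t).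
Proof.
intros h x t hn. destruct (h (- x) t hn) as [r [r0 k]]. exists r; split; [assumption|]; intros y s hy hs.
apply k; [|assumption]. replace (- y - - x) with (- (y - x)) by ring. rewrite Rabs_Ropp. assumption.
Qed.

Lemma rightmost (F : R -> R -> Prop) a b c d : closed2 F -> c <= d ->
  (exists x t, a <= x <= b /\ c <= t <= d /\ F x t) ->
  exists x1 t1, a <= x1 <= b /\ c <= t1 <= d /\ F x1 t1 /\
    forall x t, a <= x <= b -> c <= t <= d -> F x t -> x <= x1.
Proof.
intros hF cd [x [t [hx [ht hxt]]]].
destruct (leftmost (fun x t => F (- x) t) (- b) (- a) c d (closed2_flip F hF) cd) as [x1 [t1 [h1 [h2 [h3 h4]]]]].
{ exists (- x), t. rewrite Ropp_involutive. repeat split; try lra; assumption. }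
exists (- x1), t1. repeat split; try lra; try assumption.
intros x' t' k1 k2 k3. assert (x1 <= - x'); [|lra]. apply (h4 (- x') t'); try lra. rewrite Ropp_involutive; assumption.
Qed.

(** The stretch between [e] and the nearest point of [G] is free of [G], and over it [chi]
    integrates to at least its length. A distance to [G] is thus bounded by the integral of [chi]
    over the row, a quantity that can be integrated over the rows in turn. *)
Lemma row_near (G : R -> Prop) (chi : R -> R) a b e : Bm1 chi ->
  (forall x, 0 <= chi x) -> (forall x, ~ G x -> 1 <= chi x) ->
  (forall x, ~ G x -> exists rho, 0 < rho /\ forall y, Rabs (y - x) <= rho -> ~ G y) ->
  a <= e <= b ->
  b - a <= J a b chi \/ exists y, a <= y <= b /\ G y /\ Rabs (y - e) <= J a b chi.
Proof.
intros hchi h0 h1 hG he.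
destruct (classic (exists y, a <= y <= b /\ G y)) as [[y0 [hy0 Gy0]]|hn].
2:{ left. replace (b - a) with (1 * (b - a)) by ring. rewrite <- (J_const a b 1) by lra.
    apply J_le; [apply Bm1_const|assumption|]. intros x hx. apply h1. intros hg; apply hn; exists x; auto. }
right. apply NNPP; intros hn. set (dl := J a b chi) in *.
assert (hd : forall y, a <= y <= b -> G y -> dl < Rabs (y - e)).
{ intros y hy Gy. destruct (Rle_lt_dec (Rabs (y - e)) dl); [|assumption]. exfalso; apply hn; exists y; auto. }
assert (dl0 : 0 <= dl) by (apply J_ge0; [assumption|lra|intros; apply h0]).
pose proof (hd y0 hy0 Gy0) as hd0.
assert (low : forall p q, a <= p -> p <= q -> q <= b -> (forall x, p <= x <= q -> ~ G x) -> q - p <= dl).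
{ intros p q k1 k2 k3 k4. unfold dl. rewrite (J_chasles a p b chi hchi) by lra. rewrite (J_chasles p q b chi hchi) by lra.
  assert (0 <= J a p chi) by (apply J_ge0; [assumption|lra|intros; apply h0]).
  assert (0 <= J q b chi) by (apply J_ge0; [assumption|lra|intros; apply h0]).
  assert (1 * (q - p) <= J p q chi).
  { rewrite <- (J_const p q 1) by lra. apply J_le; [apply Bm1_const|assumption|]. intros; apply h1; apply k4; assumption. }
  lra. }
destruct (Rle_lt_dec e y0) as [hey|hey].
- rewrite Rabs_right in hd0 by lra.
  (* No point of [G] lies within [dl] of [e], and the complement of [G] is open: the free stretch
     from [e] extends strictly beyond length [dl], against [low]. *)
  assert (ng : ~ G (e + dl)).
  { intros hg. pose proof (hd (e + dl) ltac:(lra) hg). rewrite Rabs_right in H by lra. lra. }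
  destruct (hG _ ng) as [rho [r0 k]].
  set (q := Rmin (e + dl + rho) y0).
  assert (e + dl < q) by (apply Rmin_glb_lt; lra).
  assert (q <= e + dl + rho) by apply Rmin_l. assert (q <= y0) by apply Rmin_r.
  assert (q - e <= dl); [|lra]. apply low; try lra. intros x hx hg.
  destruct (Rle_lt_dec x (e + dl)).
  + pose proof (hd x ltac:(lra) hg). rewrite Rabs_right in H2 by lra. lra.
  + apply (k x); [|assumption]. apply Rabs_le; lra.
- rewrite Rabs_left in hd0 by lra.
  assert (ng : ~ G (e - dl)).
  { intros hg. pose proof (hd (e - dl) ltac:(lra) hg). rewrite Rabs_left1 in H by lra. lra. }
  destruct (hG _ ng) as [rho [r0 k]].
  set (q := Rmax (e - dl - rho) y0).
  assert (q < e - dl) by (apply Rmax_lub_lt; lra).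
  assert (e - dl - rho <= q) by apply Rmax_l. assert (y0 <= q) by apply Rmax_r.
  assert (e - q <= dl); [|lra]. apply low; try lra. intros x hx hg.
  destruct (Rle_lt_dec (e - dl) x).
  + pose proof (hd x ltac:(lra) hg). rewrite Rabs_left1 in H2 by lra. lra.
  + apply (k x); [|assumption]. apply Rabs_le; lra.
Qed.

(** McShane's formula, the infimum over [E] of [f y s] plus [N] times the distance, capped by [M] so
    that the extension keeps the bound. The infimum is encoded as the greatest [c] below all these
    values; the last clause records this maximality, which later gives the positivity of a distance
    function. *)
Lemma mcshane (E : R -> R -> Prop) (f : R -> R -> R) N M : 0 <= N ->
  (exists x t, E x t) -> (forall x t, Rabs (f x t) <= M) ->
  (forall x t y s, E x t -> E y s -> f x t <= f y s + N * (Rabs (x - y) + Rabs (t - s))) ->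
  exists k : R -> R -> R, (forall x t, E x t -> k x t = f x t) /\
    (forall x t y s, Rabs (k x t - k y s) <= N * (Rabs (x - y) + Rabs (t - s))) /\
    (forall x t, Rabs (k x t) <= M) /\
    (forall x t c, c <= M -> (forall y s, E y s -> c <= f y s + N * (Rabs (x - y) + Rabs (t - s))) -> c <= k x t).
Proof.
intros N0 [x0 [t0 E0]] hM hL.
assert (ex : forall x t, exists k, k <= M /\ (forall y s, E y s -> k <= f y s + N * (Rabs (x - y) + Rabs (t - s))) /\
  (forall c, c <= M -> (forall y s, E y s -> c <= f y s + N * (Rabs (x - y) + Rabs (t - s))) -> c <= k)).
{ intros x t.
  destruct (completeness (fun c => c <= M /\ forall y s, E y s -> c <= f y s + N * (Rabs (x - y) + Rabs (t - s)))) as [s [h1 h2]].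
  - exists M. intros c [hc _]; exact hc.
  - exists (- M). split; [pose proof (hM x t); pose proof (Rabs_pos (f x t)); lra|].
    intros y s _. pose proof (hM y s). apply Rabs_bnd in H.
    pose proof (Rabs_pos (x - y)); pose proof (Rabs_pos (t - s)). nra.
  - exists s. repeat split.
    + apply h2. intros c [hc _]; exact hc.
    + intros y s' hE. apply h2. intros c [_ hc]; apply hc; exact hE.
    + intros c c1 c2. apply h1; split; assumption. }
set (k := fun x t => proj1_sig (constructive_indefinite_description _ (ex x t))).
assert (hk : forall x t, k x t <= M /\ (forall y s, E y s -> k x t <= f y s + N * (Rabs (x - y) + Rabs (t - s))) /\
  (forall c, c <= M -> (forall y s, E y s -> c <= f y s + N * (Rabs (x - y) + Rabs (t - s))) -> c <= k x t)).
{ intros x t. unfold k. apply (proj2_sig (constructive_indefinite_description _ (ex x t))). }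
clearbody k.
assert (lip : forall x t y s, k x t - N * (Rabs (x - y) + Rabs (t - s)) <= k y s).
{ intros x t y s. destruct (hk y s) as [_ [_ h3]]. destruct (hk x t) as [g1 [g2 _]]. apply h3.
  - pose proof (Rabs_pos (x - y)); pose proof (Rabs_pos (t - s)). nra.
  - intros y' s' hE. specialize (g2 y' s' hE).
    assert (Rabs (x - y') <= Rabs (x - y) + Rabs (y - y')).
    { replace (x - y') with ((x - y) + (y - y')) by ring. apply Rabs_triang. }
    assert (Rabs (t - s') <= Rabs (t - s) + Rabs (s - s')).
    { replace (t - s') with ((t - s) + (s - s')) by ring. apply Rabs_triang. }
    nra. }
exists k. repeat split.
- intros x t hE. destruct (hk x t) as [_ [h2 h3]]. apply Rle_antisym.
  + specialize (h2 x t hE). unfold Rminus in h2. rewrite !Rplus_opp_r, Rabs_R0 in h2. lra.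
  + apply h3; [pose proof (hM x t) as hh; apply Rabs_bnd in hh; lra|]. intros; apply hL; assumption.
- intros x t y s. apply Rabs_le. pose proof (lip x t y s). pose proof (lip y s x t).
  rewrite (Rabs_minus_sym y x), (Rabs_minus_sym s t) in H0. lra.
- intros x t. apply Rabs_le. split; [|apply hk]. apply hk.
  + pose proof (hM x t); pose proof (Rabs_pos (f x t)); lra.
  + intros y s _. pose proof (hM y s). apply Rabs_bnd in H.
    pose proof (Rabs_pos (x - y)); pose proof (Rabs_pos (t - s)). nra.
- intros x t c h1 h2. apply hk; assumption.
Qed.

Lemma lip_continuity (f : R -> R) N : (forall x y, Rabs (f x - f y) <= N * Rabs (x - y)) -> continuity f.
Proof.
intros h x eps e0. exists (eps / (Rabs N + 1)).
pose proof (Rabs_pos N). split; [apply Rdiv_lt_0_compat; lra|].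
intros y [_ hy]. simpl in *. unfold Rdist in *.
apply Rle_lt_trans with (1 := h y x). pose proof (Rle_abs N). pose proof (Rabs_pos (y - x)).
apply Rle_lt_trans with ((Rabs N + 1) * Rabs (y - x)); [nra|].
apply Rmult_lt_reg_r with (/ (Rabs N + 1)); [apply Rinv_0_lt_compat; lra|].
replace ((Rabs N + 1) * Rabs (y - x) * / (Rabs N + 1)) with (Rabs (y - x)) by (field; lra). exact hy.
Qed.

Lemma lip2_Bm2 k N M : (forall x t y s, Rabs (k x t - k y s) <= N * (Rabs (x - y) + Rabs (t - s))) ->
  (forall x t, Rabs (k x t) <= M) -> Bm2 k.
Proof.
intros h hM. apply (Bm2_sepcont k M); [| |exact hM].
- intros t. apply (lip_continuity _ N). intros x y. specialize (h x t y t).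
  rewrite Rminus_diag, Rabs_R0, Rplus_0_r in h. exact h.
- intros x. apply (lip_continuity _ N). intros t s. specialize (h x t x s).
  rewrite Rminus_diag, Rabs_R0, Rplus_0_l in h. exact h.
Qed.

Lemma Un_cv_inv : Un_cv (fun n => / (INR n + 1)) 0.
Proof.
intros eps e0. destruct (archimed_cor1 eps e0) as [N [h1 h2]]. exists N. intros n hn.
unfold Rdist. rewrite Rminus_0_r. pose proof (pos_INR n).
rewrite Rabs_right; [|apply Rle_ge; left; apply Rinv_0_lt_compat; lra].
apply Rlt_trans with (2 := h1). apply Rinv_lt_contravar.
- apply Rmult_lt_0_compat; [apply lt_0_INR; lia|lra].
- apply le_INR in hn. lra.
Qed.

(** [dF] is the distance to [F] truncated at 1, obtained as the McShane extension of 0. The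
    indicator [chi] of the complement is the limit of [dF / (dF + 1 / (n + 1))], whence its
    measurability. *)
Lemma indicator (F : R -> R -> Prop) : closed2 F -> (exists x t, F x t) ->
  exists chi dF : R -> R -> R,
   Bm2 chi /\ Bm2 dF /\ (forall x t, F x t -> chi x t = 0) /\ (forall x t, ~ F x t -> chi x t = 1) /\
   (forall x t, 0 <= dF x t <= 1) /\ (forall x t, ~ F x t -> 0 < dF x t) /\
   (forall x t y s, F y s -> dF x t <= Rabs (x - y) + Rabs (t - s)).
Proof.
intros hF hne.
destruct (mcshane F (fun _ _ => 0) 1 1) as [k [h1 [h2 [h3 h4]]]]; [lra|exact hne|intros; rewrite Rabs_R0; lra| |].
{ intros. pose proof (Rabs_pos (x - y)); pose proof (Rabs_pos (t - s)). lra. }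
assert (k0 : forall x t, 0 <= k x t <= 1).
{ intros x t. split; [|pose proof (h3 x t) as hh; apply Rabs_bnd in hh; lra]. apply h4; [lra|].
  intros y s _. pose proof (Rabs_pos (x - y)); pose proof (Rabs_pos (t - s)). lra. }
assert (kpos : forall x t, ~ F x t -> 0 < k x t).
{ intros x t hn. destruct (hF x t hn) as [rho [r0 hr]].
  apply Rlt_le_trans with (Rmin 1 rho); [apply Rmin_pos; lra|]. apply h4; [apply Rmin_l|].
  intros y s hE. apply Rle_trans with (1 := Rmin_r 1 rho).
  destruct (Rle_lt_dec (Rabs (x - y)) rho).
  - destruct (Rle_lt_dec (Rabs (t - s)) rho); [|pose proof (Rabs_pos (x - y)); lra].
    exfalso; apply (hr y s); try assumption; rewrite Rabs_minus_sym; assumption.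
  - pose proof (Rabs_pos (t - s)); lra. }
assert (bk : Bm2 k) by (apply (lip2_Bm2 k 1 1); assumption).
set (chi := fun x t => if excluded_middle_informative (F x t) then 0 else 1).
exists chi, k. split; [|split; [exact bk|split; [|split; [|split; [exact k0|split; [exact kpos|]]]]]].
- apply (Bm2_lim (fun n x t => k x t * / (k x t + / (INR n + 1))) chi 1).
  + intros n. apply Bm2_mult; [exact bk|]. pose proof (pos_INR n).
    assert (in0 : 0 < / (INR n + 1)) by (apply Rinv_0_lt_compat; lra).
    apply (lip2_Bm2 _ (1 / (/ (INR n + 1) * / (INR n + 1))) (/ / (INR n + 1))).
    * intros x t y s. set (dl := / (INR n + 1)) in *.
      pose proof (proj1 (k0 x t)); pose proof (proj1 (k0 y s)).
      replace (/ (k x t + dl) - / (k y s + dl)) with ((k y s - k x t) * / ((k x t + dl) * (k y s + dl))) by (field; lra).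
      rewrite Rabs_mult. rewrite (Rabs_right (/ _)).
      2:{ apply Rle_ge; left; apply Rinv_0_lt_compat; apply Rmult_lt_0_compat; lra. }
      rewrite Rmult_comm. replace (1 / (dl * dl)) with (/ (dl * dl)) by (field; lra).
      apply Rmult_le_compat; try apply Rabs_pos.
      -- left; apply Rinv_0_lt_compat; apply Rmult_lt_0_compat; lra.
      -- apply Rinv_le_contravar; [apply Rmult_lt_0_compat; lra|]. apply Rmult_le_compat; lra.
      -- rewrite Rabs_minus_sym. specialize (h2 x t y s). lra.
    * intros x t. pose proof (proj1 (k0 x t)). rewrite Rabs_right.
      2:{ apply Rle_ge; left; apply Rinv_0_lt_compat; lra. }
      apply Rinv_le_contravar; lra.
  + intros x t. unfold chi. destruct (excluded_middle_informative (F x t)) as [hf|hf].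
    * rewrite (h1 x t hf). intros eps e0. exists 0%nat. intros n _. unfold Rdist.
      rewrite Rmult_0_l, Rminus_0_r, Rabs_R0. exact e0.
    * pose proof (kpos x t hf) as kp. intros eps e0.
      destruct (Un_cv_inv (eps * k x t)) as [N hN]; [apply Rmult_lt_0_compat; assumption|].
      exists N. intros n hn. specialize (hN n hn). unfold Rdist in *. rewrite Rminus_0_r in hN.
      pose proof (pos_INR n).
      assert (in0 : 0 < / (INR n + 1)) by (apply Rinv_0_lt_compat; lra).
      set (dl := / (INR n + 1)) in *. rewrite Rabs_right in hN by lra.
      replace (k x t * / (k x t + dl) - 1) with (- (dl * / (k x t + dl))) by (field; lra).
      rewrite Rabs_Ropp, Rabs_right.
      2:{ apply Rle_ge; left. apply Rmult_lt_0_compat; [assumption|apply Rinv_0_lt_compat; lra]. }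
      apply Rmult_lt_reg_r with (k x t + dl); [lra|].
      rewrite Rmult_assoc, Rinv_l by lra. nra.
  + intros x t. unfold chi. destruct (excluded_middle_informative (F x t)); [rewrite Rabs_R0; lra|rewrite Rabs_R1; lra].
- intros x t hf. unfold chi. destruct (excluded_middle_informative (F x t)); [reflexivity|contradiction].
- intros x t hf. unfold chi. destruct (excluded_middle_informative (F x t)); [contradiction|reflexivity].
- intros x t y s hf. pose proof (h2 x t y s) as hh. rewrite (h1 y s hf) in hh. apply Rabs_bnd in hh. lra.
Qed.

(** * The divergence theorem for separately differentiable functions *)

(** The flux of ([P], [S]) out of the rectangle minus the integral of [g]: the defect in the
    divergence theorem. *)
Definition Div (P S g : R -> R -> R) a b c d :=
  J c d (fun t => P b t - P a t) + J a b (fun x => S x d - S x c) - JJ a b c d g.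

Lemma Bm2_shift2 f h : Bm2 f -> Bm2 (fun x y => f x (y + h)).
Proof. intros hf. apply (Bm2_swap (fun y x => f x (y + h))). apply (Bm2_shift (fun y x => f x y)). apply Bm2_swap; exact hf. Qed.

Lemma Un_cv_squeeze0 (u v : nat -> R) : (forall n, Rabs (u n) <= v n) -> Un_cv v 0 -> Un_cv u 0.
Proof.
intros h hv eps e0. destruct (hv eps e0) as [N hN]. exists N. intros n hn. specialize (hN n hn).
unfold Rdist in *. rewrite Rminus_0_r in *. pose proof (h n). pose proof (Rle_abs (v n)). lra.
Qed.

Lemma Un_cv_const c : Un_cv (fun _ => c) c.
Proof. intros eps e0. exists 0%nat. intros. unfold Rdist. rewrite Rminus_diag, Rabs_R0. exact e0. Qed.

Lemma Un_cv_ext u v l : (forall n, u n = v n) -> Un_cv u l -> Un_cv v l.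
Proof. intros h hu eps e0. destruct (hu eps e0) as [N hN]. exists N. intros n hn. rewrite <- h. apply hN; exact hn. Qed.

Lemma cont_seq f x u : continuity_pt f x -> Un_cv u x -> Un_cv (fun n => f (u n)) (f x).
Proof. intros hf hu. apply continuity_seq; assumption. Qed.

Lemma Un_cv_scal c u : Un_cv u 0 -> Un_cv (fun n => c * u n) 0.
Proof. intros hu. rewrite <- (Rmult_0_r c). apply CV_mult; [apply Un_cv_const|exact hu]. Qed.

Section Basic.
Variables P S g : R -> R -> R.
Variable M : R.
Hypothesis bP : Bm2 P.
Hypothesis bS : Bm2 S.
Hypothesis bg : Bm2 g.
Local Notation D := (Div P S g).

Let s1 x : Bm1 (fun t => P x t). Proof. apply (Bm2_sec2 P x bP). Qed.

Let s2 t : Bm1 (fun x => S x t). Proof. apply (Bm2_sec1 S t bS). Qed.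

Let JP p q c d : J c d (fun t => P q t - P p t) = J c d (P q) - J c d (P p).
Proof. apply J_minus; apply s1. Qed.

Let JS p q a b : J a b (fun x => S x q - S x p) = J a b (fun x => S x q) - J a b (fun x => S x p).
Proof. apply J_minus; apply s2. Qed.

Lemma Div_split1 a m b c d : a <= m -> m <= b -> D a b c d = D a m c d + D m b c d.
Proof.
intros h1 h2. unfold Div. rewrite (JJ_chasles1 a m b) by assumption.
rewrite (J_chasles a m b) by (try assumption; apply Bm1_minus; apply s2).
rewrite !JP. ring.
Qed.

Lemma Div_split2 a b c m d : c <= m -> m <= d -> D a b c d = D a b c m + D a b m d.
Proof.
intros h1 h2. unfold Div. rewrite (JJ_chasles2 a b c m d) by assumption.
rewrite (J_chasles c m d) by (try assumption; apply Bm1_minus; apply s1).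
rewrite !JS. ring.
Qed.

Lemma Div_swap a b c d : a <= b -> c <= d ->
  D a b c d = Div (fun t x => S x t) (fun t x => P x t) (fun t x => g x t) c d a b.
Proof. intros h1 h2. unfold Div. rewrite (JJ_fubini a b c d) by assumption. ring. Qed.

Lemma Div_self1 a c d : D a a c d = 0.
Proof. pose proof (Div_split1 a a a c d ltac:(lra) ltac:(lra)). lra. Qed.

Lemma Div_self2 a b c : D a b c c = 0.
Proof. pose proof (Div_split2 a b c c c ltac:(lra) ltac:(lra)). lra. Qed.

Hypothesis cP : forall t, continuity (fun x => P x t).
Hypothesis mP : forall x t, Rabs (P x t) <= M.
Hypothesis mS : forall x t, Rabs (S x t) <= M.
Hypothesis mg : forall x t, Rabs (g x t) <= M.

(** On the two long sides, continuity of [P] in [x] and dominated convergence apply; the short sides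
    and the area contribute at most a multiple of the width. *)
Lemma Div_thin p q x c d : c <= d -> (forall n, p n <= q n) -> Un_cv p x -> Un_cv q x ->
  Un_cv (fun n => D (p n) (q n) c d) 0.
Proof.
intros cd pq hp hq. unfold Div.
replace 0 with (0 + 0 - 0) by ring. apply CV_minus; [apply CV_plus|].
- replace 0 with (J c d (fun _ => 0)) by (rewrite J_const; [ring|assumption]).
  apply (J_lim c d (fun n t => P (q n) t - P (p n) t) _ (2 * M)).
  + intros n; apply Bm1_minus; apply s1.
  + apply Bm1_const.
  + intros n t _. pose proof (Rabs_bnd _ _ (mP (q n) t)); pose proof (Rabs_bnd _ _ (mP (p n) t)). apply Rabs_le; lra.
  + intros t _. replace 0 with (P x t - P x t) by ring.
    apply CV_minus; apply (cont_seq (fun x => P x t)); try assumption; apply cP.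
- apply (Un_cv_squeeze0 _ (fun n => 2 * M * (q n - p n))).
  + intros n. apply J_abs_le; [apply Bm1_minus; apply s2|apply pq|].
    intros y _. pose proof (Rabs_bnd _ _ (mS y d)); pose proof (Rabs_bnd _ _ (mS y c)). apply Rabs_le; lra.
  + apply Un_cv_scal. replace 0 with (x - x) by ring. apply CV_minus; assumption.
- apply (Un_cv_squeeze0 _ (fun n => M * (d - c) * (q n - p n))).
  + intros n. replace (M * (d - c) * (q n - p n)) with (M * (q n - p n) * (d - c)) by ring.
    apply J_abs_le; [apply (Bm2_J1 g _ _ bg)|assumption|]. intros t _.
    apply J_abs_le; [apply (Bm2_sec1 g t bg)|apply pq|]. intros y _; apply mg.
  + apply Un_cv_scal. replace 0 with (x - x) by ring. apply CV_minus; assumption.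
Qed.

Lemma Div_lim1 an bn a b c d : c <= d -> (forall n, a <= an n /\ an n <= bn n /\ bn n <= b) ->
  Un_cv an a -> Un_cv bn b -> (forall n, D (an n) (bn n) c d = 0) -> D a b c d = 0.
Proof.
intros cd h ha hb h0.
apply (UL_sequence (fun n => D a (an n) c d + D (bn n) b c d)).
- apply (Un_cv_ext (fun _ => D a b c d)); [|apply Un_cv_const].
  intros n. destruct (h n) as [k1 [k2 k3]].
  rewrite (Div_split1 a (an n) b) by lra. rewrite (Div_split1 (an n) (bn n) b) by lra. rewrite h0. ring.
- replace 0 with (0 + 0) by ring. apply CV_plus.
  + apply (Div_thin (fun _ => a) an a); try assumption; [intros; apply h|apply Un_cv_const].
  + apply (Div_thin bn (fun _ => b) b); try assumption; [intros; apply h|apply Un_cv_const].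
Qed.
End Basic.

(** All small rectangles near the point are required, not only those that contain it; this makes the
    set of good points open. *)
Definition good P S g x t := exists rho, 0 < rho /\ forall a b c d,
  x - rho <= a -> a <= b -> b <= x + rho -> t - rho <= c -> c <= d -> d <= t + rho -> Div P S g a b c d = 0.
Definition bad P S g x t := ~ good P S g x t.

Lemma bad_closed P S g : closed2 (bad P S g).
Proof.
intros x t hn. apply NNPP in hn. destruct hn as [rho [r0 h]]. exists (rho / 2). split; [lra|].
intros y s hy hs hb. apply hb. exists (rho / 2). split; [lra|].
apply Rabs_bnd in hy; apply Rabs_bnd in hs. intros; apply h; lra.
Qed.

Section Cover.
Variables P S g : R -> R -> R.
Hypothesis bP : Bm2 P.
Hypothesis bS : Bm2 S.
Hypothesis bg : Bm2 g.
Local Notation D := (Div P S g).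

(** Cousin's lemma twice: along each column, to get a width valid on its whole height, then across
    the columns. *)
Lemma Div_cover a b c d : a <= b -> c <= d ->
  (forall x t, a <= x <= b -> c <= t <= d -> good P S g x t) -> D a b c d = 0.
Proof.
intros ab cd h.
assert (H : forall x, a <= x <= b -> exists rho, 0 < rho /\ forall a' b' c' d',
   x - rho <= a' -> a' <= b' -> b' <= x + rho -> c <= c' -> c' <= d' -> d' <= d -> D a' b' c' d' = 0).
{ intros x hx.
  apply (cousin (fun c d => exists rho, 0 < rho /\ forall a' b' c' d',
   x - rho <= a' -> a' <= b' -> b' <= x + rho -> c <= c' -> c' <= d' -> d' <= d -> D a' b' c' d' = 0)); [assumption| |].
  - intros p m q _ pm mq _ [r1 [h1 k1]] [r2 [h2 k2]]. exists (Rmin r1 r2).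
    split; [apply Rmin_pos; assumption|]. pose proof (Rmin_l r1 r2); pose proof (Rmin_r r1 r2).
    intros a' b' c' d' g1 g2 g3 g4 g5 g6.
    destruct (Rle_dec d' m); [apply k1; lra|]. destruct (Rle_dec m c'); [apply k2; lra|].
    rewrite (Div_split2 P S g bP bS bg a' b' c' m d') by lra.
    rewrite k1, k2 by lra. ring.
  - intros t ht. destruct (h x t hx ht) as [rho [r0 k]]. exists rho; split; [assumption|].
    intros p q q1 q2 q3 q4 q5 q6. exists rho; split; [assumption|]. intros; apply k; lra. }
apply (cousin (fun a b => D a b c d = 0)); [assumption| |].
- intros p m q _ pm mq _ e1 e2. rewrite (Div_split1 P S g bP bS bg p m q) by lra. rewrite e1, e2. ring.
- intros x hx. destruct (H x hx) as [rho [r0 k]]. exists rho; split; [assumption|]. intros; apply k; lra.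
Qed.
End Cover.

(** Increments are controlled only along the cross through the point, which is all that separate
    derivatives provide. The same [N] bounds the slope and limits the range, so that the sets for
    integer [N] cover the plane. *)
Definition lip_at (P : R -> R -> R) N x t := forall h, Rabs h < / N ->
  Rabs (P (x + h) t - P x t) <= N * Rabs h /\ Rabs (P x (t + h) - P x t) <= N * Rabs h.

Lemma cont_delta f x eps : continuity_pt f x -> 0 < eps ->
  exists dl, 0 < dl /\ forall y, Rabs (y - x) < dl -> Rabs (f y - f x) < eps.
Proof.
intros h e0. destruct (h eps e0) as [dl [d0 k]]. exists dl; split; [exact d0|].
intros y hy. destruct (Req_dec x y) as [->|ne]; [rewrite Rminus_diag, Rabs_R0; exact e0|].
apply k. split; [split; [exact I|exact ne]|exact hy].
Qed.

(* separate continuity suffices: a nearby point of the set controls a whole cross *)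
Lemma lip_at_closed P N x t : 0 < N -> (forall t, continuity (fun x => P x t)) -> (forall x, continuity (P x)) ->
  (forall rho, 0 < rho -> exists y s, Rabs (y - x) < rho /\ Rabs (s - t) < rho /\ lip_at P N y s) -> lip_at P N x t.
Proof.
intros N0 c1 c2 H h hh.
assert (key : forall eps, 0 < eps -> Rabs (P (x + h) t - P x t) <= N * Rabs h + eps /\ Rabs (P x (t + h) - P x t) <= N * Rabs h + eps).
{ intros eps e0.
  destruct (cont_delta (P (x + h)) t (eps / 4) (c2 _ _) ltac:(lra)) as [d1 [p1 k1]].
  destruct (cont_delta (P x) t (eps / 4) (c2 _ _) ltac:(lra)) as [d2 [p2 k2]].
  destruct (cont_delta (fun x => P x (t + h)) x (eps / 4) (c1 _ _) ltac:(lra)) as [d3 [p3 k3]].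
  destruct (cont_delta (fun x => P x t) x (eps / 4) (c1 _ _) ltac:(lra)) as [d4 [p4 k4]].
  set (d5 := / N - Rabs h). set (d6 := eps / (8 * N)).
  assert (p5 : 0 < d5) by (unfold d5; lra). assert (p6 : 0 < d6) by (apply Rdiv_lt_0_compat; lra).
  assert (e6 : N * d6 = eps / 8) by (unfold d6; field; lra).
  set (rho := Rmin (Rmin (Rmin d1 d2) (Rmin d3 d4)) (Rmin d5 d6)).
  assert (r0 : 0 < rho) by (unfold rho; repeat apply Rmin_pos; assumption).
  assert (hr : rho <= d1 /\ rho <= d2 /\ rho <= d3 /\ rho <= d4 /\ rho <= d5 /\ rho <= d6).
  { unfold rho. pose proof (Rmin_l (Rmin (Rmin d1 d2) (Rmin d3 d4)) (Rmin d5 d6)).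
    pose proof (Rmin_r (Rmin (Rmin d1 d2) (Rmin d3 d4)) (Rmin d5 d6)).
    pose proof (Rmin_l (Rmin d1 d2) (Rmin d3 d4)). pose proof (Rmin_r (Rmin d1 d2) (Rmin d3 d4)).
    pose proof (Rmin_l d1 d2); pose proof (Rmin_r d1 d2). pose proof (Rmin_l d3 d4); pose proof (Rmin_r d3 d4).
    pose proof (Rmin_l d5 d6); pose proof (Rmin_r d5 d6). repeat split; lra. }
  destruct hr as [hr1 [hr2 [hr3 [hr4 [hr5 hr6]]]]].
  destruct (H rho r0) as [y [s [hy [hs A]]]].
  assert (abs1 : Rabs (x - y) < rho) by (rewrite Rabs_minus_sym; exact hy).
  assert (abs2 : Rabs (t - s) < rho) by (rewrite Rabs_minus_sym; exact hs).
  assert (tr : forall u v w, Rabs (u - v) <= N * w -> 0 <= w -> w <= Rabs h + rho ->  Rabs (u - v) <= N * Rabs h + eps / 8).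
  { intros u v w q1 q2 q3. assert (N * w <= N * (Rabs h + rho)) by (apply Rmult_le_compat_l; lra).
    assert (N * rho <= N * d6) by (apply Rmult_le_compat_l; lra). lra. }
  assert (tr' : forall u v w, Rabs (u - v) <= N * w -> w <= rho ->  Rabs (u - v) <= eps / 8).
  { intros u v w q1 q3. assert (N * w <= N * rho) by (apply Rmult_le_compat_l; lra).
    assert (N * rho <= N * d6) by (apply Rmult_le_compat_l; lra). lra. }
  split.
  - pose proof (Rabs_triang (x - y) h).
    destruct (A (x + h - y)) as [a1 _]; [replace (x + h - y) with (x - y + h) by ring; unfold d5 in *; lra|].
    replace (y + (x + h - y)) with (x + h) in a1 by ring.
    apply tr in a1; [|apply Rabs_pos|replace (x + h - y) with (x - y + h) by ring; lra].
    destruct (A (x - y)) as [a2 _]; [unfold d5 in *; pose proof (Rabs_pos h); lra|].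
    replace (y + (x - y)) with x in a2 by ring. apply tr' in a2; [|lra].
    specialize (k1 s ltac:(lra)). specialize (k2 s ltac:(lra)).
    apply Rabs_bnd in a1; apply Rabs_bnd in a2. apply Rlt_le, Rabs_bnd in k1; apply Rlt_le, Rabs_bnd in k2.
    apply Rabs_le; lra.
  - pose proof (Rabs_triang (t - s) h).
    destruct (A (t + h - s)) as [_ a1]; [replace (t + h - s) with (t - s + h) by ring; unfold d5 in *; lra|].
    replace (s + (t + h - s)) with (t + h) in a1 by ring.
    apply tr in a1; [|apply Rabs_pos|replace (t + h - s) with (t - s + h) by ring; lra].
    destruct (A (t - s)) as [_ a2]; [unfold d5 in *; pose proof (Rabs_pos h); lra|].
    replace (s + (t - s)) with t in a2 by ring. apply tr' in a2; [|lra].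
    specialize (k3 y ltac:(lra)). specialize (k4 y ltac:(lra)).
    apply Rabs_bnd in a1; apply Rabs_bnd in a2. apply Rlt_le, Rabs_bnd in k3; apply Rlt_le, Rabs_bnd in k4.
    apply Rabs_le; lra. }
split; apply le_epsilon; intros eps e0; apply key; assumption.
Qed.

Lemma deriv_lip f x l : derivable_pt_lim f x l ->
  exists dl, 0 < dl /\ forall h, Rabs h < dl -> Rabs (f (x + h) - f x) <= (Rabs l + 1) * Rabs h.
Proof.
intros hd. destruct (hd 1 ltac:(lra)) as [dl k]. exists dl; split; [apply cond_pos|].
intros h hh. destruct (Req_dec h 0) as [->|ne].
- rewrite Rplus_0_r, Rminus_diag, !Rabs_R0. lra.
- specialize (k h ne hh).
  replace (f (x + h) - f x) with (((f (x + h) - f x) / h - l + l) * h) by (field; exact ne).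
  rewrite Rabs_mult. apply Rmult_le_compat_r; [apply Rabs_pos|].
  apply Rle_trans with (1 := Rabs_triang _ _). lra.
Qed.

Lemma lip_at_ex P x t px pt : derivable_pt_lim (fun x => P x t) x px -> derivable_pt_lim (P x) t pt ->
  exists n0 : nat, forall n, (n0 <= n)%nat -> lip_at P (INR n + 1) x t.
Proof.
intros h1 h2. destruct (deriv_lip _ _ _ h1) as [d1 [p1 k1]]. destruct (deriv_lip _ _ _ h2) as [d2 [p2 k2]].
destruct (INR_unbounded (Rabs px + Rabs pt + / d1 + / d2)) as [n0 hn0].
exists n0. intros n hn. apply le_INR in hn.
pose proof (Rabs_pos px); pose proof (Rabs_pos pt).
pose proof (Rinv_0_lt_compat _ p1); pose proof (Rinv_0_lt_compat _ p2).
intros h hh. pose proof (Rabs_pos h).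
assert (q1 : / (INR n + 1) < d1).
{ rewrite <- (Rinv_inv d1). apply Rinv_lt_contravar; [apply Rmult_lt_0_compat; lra|lra]. }
assert (q2 : / (INR n + 1) < d2).
{ rewrite <- (Rinv_inv d2). apply Rinv_lt_contravar; [apply Rmult_lt_0_compat; lra|lra]. }
split.
- apply Rle_trans with (1 := k1 h ltac:(lra)). apply Rmult_le_compat_r; lra.
- apply Rle_trans with (1 := k2 h ltac:(lra)). apply Rmult_le_compat_r; lra.
Qed.

(** Nested squares with centres in [F], each avoiding the next set [A n]. Their common point need
    not lie in [F], because the [A n] cover the whole plane. *)
Lemma baire2 (F : R -> R -> Prop) (A : nat -> R -> R -> Prop) :
  (forall n, closed2 (A n)) -> (forall x t, exists n, A n x t) -> (exists x t, F x t) ->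
  exists n x0 t0 rho, 0 < rho /\ F x0 t0 /\
    forall x t, Rabs (x - x0) <= rho -> Rabs (t - t0) <= rho -> F x t -> A n x t.
Proof.
intros hcl hcov [x0 [t0 F0]]. apply NNPP; intros hn.
set (st := {z : R * R * R | F (fst (fst z)) (snd (fst z)) /\ 0 < snd z}).
assert (step : forall (n : nat) (z : st), exists z' : st,
  let '((x, t), r) := proj1_sig z in let '((x', t'), r') := proj1_sig z' in
  Rabs (x' - x) + r' <= r /\ Rabs (t' - t) + r' <= r /\
  forall y s, Rabs (y - x') <= r' -> Rabs (s - t') <= r' -> ~ A n y s).
{ intros n [[[x t] r] [Fz r0]]. simpl in *.
  assert (exists x' t', Rabs (x' - x) <= r / 2 /\ Rabs (t' - t) <= r / 2 /\ F x' t' /\ ~ A n x' t') as [x' [t' [h1 [h2 [h3 h4]]]]].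
  { apply NNPP; intros hm. apply hn. exists n, x, t, (r / 2). split; [lra|]. split; [assumption|].
    intros x' t' h1 h2 h3. apply NNPP; intros h4. apply hm. exists x', t'; auto. }
  destruct (hcl n x' t' h4) as [rho [r1 k]].
  assert (q : 0 < Rmin rho (r / 2)) by (apply Rmin_pos; lra).
  exists (exist _ ((x', t'), Rmin rho (r / 2)) (conj h3 q)). simpl.
  pose proof (Rmin_l rho (r / 2)); pose proof (Rmin_r rho (r / 2)). repeat split; try lra.
  intros y s hy hs. apply k; lra. }
set (nxt := fun n z => proj1_sig (constructive_indefinite_description _ (step n z))).
assert (hnxt : forall n z, let '((x, t), r) := proj1_sig z in let '((x', t'), r') := proj1_sig (nxt n z) in
  Rabs (x' - x) + r' <= r /\ Rabs (t' - t) + r' <= r /\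
  forall y s, Rabs (y - x') <= r' -> Rabs (s - t') <= r' -> ~ A n y s).
{ intros n z. unfold nxt. apply (proj2_sig (constructive_indefinite_description _ (step n z))). }
clearbody nxt.
set (z0 := exist (fun z : R * R * R => F (fst (fst z)) (snd (fst z)) /\ 0 < snd z) ((x0, t0), 1) (conj F0 Rlt_0_1) : st).
set (z := fix z n := match n with O => z0 | Datatypes.S m => nxt m (z m) end).
set (X := fun n => fst (fst (proj1_sig (z n)))). set (T := fun n => snd (fst (proj1_sig (z n)))).
set (r := fun n => snd (proj1_sig (z n))).
assert (hs : forall n, Rabs (X (Datatypes.S n) - X n) + r (Datatypes.S n) <= r n /\ Rabs (T (Datatypes.S n) - T n) + r (Datatypes.S n) <= r n /\
  forall y s, Rabs (y - X (Datatypes.S n)) <= r (Datatypes.S n) -> Rabs (s - T (Datatypes.S n)) <= r (Datatypes.S n) -> ~ A n y s).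
{ intros n. unfold X, T, r. simpl z. specialize (hnxt n (z n)).
  destruct (z n) as [[[x t] rr] hz]; destruct (nxt n _) as [[[x' t'] rr'] hz']. exact hnxt. }
assert (r0 : forall n, 0 < r n).
{ intros n. unfold r. apply (proj2 (proj2_sig (z n))). }
assert (nest : forall (Y : nat -> R), (forall n, Rabs (Y (Datatypes.S n) - Y n) + r (Datatypes.S n) <= r n) ->
  exists y, forall n, Rabs (y - Y n) <= r n).
{ intros Y hY.
  assert (mono : forall n k, Y n - r n <= Y (n + k)%nat - r (n + k)%nat /\ Y (n + k)%nat + r (n + k)%nat <= Y n + r n).
  { intros n k. induction k as [|k IH]; [rewrite Nat.add_0_r; lra|].
    rewrite Nat.add_succ_r. pose proof (hY (n + k)%nat) as q.
    assert (q2 : Rabs (Y (Datatypes.S (n + k)) - Y (n + k)%nat) <= r (n + k)%nat - r (Datatypes.S (n + k))) by lra.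
    apply Rabs_bnd in q2. lra. }
  assert (cr : forall n m, Y n - r n <= Y m + r m).
  { intros n m. pose proof (mono n m). pose proof (mono m n). rewrite (Nat.add_comm m n) in H0.
    pose proof (r0 (n + m)%nat). lra. }
  destruct (completeness (fun v => exists n, v = Y n - r n)) as [y [hy1 hy2]].
  - exists (Y 0%nat + r 0%nat). intros v [n ->]. apply cr.
  - exists (Y 0%nat - r 0%nat), 0%nat. reflexivity.
  - exists y. intros n. apply Rabs_le.
    assert (Y n - r n <= y) by (apply hy1; exists n; reflexivity).
    assert (y <= Y n + r n) by (apply hy2; intros v [m ->]; apply cr). lra. }
destruct (nest X) as [x hx]; [intros n; apply (hs n)|].
destruct (nest T) as [t ht]; [intros n; apply (hs n)|].
destruct (hcov x t) as [n hA].
destruct (hs n) as [_ [_ hh]]. apply (hh x t); [apply hx|apply ht|exact hA].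
Qed.

(** After a translation the integral is the difference of the means of [f] over [[b, b + h]] and
    [[a, a + h]]. This replaces the fundamental theorem of calculus for Lipschitz functions and
    avoids almost everywhere differentiability. *)
Lemma J_diff_quot f N M a b h : (forall x y, Rabs (f x - f y) <= N * Rabs (x - y)) ->
  (forall x, Rabs (f x) <= M) -> a <= b -> 0 < h ->
  Rabs (J a b (fun x => (f (x + h) - f x) * / h) - (f b - f a)) <= 2 * N * h.
Proof.
intros hl hM ab h0.
assert (bf : Bm1 f) by (apply (Bm1_cont f M); [apply (lip_continuity f N hl)|exact hM]).
assert (bfh : Bm1 (fun x => f (x + h))).
{ apply (Bm1_cont _ M); [|intros; apply hM]. apply (lip_continuity _ N). intros x y.
  replace (x - y) with ((x + h) - (y + h)) by ring. apply hl. }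
assert (e1 : J a b (fun x => (f (x + h) - f x) * / h) = / h * (J b (b + h) f - J a (a + h) f)).
{ rewrite (J_ext a b _ (fun x => / h * (f (x + h) - f x))) by (intros; ring).
  rewrite J_scal by (apply Bm1_minus; assumption). f_equal.
  rewrite (J_minus a b (fun x => f (x + h)) f) by assumption. rewrite J_shift by assumption.
  pose proof (J_chasles a b (b + h) f bf ltac:(lra) ltac:(lra)).
  pose proof (J_chasles a (a + h) (b + h) f bf ltac:(lra) ltac:(lra)). lra. }
assert (e2 : forall y, Rabs (J y (y + h) f - f y * h) <= N * h * h).
{ intros y. replace (f y * h) with (J y (y + h) (fun _ => f y)) by (rewrite J_const; [ring|lra]).
  rewrite <- J_minus by (assumption || apply Bm1_const).
  replace (N * h * h) with (N * h * (y + h - y)) by ring.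
  apply J_abs_le; [apply Bm1_minus; [assumption|apply Bm1_const]|lra|].
  intros x hx. apply Rle_trans with (1 := hl x y).
  assert (N0 : 0 <= N). { pose proof (hl 1 0) as q. rewrite Rminus_0_r, Rabs_R1 in q. pose proof (Rabs_pos (f 1 - f 0)). lra. }
  apply Rmult_le_compat_l; [assumption|]. apply Rabs_le; lra. }
rewrite e1. pose proof (e2 b) as q1; pose proof (e2 a) as q2. apply Rabs_bnd in q1; apply Rabs_bnd in q2.
replace (/ h * (J b (b + h) f - J a (a + h) f) - (f b - f a))
  with (/ h * ((J b (b + h) f - f b * h) - (J a (a + h) f - f a * h))) by (field; lra).
rewrite Rabs_mult, (Rabs_right (/ h)) by (apply Rle_ge; left; apply Rinv_0_lt_compat; assumption).
replace (2 * N * h) with (/ h * (2 * (N * h * h))) by (field; lra).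
apply Rmult_le_compat_l; [left; apply Rinv_0_lt_compat; assumption|]. apply Rabs_le; lra.
Qed.

Lemma deriv_seq f x l hn : derivable_pt_lim f x l -> (forall n, 0 < hn n) -> Un_cv hn 0 ->
  Un_cv (fun n : nat => (f (x + hn n) - f x) * / hn n) l.
Proof.
intros hd h0 hc eps e0. destruct (hd eps e0) as [dl k].
destruct (hc dl (cond_pos dl)) as [N hN]. exists N. intros n hnn. specialize (hN n hnn).
unfold Rdist in *. rewrite Rminus_0_r in hN. apply (k (hn n)); [|exact hN]. specialize (h0 n). lra.
Qed.

Lemma le_of_cv A B (e : nat -> R) : (forall n, A <= B + e n) -> Un_cv e 0 -> A <= B.
Proof.
intros h he. apply le_epsilon. intros eps e0. destruct (he eps e0) as [N hN].
specialize (hN N ltac:(lia)). unfold Rdist in hN. rewrite Rminus_0_r in hN. pose proof (Rle_abs (e N)).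
specialize (h N). lra.
Qed.

(** * The Looman-Menchoff argument: the set of bad points is empty *)

Section Key.
Variables P S g Px Pt Sx St : R -> R -> R.
Variable M : R.
Hypothesis mP : forall x t, Rabs (P x t) <= M.
Hypothesis mS : forall x t, Rabs (S x t) <= M.
Hypothesis mg : forall x t, Rabs (g x t) <= M.
Hypothesis dPx : forall x t, derivable_pt_lim (fun x => P x t) x (Px x t).
Hypothesis dPt : forall x t, derivable_pt_lim (P x) t (Pt x t).
Hypothesis dSx : forall x t, derivable_pt_lim (fun x => S x t) x (Sx x t).
Hypothesis dSt : forall x t, derivable_pt_lim (S x) t (St x t).
Hypothesis eqn : forall x t, Px x t + St x t = g x t.
Hypothesis cg1 : forall t, continuity (fun x => g x t).
Hypothesis cg2 : forall x, continuity (g x).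

Lemma derivable_pt_lim_continuity_pt f x l : derivable_pt_lim f x l -> continuity_pt f x.
Proof. intros h. apply derivable_continuous_pt. exists l. exact h. Qed.

Let cP1 t : continuity (fun x => P x t). Proof. intros x. apply (derivable_pt_lim_continuity_pt _ _ _ (dPx x t)). Qed.

Let cP2 x : continuity (P x). Proof. intros t. apply (derivable_pt_lim_continuity_pt _ _ _ (dPt x t)). Qed.

Let cS1 t : continuity (fun x => S x t). Proof. intros x. apply (derivable_pt_lim_continuity_pt _ _ _ (dSx x t)). Qed.

Let cS2 x : continuity (S x). Proof. intros t. apply (derivable_pt_lim_continuity_pt _ _ _ (dSt x t)). Qed.

Let bP : Bm2 P. Proof. apply (Bm2_sepcont P M); assumption. Qed.

Let bS : Bm2 S. Proof. apply (Bm2_sepcont S M); assumption. Qed.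

Let bg : Bm2 g. Proof. apply (Bm2_sepcont g M); assumption. Qed.

Local Notation D := (Div P S g).
Local Notation F := (bad P S g).

Lemma Div_free a b c d : a <= b -> c <= d -> (forall x t, a <= x <= b -> c <= t <= d -> ~ F x t) -> D a b c d = 0.
Proof. intros ab cd h. apply Div_cover; try assumption. intros x t hx ht. apply NNPP. apply h; assumption. Qed.

Lemma Div_lim2 cn dn a b c d : a <= b -> (forall n, c <= cn n /\ cn n <= dn n /\ dn n <= d) ->
  Un_cv cn c -> Un_cv dn d -> (forall n, D a b (cn n) (dn n) = 0) -> D a b c d = 0.
Proof.
intros ab h hc hd h0. destruct (h 0%nat) as [q1 [q2 q3]].
rewrite Div_swap by (assumption || lra).
apply (Div_lim1 (fun t x => S x t) (fun t x => P x t) (fun t x => g x t) M) with (an := cn) (bn := dn); try assumption;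
  try (apply Bm2_swap; assumption); try (intros; apply cS2); try (intros; auto; fail).
intros n. specialize (h n). rewrite <- Div_swap by (assumption || lra). apply h0.
Qed.

Lemma seq_lt p q : p < q -> exists un : nat -> R, (forall n, p <= un n /\ un n < q) /\ Un_cv un q.
Proof.
intros pq. exists (fun n => q - (q - p) * / (INR n + 1)). split.
- intros n. pose proof (pos_INR n).
  assert (0 < / (INR n + 1)) by (apply Rinv_0_lt_compat; lra).
  assert (/ (INR n + 1) <= 1) by (rewrite <- Rinv_1; apply Rinv_le_contravar; lra). split; nra.
- replace q with (q - 0) at 1 by ring. apply CV_minus; [apply Un_cv_const|]. apply Un_cv_scal. apply Un_cv_inv.
Qed.

Lemma seq_gt p q : p < q -> exists un : nat -> R, (forall n, p < un n /\ un n <= q) /\ Un_cv un p.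
Proof.
intros pq. exists (fun n => p + (q - p) * / (INR n + 1)). split.
- intros n. pose proof (pos_INR n).
  assert (0 < / (INR n + 1)) by (apply Rinv_0_lt_compat; lra).
  assert (/ (INR n + 1) <= 1) by (rewrite <- Rinv_1; apply Rinv_le_contravar; lra). split; nra.
- replace p with (p + 0) at 1 by ring. apply CV_plus; [apply Un_cv_const|]. apply Un_cv_scal. apply Un_cv_inv.
Qed.

(** The side [x = b] may carry bad points: rectangles that stop before it have no defect, and the
    remaining strip becomes thin. *)
Lemma Div_free_left a b c d : a <= b -> c <= d -> (forall x t, a <= x < b -> c <= t <= d -> ~ F x t) -> D a b c d = 0.
Proof.
intros ab cd h. destruct (Req_dec a b) as [->|ne]; [apply Div_self1; assumption|].
destruct (seq_lt a b ltac:(lra)) as [un [h1 h2]].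
apply (Div_lim1 P S g M bP bS bg cP1 mP mS mg (fun _ => a) un); try assumption; [|apply Un_cv_const|].
- intros n; specialize (h1 n); lra.
- intros n; specialize (h1 n). apply Div_free; try lra. intros x t hx ht. apply h; lra.
Qed.

Lemma Div_free_right a b c d : a <= b -> c <= d -> (forall x t, a < x <= b -> c <= t <= d -> ~ F x t) -> D a b c d = 0.
Proof.
intros ab cd h. destruct (Req_dec a b) as [->|ne]; [apply Div_self1; assumption|].
destruct (seq_gt a b ltac:(lra)) as [un [h1 h2]].
apply (Div_lim1 P S g M bP bS bg cP1 mP mS mg un (fun _ => b)); try assumption; [|apply Un_cv_const|].
- intros n; specialize (h1 n); lra.
- intros n; specialize (h1 n). apply Div_free; try lra. intros x t hx ht. apply h; lra.
Qed.

Lemma Div_free_down a b c d : a <= b -> c <= d -> (forall x t, a <= x <= b -> c <= t < d -> ~ F x t) -> D a b c d = 0.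
Proof.
intros ab cd h. destruct (Req_dec c d) as [->|ne]; [apply Div_self2; assumption|].
destruct (seq_lt c d ltac:(lra)) as [un [h1 h2]].
apply (Div_lim2 (fun _ => c) un); try assumption; [|apply Un_cv_const|].
- intros n; specialize (h1 n); lra.
- intros n; specialize (h1 n). apply Div_free; try lra. intros x t hx ht. apply h; lra.
Qed.

Lemma Div_free_up a b c d : a <= b -> c <= d -> (forall x t, a <= x <= b -> c < t <= d -> ~ F x t) -> D a b c d = 0.
Proof.
intros ab cd h. destruct (Req_dec c d) as [->|ne]; [apply Div_self2; assumption|].
destruct (seq_gt c d ltac:(lra)) as [un [h1 h2]].
apply (Div_lim2 un (fun _ => d)); try assumption; [|apply Un_cv_const|].
- intros n; specialize (h1 n); lra.
- intros n; specialize (h1 n). apply Div_free; try lra. intros x t hx ht. apply h; lra.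
Qed.

(* Shrinking to the smallest rectangle around the bad points keeps D and makes every side touch F. *)
Lemma Div_shrink a b c d : a <= b -> c <= d -> (exists x t, a <= x <= b /\ c <= t <= d /\ F x t) ->
  exists a1 b1 c1 d1, a <= a1 /\ a1 <= b1 /\ b1 <= b /\ c <= c1 /\ c1 <= d1 /\ d1 <= d /\
    D a b c d = D a1 b1 c1 d1 /\
    (exists t, c <= t <= d /\ F a1 t) /\ (exists t, c <= t <= d /\ F b1 t) /\
    (exists x, a <= x <= b /\ F x c1) /\ (exists x, a <= x <= b /\ F x d1).
Proof.
intros ab cd hne. pose proof (bad_closed P S g) as hF.
destruct (leftmost F a b c d hF cd hne) as [a1 [ta [h1 [h2 [h3 h4]]]]].
destruct (rightmost F a b c d hF cd hne) as [b1 [tb [k1 [k2 [k3 k4]]]]].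
assert (hne' : exists t x, c <= t <= d /\ a <= x <= b /\ F x t) by (destruct hne as [x [t [q1 [q2 q3]]]]; exists t, x; auto).
destruct (leftmost (fun t x => F x t) c d a b (closed2_swap F hF) ab hne') as [c1 [xc [m1 [m2 [m3 m4]]]]].
destruct (rightmost (fun t x => F x t) c d a b (closed2_swap F hF) ab hne') as [d1 [xd [n1 [n2 [n3 n4]]]]].
assert (a1b1 : a1 <= b1) by (apply (k4 a1 ta); assumption).
assert (c1d1 : c1 <= d1) by (apply (n4 c1 xc); assumption).
exists a1, b1, c1, d1. repeat split; try lra.
- rewrite (Div_split1 P S g bP bS bg a a1 b) by lra. rewrite (Div_split1 P S g bP bS bg a1 b1 b) by lra.
  rewrite (Div_split2 P S g bP bS bg a1 b1 c c1 d) by lra. rewrite (Div_split2 P S g bP bS bg a1 b1 c1 d1 d) by lra.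
  rewrite (Div_free_left a a1 c d); [|lra|lra|].
  2:{ intros x t hx ht hf. pose proof (h4 x t ltac:(lra) ht hf). lra. }
  rewrite (Div_free_right b1 b c d); [|lra|lra|].
  2:{ intros x t hx ht hf. pose proof (k4 x t ltac:(lra) ht hf). lra. }
  rewrite (Div_free_down a1 b1 c c1); [|lra|lra|].
  2:{ intros x t hx ht hf. pose proof (m4 t x ltac:(lra) ltac:(lra) hf). lra. }
  rewrite (Div_free_up a1 b1 d1 d); [|lra|lra|].
  2:{ intros x t hx ht hf. pose proof (n4 t x ltac:(lra) ltac:(lra) hf). lra. }
  ring.
- exists ta; auto.
- exists tb; auto.
- exists xc; auto.
- exists xd; auto.
Qed.

(** * A square with centre ([xc], [to_complex]) whose bad points satisfy [lip_at] with the same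
    [N] *)

Section Local.
Variables (xc to_complex rho N : R).
Hypothesis rho0 : 0 < rho.
Hypothesis N1 : 0 < N.
Hypothesis rhoN : 2 * rho < / N.
Local Notation U x t := (Rabs (x - xc) <= rho /\ Rabs (t - to_complex) <= rho).
Hypothesis lipP : forall x t, U x t -> F x t -> lip_at P N x t.
Hypothesis lipS : forall x t, U x t -> F x t -> lip_at S N x t.
Hypothesis Fc : F xc to_complex.

Let E x t := U x t /\ F x t.

(** Two points of [E] are joined through the corner ([y], [t]), which need not lie in [E]: the first
    point controls the horizontal step, the second the vertical one. Both steps have length at most
    [2 * rho], below [/ N]. *)
Lemma mcshane_at Q : (forall x t, Rabs (Q x t) <= M) -> (forall x t, U x t -> F x t -> lip_at Q N x t) ->
  exists k : R -> R -> R, (forall x t, E x t -> k x t = Q x t) /\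
    (forall x t y s, Rabs (k x t - k y s) <= N * (Rabs (x - y) + Rabs (t - s))) /\ (forall x t, Rabs (k x t) <= M).
Proof.
intros mQ lQ. destruct (mcshane E Q N M) as [k [h1 [h2 [h3 _]]]]; [lra| |exact mQ| |exists k; auto].
- exists xc, to_complex. split; [|exact Fc]. rewrite !Rminus_diag, Rabs_R0. lra.
- intros x t y s [[u1 u2] f1] [[u3 u4] f2].
  apply Rabs_bnd in u1, u2, u3, u4.
  destruct (lQ x t) with (h := y - x) as [a1 _]; [split; apply Rabs_le; lra|assumption| |].
  { apply Rle_lt_trans with (2 * rho); [apply Rabs_le; lra|lra]. }
  destruct (lQ y s) with (h := t - s) as [_ a2]; [split; apply Rabs_le; lra|assumption| |].
  { apply Rle_lt_trans with (2 * rho); [apply Rabs_le; lra|lra]. }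
  replace (x + (y - x)) with y in a1 by ring. replace (s + (t - s)) with t in a2 by ring.
  rewrite (Rabs_minus_sym y x) in a1. apply Rabs_bnd in a1; apply Rabs_bnd in a2. lra.
Qed.

Variables kP kS : R -> R -> R.
Hypothesis kP1 : forall x t, E x t -> kP x t = P x t.
Hypothesis kP2 : forall x t y s, Rabs (kP x t - kP y s) <= N * (Rabs (x - y) + Rabs (t - s)).
Hypothesis kP3 : forall x t, Rabs (kP x t) <= M.
Hypothesis kS1 : forall x t, E x t -> kS x t = S x t.
Hypothesis kS2 : forall x t y s, Rabs (kS x t - kS y s) <= N * (Rabs (x - y) + Rabs (t - s)).
Hypothesis kS3 : forall x t, Rabs (kS x t) <= M.
Let p x t := P x t - kP x t.
Let q x t := S x t - kS x t.
Let bkP : Bm2 kP. Proof. apply (lip2_Bm2 kP N M); assumption. Qed.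

Let bkS : Bm2 kS. Proof. apply (lip2_Bm2 kS N M); assumption. Qed.

Let bp : Bm2 p. Proof. apply Bm2_minus; assumption. Qed.

Let bq : Bm2 q. Proof. apply Bm2_minus; assumption. Qed.

(** [p] vanishes at the centre of the cross, and [P] and its extension each contribute a slope
    [N]. *)
Lemma cross_p x t h : E x t -> Rabs h <= 2 * rho ->
  Rabs (p (x + h) t) <= 2 * N * Rabs h /\ Rabs (p x (t + h)) <= 2 * N * Rabs h.
Proof.
intros hE hh. destruct (lipP x t (proj1 hE) (proj2 hE) h ltac:(lra)) as [a1 a2].
pose proof (kP1 x t hE) as e. pose proof (kP2 (x + h) t x t) as b1. pose proof (kP2 x (t + h) x t) as b2.
replace (x + h - x) with h in * by ring. replace (t + h - t) with h in * by ring.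
rewrite Rminus_diag, Rabs_R0 in b1, b2. unfold p.
apply Rabs_bnd in a1, a2, b1, b2. split; apply Rabs_le; lra.
Qed.

Lemma cross_q x t h : E x t -> Rabs h <= 2 * rho ->
  Rabs (q (x + h) t) <= 2 * N * Rabs h /\ Rabs (q x (t + h)) <= 2 * N * Rabs h.
Proof.
intros hE hh. destruct (lipS x t (proj1 hE) (proj2 hE) h ltac:(lra)) as [a1 a2].
pose proof (kS1 x t hE) as e. pose proof (kS2 (x + h) t x t) as b1. pose proof (kS2 x (t + h) x t) as b2.
replace (x + h - x) with h in * by ring. replace (t + h - t) with h in * by ring.
rewrite Rminus_diag, Rabs_R0 in b1, b2. unfold q.
apply Rabs_bnd in a1, a2, b1, b2. split; apply Rabs_le; lra.
Qed.

Variables chi dF : R -> R -> R.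
Hypothesis bchi : Bm2 chi.
Hypothesis chi0 : forall x t, F x t -> chi x t = 0.
Hypothesis chi1 : forall x t, ~ F x t -> chi x t = 1.

Let chi_ge0 x t : 0 <= chi x t.
Proof. destruct (classic (F x t)) as [h|h]; [rewrite chi0|rewrite chi1]; (assumption || lra). Qed.

Let chi_le1 x t : chi x t <= 1.
Proof. destruct (classic (F x t)) as [h|h]; [rewrite chi0|rewrite chi1]; (assumption || lra). Qed.

Local Notation inU a b c d := (xc - rho / 2 <= a /\ b <= xc + rho / 2 /\ to_complex - rho / 2 <= c /\ d <= to_complex + rho / 2).

(** The side [x = e] meets [F] at height [ts]. In a row that meets [F], a bad point at distance at
    most the integral of [chi] controls [p] horizontally. In a row without bad points this integral
    is the full width, and by the aspect bound [lam] it dominates the vertical distance to ([e],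
    [ts]). *)
Lemma side_bound lam a b c d e t ts : 1 <= lam -> inU a b c d -> d - c <= lam * (b - a) ->
  a <= e <= b -> c <= t <= d -> c <= ts <= d -> F e ts ->
  Rabs (p e t) <= 2 * N * lam * J a b (fun x => chi x t).
Proof.
intros l1 [u1 [u2 [u3 u4]]] asp he ht hts hF.
destruct (row_near (fun x => F x t) (fun x => chi x t) a b e) as [hc|[y [hy [Fy hd]]]].
- apply (Bm2_sec1 chi t bchi).
- intros; apply chi_ge0.
- intros x hx. rewrite chi1 by assumption. lra.
- intros x hx. destruct (bad_closed P S g x t hx) as [r [r0 k]]. exists r; split; [assumption|].
  intros y hy. apply k; [assumption|rewrite Rminus_diag, Rabs_R0; lra].
- assumption.
- assert (hE : E e ts) by (split; [split; apply Rabs_le; lra|assumption]).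
  destruct (cross_p e ts (t - ts) hE) as [_ a2]; [apply Rabs_le; lra|].
  replace (ts + (t - ts)) with t in a2 by ring. apply Rle_trans with (1 := a2).
  assert (Rabs (t - ts) <= d - c) by (apply Rabs_le; lra).
  assert (lam * (b - a) <= lam * J a b (fun x => chi x t)) by (apply Rmult_le_compat_l; lra).
  replace (2 * N * lam * J a b (fun x => chi x t)) with (2 * N * (lam * J a b (fun x => chi x t))) by ring.
  apply Rmult_le_compat_l; lra.
- assert (hE : E y t) by (split; [split; apply Rabs_le; lra|assumption]).
  destruct (cross_p y t (e - y) hE) as [a2 _]; [apply Rabs_le; lra|].
  replace (y + (e - y)) with e in a2 by ring. apply Rle_trans with (1 := a2). rewrite Rabs_minus_sym.
  assert (0 <= J a b (fun x => chi x t)) by (apply Rle_trans with (2 := hd); apply Rabs_pos).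
  assert (1 * J a b (fun x => chi x t) <= lam * J a b (fun x => chi x t)) by (apply Rmult_le_compat_r; lra).
  replace (2 * N * lam * J a b (fun x => chi x t)) with (2 * N * (lam * J a b (fun x => chi x t))) by ring.
  apply Rmult_le_compat_l; lra.
Qed.

Lemma side_bound2 lam a b c d e x xs : 1 <= lam -> inU a b c d -> b - a <= lam * (d - c) ->
  c <= e <= d -> a <= x <= b -> a <= xs <= b -> F xs e ->
  Rabs (q x e) <= 2 * N * lam * J c d (fun t => chi x t).
Proof.
intros l1 [u1 [u2 [u3 u4]]] asp he ht hts hF.
destruct (row_near (fun t => F x t) (fun t => chi x t) c d e) as [hc|[y [hy [Fy hd]]]].
- apply (Bm2_sec2 chi x bchi).
- intros; apply chi_ge0.
- intros t hx. rewrite chi1 by assumption. lra.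
- intros t hx. destruct (bad_closed P S g x t hx) as [r [r0 k]]. exists r; split; [assumption|].
  intros y hy. apply k; [rewrite Rminus_diag, Rabs_R0; lra|assumption].
- assumption.
- assert (hE : E xs e) by (split; [split; apply Rabs_le; lra|assumption]).
  destruct (cross_q xs e (x - xs) hE) as [a2 _]; [apply Rabs_le; lra|].
  replace (xs + (x - xs)) with x in a2 by ring. apply Rle_trans with (1 := a2).
  assert (Rabs (x - xs) <= b - a) by (apply Rabs_le; lra).
  assert (lam * (d - c) <= lam * J c d (fun t => chi x t)) by (apply Rmult_le_compat_l; lra).
  replace (2 * N * lam * J c d (fun t => chi x t)) with (2 * N * (lam * J c d (fun t => chi x t))) by ring.
  apply Rmult_le_compat_l; lra.
- assert (hE : E x y) by (split; [split; apply Rabs_le; lra|assumption]).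
  destruct (cross_q x y (e - y) hE) as [_ a2]; [apply Rabs_le; lra|].
  replace (y + (e - y)) with e in a2 by ring. apply Rle_trans with (1 := a2). rewrite Rabs_minus_sym.
  assert (0 <= J c d (fun t => chi x t)) by (apply Rle_trans with (2 := hd); apply Rabs_pos).
  assert (1 * J c d (fun t => chi x t) <= lam * J c d (fun t => chi x t)) by (apply Rmult_le_compat_r; lra).
  replace (2 * N * lam * J c d (fun t => chi x t)) with (2 * N * (lam * J c d (fun t => chi x t))) by ring.
  apply Rmult_le_compat_l; lra.
Qed.

(** Steps of at most [rho / 2], so that a point of the half-size square stays in [U] after a
    step. *)
Let hn (n : nat) := rho / 2 * / (INR n + 1).
Let hn0 n : 0 < hn n /\ hn n <= rho / 2.
Proof.
unfold hn. pose proof (pos_INR n). assert (0 < / (INR n + 1)) by (apply Rinv_0_lt_compat; lra).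
assert (/ (INR n + 1) <= 1) by (rewrite <- Rinv_1; apply Rinv_le_contravar; lra). split; nra.
Qed.

Let hncv : Un_cv hn 0. Proof. apply Un_cv_scal. apply Un_cv_inv. Qed.

(** The divergence of ([kP], [kS]) is computed with difference quotients. Off [F] they are bounded
    by [N] each, which costs [2 * N + M] times the measure of the complement of [F]. On [F] they
    split into the quotients of [P] and [S], which converge boundedly to derivatives with sum [g],
    and those of [p] and [q], which vanish unless the shifted point leaves [F]; each of these costs
    another [2 * N]. *)
Lemma Div_extension a b c d : a <= b -> c <= d -> inU a b c d ->
  Rabs (Div kP kS g a b c d) <= (6 * N + M) * JJ a b c d chi.
Proof.
intros ab cd [u1 [u2 [u3 u4]]].
assert (M0 : 0 <= M) by (pose proof (mP 0 0); pose proof (Rabs_pos (P 0 0)); lra).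
set (dk n x t := (kP (x + hn n) t - kP x t) * / hn n).
set (ds n x t := (kS x (t + hn n) - kS x t) * / hn n).
set (dp n x t := (p (x + hn n) t - p x t) * / hn n).
set (dq n x t := (q x (t + hn n) - q x t) * / hn n).
set (r n x t := (P (x + hn n) t - P x t) * / hn n + (S x (t + hn n) - S x t) * / hn n - g x t).
assert (bmr : forall f c, Bm2 f -> Bm2 (fun x t => f x t * c)).
{ intros f c0 hf. apply Bm2_mult; [assumption|apply Bm2_const]. }
assert (bdk : forall n, Bm2 (dk n)) by (intros n; apply bmr, Bm2_minus; [apply (Bm2_shift kP); assumption|assumption]).
assert (bds : forall n, Bm2 (ds n)) by (intros n; apply bmr, Bm2_minus; [apply (Bm2_shift2 kS); assumption|assumption]).
assert (bdp : forall n, Bm2 (dp n)) by (intros n; apply bmr, Bm2_minus; [apply (Bm2_shift p); assumption|assumption]).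
assert (bdq : forall n, Bm2 (dq n)) by (intros n; apply bmr, Bm2_minus; [apply (Bm2_shift2 q); assumption|assumption]).
assert (br : forall n, Bm2 (r n)).
{ intros n; apply Bm2_minus; [apply Bm2_plus|assumption]; apply bmr, Bm2_minus; try assumption;
  [apply (Bm2_shift P)|apply (Bm2_shift2 S)]; assumption. }
assert (b1c : Bm2 (fun x t => 1 - chi x t)) by (apply Bm2_minus; [apply Bm2_const|assumption]).
(* Only the first term sees the complement of [F]; the other three are supported on [F], where
   [1 - chi] is 1. *)
assert (rel : forall n x t, dk n x t + ds n x t - g x t =
   chi x t * (dk n x t + ds n x t - g x t) + (1 - chi x t) * r n x t - (1 - chi x t) * dp n x t - (1 - chi x t) * dq n x t).
{ intros n x t. unfold dk, ds, dp, dq, r, p, q. ring. }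
(* On [F] the quotients of [P] and [S] are bounded by [N] thanks to [lip_at] and converge pointwise,
   so dominated convergence applies although the derivatives may be unbounded elsewhere. *)
set (eps n := Rabs (JJ a b c d (fun x t => (1 - chi x t) * r n x t))).
assert (heps : Un_cv eps 0).
{ assert (z : Un_cv (fun n => JJ a b c d (fun x t => (1 - chi x t) * r n x t)) (JJ a b c d (fun _ _ => 0))).
  { apply (JJ_lim a b c d (fun n x t => (1 - chi x t) * r n x t) (fun _ _ => 0) (2 * N + M)); try assumption.
    - intros n; apply Bm2_mult; [assumption|apply br].
    - apply Bm2_const.
    - intros n x t hx ht. destruct (classic (F x t)) as [hf|hf].
      2:{ rewrite chi1 by assumption. rewrite Rminus_diag, Rmult_0_l, Rabs_R0. lra. }
      rewrite chi0, Rminus_0_r, Rmult_1_l by assumption. destruct (hn0 n) as [q1 q2].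
      assert (hU : U x t) by (split; apply Rabs_le; lra).
      assert (habs : Rabs (hn n) = hn n) by (apply Rabs_right; lra).
      destruct (lipP x t hU hf (hn n)) as [a1 _]; [lra|]. destruct (lipS x t hU hf (hn n)) as [_ a2]; [lra|].
      unfold r. rewrite habs in a1, a2.
      assert (z : forall v, Rabs v <= N * hn n -> Rabs (v * / hn n) <= N).
      { intros v hv. rewrite Rabs_mult, (Rabs_right (/ hn n)) by (apply Rle_ge; left; apply Rinv_0_lt_compat; lra).
        apply Rmult_le_reg_r with (hn n); [lra|]. rewrite Rmult_assoc, Rinv_l by lra. lra. }
      apply z in a1; apply z in a2. pose proof (mg x t) as a3.
      apply Rabs_bnd in a1, a2, a3. apply Rabs_le; lra.
    - intros x t hx ht. destruct (classic (F x t)) as [hf|hf].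
      2:{ apply (Un_cv_ext (fun _ => 0)); [|apply Un_cv_const]. intros n. rewrite chi1 by assumption. ring. }
      apply (Un_cv_ext (fun n => r n x t)); [intros n; rewrite chi0 by assumption; ring|].
      replace 0 with (Px x t + St x t - g x t) by (rewrite eqn; ring).
      unfold r. apply CV_minus; [apply CV_plus|apply Un_cv_const].
      + apply (deriv_seq (fun x => P x t)); [apply dPx|intros; apply hn0|apply hncv].
      + apply (deriv_seq (S x)); [apply dSt|intros; apply hn0|apply hncv].
  }
  rewrite JJ_const, !Rmult_0_l in z by assumption. unfold eps.
  replace 0 with (Rabs 0) by apply Rabs_R0. apply cv_cvabs. exact z. }
apply (le_of_cv _ _ (fun n => (6 * N * (d - c) + 6 * N * (b - a)) * hn n + eps n)).
2:{ replace 0 with (0 + 0) by ring. apply CV_plus; [apply Un_cv_scal; apply hncv|exact heps]. }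
intros n. destruct (hn0 n) as [q1 q2]. set (h := hn n) in *.
assert (ih : 0 < / h) by (apply Rinv_0_lt_compat; lra).
assert (g1 : Rabs (JJ a b c d (dk n) - J c d (fun t => kP b t - kP a t)) <= 2 * N * h * (d - c)).
{ unfold JJ. rewrite <- J_minus; [|apply (Bm2_J1 (dk n)); apply bdk|apply Bm1_minus; apply (Bm2_sec2 kP _ bkP)].
  apply J_abs_le; [apply Bm1_minus; [apply (Bm2_J1 (dk n)); apply bdk|apply Bm1_minus; apply (Bm2_sec2 kP _ bkP)]|assumption|].
  intros t ht. apply (J_diff_quot (fun x => kP x t) N M); try assumption; [|intros; apply kP3].
  intros x y. pose proof (kP2 x t y t) as z. rewrite Rminus_diag, Rabs_R0, Rplus_0_r in z. exact z. }
assert (g2 : Rabs (JJ a b c d (ds n) - J a b (fun x => kS x d - kS x c)) <= 2 * N * h * (b - a)).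
{ rewrite JJ_fubini; [|apply bds|assumption|assumption].
  unfold JJ. rewrite <- J_minus; [|apply (Bm2_J (ds n)); apply bds|apply Bm1_minus; apply (Bm2_sec1 kS _ bkS)].
  apply J_abs_le; [apply Bm1_minus; [apply (Bm2_J (ds n)); apply bds|apply Bm1_minus; apply (Bm2_sec1 kS _ bkS)]|assumption|].
  intros x hx. apply (J_diff_quot (fun t => kS x t) N M); try assumption; [|intros; apply kS3].
  intros t s. pose proof (kS2 x t x s) as z. rewrite Rminus_diag, Rabs_R0, Rplus_0_l in z. exact z. }
assert (T1 : Rabs (JJ a b c d (fun x t => chi x t * (dk n x t + ds n x t - g x t))) <= (2 * N + M) * JJ a b c d chi).
{ rewrite <- JJ_scal by assumption. apply JJ_abs_le_fun.
  - apply Bm2_mult; [assumption|]. apply Bm2_minus; [apply Bm2_plus; auto|assumption].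
  - apply Bm2_scal; assumption.
  - intros x t hx ht. rewrite Rabs_mult, (Rabs_right (chi x t)) by (apply Rle_ge; apply chi_ge0).
    rewrite Rmult_comm. apply Rmult_le_compat_r; [apply chi_ge0|].
    assert (z : forall v, Rabs v <= N * h -> Rabs (v * / h) <= N).
    { intros v hv. rewrite Rabs_mult, (Rabs_right (/ h)) by (apply Rle_ge; lra).
      apply Rmult_le_reg_r with h; [lra|]. rewrite Rmult_assoc, Rinv_l by lra. lra. }
    assert (habs : Rabs h = h) by (apply Rabs_right; lra).
    assert (a1 : Rabs (dk n x t) <= N).
    { apply z. pose proof (kP2 (x + h) t x t) as w. rewrite Rminus_diag, Rabs_R0 in w. replace (x + h - x) with h in w by ring. rewrite habs in w. fold h. lra. }
    assert (a2 : Rabs (ds n x t) <= N).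
    { apply z. pose proof (kS2 x (t + h) x t) as w. rewrite Rminus_diag, Rabs_R0 in w. replace (t + h - t) with h in w by ring. rewrite habs in w. fold h. lra. }
    pose proof (mg x t) as a3. apply Rabs_bnd in a1, a2, a3. apply Rabs_le; lra. }
(* [w] is the value of [chi] at the shifted point: a quotient of [p] or [q] costs nothing when that
   point is in [F]. *)
assert (zz : forall v w, Rabs v <= 2 * N * h -> (w = 0 \/ w = 1) -> (w = 0 -> v = 0) -> Rabs (v * / h) <= 2 * N * w).
{ intros v w hv [-> | ->] hw; [rewrite hw by reflexivity; rewrite Rmult_0_l, Rabs_R0; lra|].
  rewrite Rabs_mult, (Rabs_right (/ h)) by (apply Rle_ge; lra).
  apply Rmult_le_reg_r with h; [lra|]. rewrite Rmult_assoc, Rinv_l by lra. lra. }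
assert (chi01 : forall x t, chi x t = 0 \/ chi x t = 1).
{ intros x t. destruct (classic (F x t)); [left; apply chi0|right; apply chi1]; assumption. }
assert (chiF : forall x t, chi x t = 0 -> F x t).
{ intros x t h0. apply NNPP; intros hf. rewrite chi1 in h0 by assumption. lra. }
assert (T2 : Rabs (JJ a b c d (fun x t => (1 - chi x t) * dp n x t)) <= 2 * N * (JJ a b c d chi + h * (d - c))).
{ apply Rle_trans with (2 * N * JJ a b c d (fun x t => chi (x + h) t)).
  - rewrite <- JJ_scal by (apply (Bm2_shift chi); assumption). apply JJ_abs_le_fun.
    + apply Bm2_mult; [assumption|apply bdp].
    + apply Bm2_scal. apply (Bm2_shift chi); assumption.
    + intros x t hx ht. destruct (classic (F x t)) as [hf|hf].
      2:{ rewrite chi1 by assumption. rewrite Rminus_diag, Rmult_0_l, Rabs_R0.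
          pose proof (chi_ge0 (x + h) t). apply Rmult_le_pos; lra. }
      rewrite (chi0 x t), Rminus_0_r, Rmult_1_l by assumption.
      assert (hE : E x t) by (split; [split; apply Rabs_le; lra|assumption]).
      unfold dp. fold h. replace (p x t) with 0 by (unfold p; rewrite kP1 by assumption; ring).
      rewrite Rminus_0_r. apply zz; [|apply chi01|].
      * destruct (cross_p x t h hE) as [w _]; [rewrite Rabs_right; lra|]. rewrite (Rabs_right h) in w by lra. exact w.
      * intros h0. unfold p. rewrite kP1; [ring|]. split; [split; apply Rabs_le; lra|apply chiF; exact h0].
  - apply Rmult_le_compat_l; [lra|]. unfold JJ.
    replace (J c d (fun t => J a b (fun x => chi x t)) + h * (d - c)) with (J c d (fun t => J a b (fun x => chi x t) + h)).
    2:{ rewrite J_plus; [|apply (Bm2_J1 chi); assumption|apply Bm1_const]. rewrite J_const by assumption. reflexivity. }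
    apply J_le; [apply (Bm2_J1 (fun x t => chi (x + h) t)); apply (Bm2_shift chi); assumption| |].
    + apply Bm1_plus; [apply (Bm2_J1 chi); assumption|apply Bm1_const].
    (* The shifted row exceeds the original one by a piece of length [h], where [chi] is at most
       1. *)
    + intros t ht. pose proof (Bm2_sec1 chi t bchi) as bt. rewrite (J_shift a b h (fun x => chi x t) bt).
      pose proof (J_chasles a (a + h) (b + h) _ bt ltac:(lra) ltac:(lra)).
      pose proof (J_chasles a b (b + h) _ bt ltac:(lra) ltac:(lra)).
      assert (0 <= J a (a + h) (fun x => chi x t)) by (apply J_ge0; [assumption|lra|intros; apply chi_ge0]).
      assert (J b (b + h) (fun x => chi x t) <= 1 * (b + h - b)).
      { rewrite <- J_const by lra. apply J_le; [assumption|apply Bm1_const|intros; apply chi_le1]. }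
      lra. }
assert (T3 : Rabs (JJ a b c d (fun x t => (1 - chi x t) * dq n x t)) <= 2 * N * (JJ a b c d chi + h * (b - a))).
{ apply Rle_trans with (2 * N * JJ a b c d (fun x t => chi x (t + h))).
  - rewrite <- JJ_scal by (apply (Bm2_shift2 chi); assumption). apply JJ_abs_le_fun.
    + apply Bm2_mult; [assumption|apply bdq].
    + apply Bm2_scal. apply (Bm2_shift2 chi); assumption.
    + intros x t hx ht. destruct (classic (F x t)) as [hf|hf].
      2:{ rewrite chi1 by assumption. rewrite Rminus_diag, Rmult_0_l, Rabs_R0.
          pose proof (chi_ge0 x (t + h)). apply Rmult_le_pos; lra. }
      rewrite (chi0 x t), Rminus_0_r, Rmult_1_l by assumption.
      assert (hE : E x t) by (split; [split; apply Rabs_le; lra|assumption]).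
      unfold dq. fold h. replace (q x t) with 0 by (unfold q; rewrite kS1 by assumption; ring).
      rewrite Rminus_0_r. apply zz; [|apply chi01|].
      * destruct (cross_q x t h hE) as [_ w]; [rewrite Rabs_right; lra|]. rewrite (Rabs_right h) in w by lra. exact w.
      * intros h0. unfold q. rewrite kS1; [ring|]. split; [split; apply Rabs_le; lra|apply chiF; exact h0].
  - apply Rmult_le_compat_l; [lra|].
    rewrite (JJ_fubini a b c d (fun x t => chi x (t + h))) by (try assumption; apply (Bm2_shift2 chi); assumption).
    rewrite (JJ_fubini a b c d chi) by assumption. unfold JJ.
    replace (J a b (fun x => J c d (fun t => chi x t)) + h * (b - a)) with (J a b (fun x => J c d (fun t => chi x t) + h)).
    2:{ rewrite J_plus; [|apply (Bm2_J chi); assumption|apply Bm1_const]. rewrite J_const by assumption. reflexivity. }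
    apply J_le; [apply (Bm2_J (fun x t => chi x (t + h))); apply (Bm2_shift2 chi); assumption| |].
    + apply Bm1_plus; [apply (Bm2_J chi); assumption|apply Bm1_const].
    + intros x ht. pose proof (Bm2_sec2 chi x bchi) as bt. rewrite (J_shift c d h (fun t => chi x t) bt).
      pose proof (J_chasles c (c + h) (d + h) _ bt ltac:(lra) ltac:(lra)).
      pose proof (J_chasles c d (d + h) _ bt ltac:(lra) ltac:(lra)).
      assert (0 <= J c (c + h) (fun t => chi x t)) by (apply J_ge0; [assumption|lra|intros; apply chi_ge0]).
      assert (J d (d + h) (fun t => chi x t) <= 1 * (d + h - d)).
      { rewrite <- J_const by lra. apply J_le; [assumption|apply Bm1_const|intros; apply chi_le1]. }
      lra. }
assert (sum : JJ a b c d (dk n) + JJ a b c d (ds n) - JJ a b c d g =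
  JJ a b c d (fun x t => chi x t * (dk n x t + ds n x t - g x t)) + JJ a b c d (fun x t => (1 - chi x t) * r n x t)
  - JJ a b c d (fun x t => (1 - chi x t) * dp n x t) - JJ a b c d (fun x t => (1 - chi x t) * dq n x t)).
{ assert (b1 : Bm2 (fun x t => chi x t * (dk n x t + ds n x t - g x t))).
  { apply Bm2_mult; [assumption|]. apply Bm2_minus; [apply Bm2_plus; auto|assumption]. }
  assert (b2 : Bm2 (fun x t => (1 - chi x t) * r n x t)) by (apply Bm2_mult; auto).
  assert (b3 : Bm2 (fun x t => (1 - chi x t) * dp n x t)) by (apply Bm2_mult; auto).
  assert (b4 : Bm2 (fun x t => (1 - chi x t) * dq n x t)) by (apply Bm2_mult; auto).
  assert (b5 : Bm2 (fun x t => chi x t * (dk n x t + ds n x t - g x t) + (1 - chi x t) * r n x t)) by (apply (Bm2_plus _ _ b1 b2)).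
  rewrite <- (JJ_plus a b c d (dk n) (ds n)) by auto.
  rewrite <- (JJ_minus a b c d (fun x t => dk n x t + ds n x t) g); [|apply Bm2_plus; auto|assumption].
  rewrite <- (JJ_plus a b c d _ _ b1 b2). rewrite <- (JJ_minus a b c d _ _ b5 b3).
  rewrite <- (JJ_minus a b c d _ _ (Bm2_minus _ _ b5 b3) b4). apply JJ_ext. intros x t. apply (rel n x t). }
assert (T4 : Rabs (JJ a b c d (fun x t => (1 - chi x t) * r n x t)) <= eps n) by (unfold eps; lra).
unfold Div. apply Rabs_bnd in g1, g2, T1, T2, T3, T4. apply Rabs_le.
clear - g1 g2 T1 T2 T3 T4 sum. split; nra.
Qed.

(** After shrinking, every side meets [F] and contributes [2 * N * lam] times the integral of [chi];
    four sides give [8 * N * lam], the extension gives the rest. The bounds on the sides use the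
    original rectangle, whose aspect ratio is controlled, since the shrunk one may be arbitrarily
    thin. *)
Lemma Div_portion lam a b c d : 1 <= lam -> a <= b -> c <= d -> inU a b c d ->
  d - c <= lam * (b - a) -> b - a <= lam * (d - c) ->
  (exists x t, a <= x <= b /\ c <= t <= d /\ F x t) ->
  Rabs (D a b c d) <= (8 * N * lam + 6 * N + M) * JJ a b c d chi.
Proof.
intros l1 ab cd hU asp1 asp2 hne. pose proof hU as [u1 [u2 [u3 u4]]].
assert (M0 : 0 <= M) by (pose proof (mP 0 0); pose proof (Rabs_pos (P 0 0)); lra).
destruct (Div_shrink a b c d ab cd hne) as [a1 [b1 [c1 [d1 [h1 [h2 [h3 [h4 [h5 [h6 [e [[ta [hta Fa]] [[tb [htb Fb]] [[xc' [hxc Fc']] [xd [hxd Fd]]]]]]]]]]]]]]]].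
rewrite e.
assert (split : D a1 b1 c1 d1 = J c1 d1 (fun t => p b1 t - p a1 t) + J a1 b1 (fun x => q x d1 - q x c1) + Div kP kS g a1 b1 c1 d1).
{ unfold Div.
  assert (z1 : J c1 d1 (fun t => P b1 t - P a1 t) = J c1 d1 (fun t => p b1 t - p a1 t) + J c1 d1 (fun t => kP b1 t - kP a1 t)).
  { rewrite <- J_plus.
    - apply J_ext; intros t; unfold p; ring.
    - apply Bm1_minus; apply (Bm2_sec2 p _ bp).
    - apply Bm1_minus; apply (Bm2_sec2 kP _ bkP). }
  assert (z2 : J a1 b1 (fun x => S x d1 - S x c1) = J a1 b1 (fun x => q x d1 - q x c1) + J a1 b1 (fun x => kS x d1 - kS x c1)).
  { rewrite <- J_plus.
    - apply J_ext; intros t; unfold q; ring.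
    - apply Bm1_minus; apply (Bm2_sec1 q _ bq).
    - apply Bm1_minus; apply (Bm2_sec1 kS _ bkS). }
  rewrite z1, z2. ring. }
rewrite split.
pose proof (Div_extension a1 b1 c1 d1 h2 h5 ltac:(lra)) as K.
assert (mono : JJ a1 b1 c1 d1 chi <= JJ a b c d chi) by (apply JJ_mono; try assumption; lra).
assert (K' : (6 * N + M) * JJ a1 b1 c1 d1 chi <= (6 * N + M) * JJ a b c d chi) by (apply Rmult_le_compat_l; lra).
assert (A1 : Rabs (J c1 d1 (fun t => p b1 t - p a1 t)) <= 4 * N * lam * JJ a b c d chi).
{ apply Rle_trans with (4 * N * lam * JJ a b c1 d1 chi).
  - unfold JJ. rewrite <- J_scal by (apply (Bm2_J1 chi); assumption). apply J_abs_le_fun.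
    + apply Bm1_minus; apply (Bm2_sec2 p _ bp).
    + apply Bm1_scal; apply (Bm2_J1 chi); assumption.
    + intros t ht.
      pose proof (side_bound lam a b c d b1 t tb l1 hU asp1 ltac:(lra) ltac:(lra) htb Fb) as w1.
      pose proof (side_bound lam a b c d a1 t ta l1 hU asp1 ltac:(lra) ltac:(lra) hta Fa) as w2.
      apply Rabs_bnd in w1, w2. apply Rabs_le; lra.
  - apply Rmult_le_compat_l; [nra|]. apply JJ_mono; try assumption; lra. }
assert (A2 : Rabs (J a1 b1 (fun x => q x d1 - q x c1)) <= 4 * N * lam * JJ a b c d chi).
{ apply Rle_trans with (4 * N * lam * JJ a1 b1 c d chi).
  - rewrite JJ_fubini by assumption. unfold JJ. rewrite <- J_scal by (apply (Bm2_J chi); assumption). apply J_abs_le_fun.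
    + apply Bm1_minus; apply (Bm2_sec1 q _ bq).
    + apply Bm1_scal; apply (Bm2_J chi); assumption.
    + intros x ht.
      pose proof (side_bound2 lam a b c d d1 x xd l1 hU asp2 ltac:(lra) ltac:(lra) hxd Fd) as w1.
      pose proof (side_bound2 lam a b c d c1 x xc' l1 hU asp2 ltac:(lra) ltac:(lra) hxc Fc') as w2.
      apply Rabs_bnd in w1, w2. apply Rabs_le; lra.
  - apply Rmult_le_compat_l; [nra|]. apply JJ_mono; try assumption; lra. }
apply Rabs_bnd in A1, A2, K. apply Rabs_le. lra.
Qed.

Hypothesis bdF : Bm2 dF.
Hypothesis dF1 : forall x t, 0 <= dF x t <= 1.
Hypothesis dF2 : forall x t, ~ F x t -> 0 < dF x t.
Hypothesis dF3 : forall x t y s, F y s -> dF x t <= Rabs (x - y) + Rabs (t - s).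

(** A cut-off around [F]: at least 1 where [dF] is below [/ k], and 0 where it exceeds [2 / k]. *)
Let theta k x t := Rmax 0 (2 - dF x t * k).
Let btheta k : Bm2 (theta k).
Proof.
apply (Bm2_ext (fun x t => Rmax 0 (2 - dF x t * k))); [reflexivity|].
assert (b0 : Bm2 (fun x t => 2 - dF x t * k)).
{ apply Bm2_minus; [apply Bm2_const|]. apply Bm2_mult; [assumption|apply Bm2_const]. }
apply (Bm2_ext (fun x t => / 2 * ((2 - dF x t * k) + Rabs (2 - dF x t * k)))).
{ intros x t. unfold Rmax. destruct (Rle_dec 0 (2 - dF x t * k)); [rewrite Rabs_right|rewrite Rabs_left]; lra. }
apply Bm2_scal. apply Bm2_plus; [assumption|]. apply Bm2_abs. assumption.
Qed.

(** Halving both sides keeps the aspect ratio, hence the constant. A piece without bad points has no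
    defect; a piece that meets [F] stays within its own half-perimeter of [F], where the cut-off is
    at least 1. *)
Lemma Div_dyadic lam n : 1 <= lam -> forall a b c d, a < b -> c < d -> inU a b c d ->
  d - c <= lam * (b - a) -> b - a <= lam * (d - c) ->
  Rabs (D a b c d) <= (8 * N * lam + 6 * N + M) * JJ a b c d (fun x t => chi x t * theta (2 ^ n * / (b - a + (d - c))) x t).
Proof.
intros l1. assert (M0 : 0 <= M) by (pose proof (mP 0 0); pose proof (Rabs_pos (P 0 0)); lra).
assert (C0 : 0 <= 8 * N * lam + 6 * N + M) by nra.
assert (bct : forall k, Bm2 (fun x t => chi x t * theta k x t)) by (intros; apply Bm2_mult; [assumption|apply btheta]).
induction n as [|n IH]; intros a b c d ab cd hU asp1 asp2.
- destruct (classic (exists x t, a <= x <= b /\ c <= t <= d /\ F x t)) as [hne|hno].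
  2:{ rewrite Div_free; [|lra|lra|].
      - rewrite Rabs_R0. apply Rmult_le_pos; [assumption|]. apply JJ_ge0; [apply bct|lra|lra|].
        intros x t _ _. apply Rmult_le_pos; [apply chi_ge0|apply Rmax_l].
      - intros x t hx ht hf. apply hno; exists x, t; auto. }
  apply Rle_trans with (1 := Div_portion lam a b c d l1 ltac:(lra) ltac:(lra) hU asp1 asp2 hne).
  apply Rmult_le_compat_l; [assumption|]. apply JJ_le; [assumption|apply bct|].
  intros x t hx ht. rewrite <- (Rmult_1_r (chi x t)) at 1. apply Rmult_le_compat_l; [apply chi_ge0|].
  unfold theta. apply Rle_trans with (2 := Rmax_r _ _).
  destruct hne as [y [s [hy [hs hf]]]].
  assert (dF x t <= b - a + (d - c)).
  { apply Rle_trans with (1 := dF3 x t y s hf).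
    assert (Rabs (x - y) <= b - a) by (apply Rabs_le; lra). assert (Rabs (t - s) <= d - c) by (apply Rabs_le; lra). lra. }
  simpl. assert (dF x t * (1 * / (b - a + (d - c))) <= 1); [|lra].
  rewrite Rmult_1_l. apply Rmult_le_reg_r with (b - a + (d - c)); [lra|]. rewrite Rmult_assoc, Rinv_l by lra. lra.
- set (m := (a + b) / 2). set (s := (c + d) / 2).
  rewrite (Div_split1 P S g bP bS bg a m b) by (unfold m; lra).
  rewrite (Div_split2 P S g bP bS bg a m c s d) by (unfold s; lra).
  rewrite (Div_split2 P S g bP bS bg m b c s d) by (unfold s; lra).
  set (f := fun x t => chi x t * theta (2 ^ Datatypes.S n * / (b - a + (d - c))) x t).
  assert (bf : Bm2 f) by apply bct.
  rewrite (JJ_chasles1 a m b c d f) by (try assumption; unfold m; lra).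
  rewrite (JJ_chasles2 a m c s d f) by (try assumption; unfold s; lra).
  rewrite (JJ_chasles2 m b c s d f) by (try assumption; unfold s; lra).
  assert (sc : forall a' b' c' d', a' < b' -> c' < d' -> b' - a' = (b - a) / 2 -> d' - c' = (d - c) / 2 -> inU a' b' c' d' ->
     Rabs (D a' b' c' d') <= (8 * N * lam + 6 * N + M) * JJ a' b' c' d' f).
  { intros a' b' c' d' q1 q2 q3 q4 q5.
    replace f with (fun x t => chi x t * theta (2 ^ n * / (b' - a' + (d' - c'))) x t).
    - apply IH; try assumption; rewrite q3, q4; lra.
    - unfold f. rewrite q3, q4. replace (2 ^ n * / ((b - a) / 2 + (d - c) / 2)) with (2 ^ Datatypes.S n * / (b - a + (d - c))); [reflexivity|].
      simpl. field. lra. }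
  pose proof (sc a m c s) as w1; pose proof (sc a m s d) as w2; pose proof (sc m b c s) as w3; pose proof (sc m b s d) as w4.
  specialize (w1 ltac:(unfold m; lra) ltac:(unfold s; lra) ltac:(unfold m; lra) ltac:(unfold s; lra) ltac:(unfold m, s; lra)).
  specialize (w2 ltac:(unfold m; lra) ltac:(unfold s; lra) ltac:(unfold m; lra) ltac:(unfold s; lra) ltac:(unfold m, s; lra)).
  specialize (w3 ltac:(unfold m; lra) ltac:(unfold s; lra) ltac:(unfold m; lra) ltac:(unfold s; lra) ltac:(unfold m, s; lra)).
  specialize (w4 ltac:(unfold m; lra) ltac:(unfold s; lra) ltac:(unfold m; lra) ltac:(unfold s; lra) ltac:(unfold m, s; lra)).
  apply Rabs_bnd in w1, w2, w3, w4. apply Rabs_le. lra.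
Qed.

(** The dyadic bounds tend to 0 by dominated convergence: [chi] vanishes on [F], and off [F] the
    cut-offs are eventually 0. *)
Lemma Div_local a b c d : a <= b -> c <= d -> inU a b c d -> D a b c d = 0.
Proof.
intros ab cd hU.
destruct (Req_dec a b) as [->|nab]; [apply Div_self1; assumption|].
destruct (Req_dec c d) as [->|ncd]; [apply Div_self2; assumption|].
set (lam := 1 + (d - c) / (b - a) + (b - a) / (d - c)).
assert (p1 : 0 < (d - c) / (b - a)) by (apply Rdiv_lt_0_compat; lra).
assert (p2 : 0 < (b - a) / (d - c)) by (apply Rdiv_lt_0_compat; lra).
assert (q1 : d - c <= lam * (b - a)).
{ replace (d - c) with ((d - c) / (b - a) * (b - a)) at 1 by (field; lra). apply Rmult_le_compat_r; unfold lam; lra. }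
assert (q2 : b - a <= lam * (d - c)).
{ replace (b - a) with ((b - a) / (d - c) * (d - c)) at 1 by (field; lra). apply Rmult_le_compat_r; unfold lam; lra. }
assert (l1 : 1 <= lam) by (unfold lam; lra).
set (f := fun n x t => chi x t * theta (2 ^ n * / (b - a + (d - c))) x t).
assert (cv : Un_cv (fun n => JJ a b c d (f n)) (JJ a b c d (fun _ _ => 0))).
{ apply (JJ_lim a b c d f (fun _ _ => 0) 2); [assumption|intros; apply Bm2_mult; [assumption|apply btheta]|apply Bm2_const| |].
  - intros n x t _ _. unfold f, theta.
    assert (0 <= 2 ^ n * / (b - a + (d - c))).
    { apply Rmult_le_pos; [apply pow_le; lra|left; apply Rinv_0_lt_compat; lra]. }
    pose proof (dF1 x t). pose proof (chi_ge0 x t); pose proof (chi_le1 x t).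
    assert (0 <= Rmax 0 (2 - dF x t * (2 ^ n * / (b - a + (d - c)))) <= 2).
    { split; [apply Rmax_l|apply Rmax_lub; [lra|]]. assert (0 <= dF x t * (2 ^ n * / (b - a + (d - c)))) by (apply Rmult_le_pos; lra). lra. }
    rewrite Rabs_right; nra.
  - intros x t _ _. destruct (classic (F x t)) as [hf|hf].
    + apply (Un_cv_ext (fun _ => 0)); [|apply Un_cv_const]. intros n. unfold f. rewrite chi0 by assumption. ring.
    + pose proof (dF2 x t hf) as dp. intros eps e0.
      destruct (Pow_x_infinity 2 ltac:(rewrite Rabs_right; lra) (2 * (b - a + (d - c)) / dF x t)) as [n0 hn0'].
      exists n0. intros n hnn. specialize (hn0' n hnn). rewrite Rabs_right in hn0' by (apply Rle_ge; apply pow_le; lra).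
      unfold f, theta. rewrite Rmax_left; [rewrite Rmult_0_r; unfold Rdist; rewrite Rminus_diag, Rabs_R0; exact e0|].
      assert (2 <= dF x t * (2 ^ n * / (b - a + (d - c)))); [|lra].
      apply Rmult_le_reg_r with (b - a + (d - c)); [lra|].
      replace (dF x t * (2 ^ n * / (b - a + (d - c))) * (b - a + (d - c))) with (dF x t * 2 ^ n) by (field; lra).
      apply Rmult_le_reg_r with (/ dF x t); [apply Rinv_0_lt_compat; lra|].
      replace (dF x t * 2 ^ n * / dF x t) with (2 ^ n) by (field; lra). unfold Rdiv in hn0'. lra. }
rewrite JJ_const, !Rmult_0_l in cv by lra.
set (CC := 8 * N * lam + 6 * N + M).
assert (z : Rabs (D a b c d) <= 0).
{ apply (le_of_cv _ _ (fun n => CC * JJ a b c d (f n))).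
  - intros n. rewrite Rplus_0_l. apply Div_dyadic; try assumption; lra.
  - apply Un_cv_scal. exact cv. }
pose proof (Rabs_pos (D a b c d)). destruct (Req_dec (D a b c d) 0) as [->|ne]; [reflexivity|].
apply Rabs_no_R0 in ne. lra.
Qed.
End Local.

Theorem divergence a b c d : a <= b -> c <= d -> D a b c d = 0.
Proof.
intros ab cd. apply Div_free; try assumption. intros x t _ _ hF.
destruct (baire2 F (fun n x t => lip_at P (INR n + 1) x t /\ lip_at S (INR n + 1) x t)) as [n [xc [to_complex [rho [r0 [Fc hA]]]]]].
- intros n. pose proof (pos_INR n). intros x' t' hn. apply NNPP; intros hm. apply hn.
  assert (hh : forall r, 0 < r -> exists y s, Rabs (y - x') < r /\ Rabs (s - t') < r /\ lip_at P (INR n + 1) y s /\ lip_at S (INR n + 1) y s).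
  { intros r r0. apply NNPP; intros hk. apply hm. exists (r / 2). split; [lra|].
    intros y s hy hs hl. apply hk. exists y, s. split; [lra|]. split; [lra|]. exact hl. }
  split; apply lip_at_closed; try assumption; try lra; intros r r0; destruct (hh r r0) as [y [s [h1 [h2 [h3 h4]]]]]; exists y, s; auto.
- intros x' t'. destruct (lip_at_ex P x' t' _ _ (dPx x' t') (dPt x' t')) as [n1 h1].
  destruct (lip_at_ex S x' t' _ _ (dSx x' t') (dSt x' t')) as [n2 h2].
  exists (Nat.max n1 n2). split; [apply h1|apply h2]; lia.
- exists x, t; exact hF.
- set (N := INR n + 1). pose proof (pos_INR n). assert (N0 : 0 < N) by (unfold N; lra).
  (* A quarter of [/ N] makes the side [2 * r] of the square smaller than [/ N]. *)
  set (r := Rmin rho (/ N / 4)). assert (iN : 0 < / N) by (apply Rinv_0_lt_compat; assumption).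
  assert (r1 : 0 < r) by (apply Rmin_pos; lra). assert (r2 : r <= rho) by apply Rmin_l. assert (r3 : r <= / N / 4) by apply Rmin_r.
  assert (lP : forall x t, Rabs (x - xc) <= r /\ Rabs (t - to_complex) <= r -> F x t -> lip_at P N x t) by (intros y s [h1 h2] h3; apply hA; lra || assumption).
  assert (lS : forall x t, Rabs (x - xc) <= r /\ Rabs (t - to_complex) <= r -> F x t -> lip_at S N x t) by (intros y s [h1 h2] h3; apply hA; lra || assumption).
  destruct (mcshane_at xc to_complex r N r1 N0 ltac:(lra) Fc P mP lP) as [kP [kP1 [kP2 kP3]]].
  destruct (mcshane_at xc to_complex r N r1 N0 ltac:(lra) Fc S mS lS) as [kS [kS1 [kS2 kS3]]].
  destruct (indicator F (bad_closed P S g)) as [chi [dF [b1 [b2 [i1 [i2 [i3 [i4 i5]]]]]]]]; [exists x, t; exact hF|].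
  apply Fc. exists (r / 2). split; [lra|]. intros a' b' c' d' q1 q2 q3 q4 q5 q6.
  apply (Div_local xc to_complex r N) with (kP := kP) (kS := kS) (chi := chi) (dF := dF); try assumption; lra.
Qed.
End Key.

(** * Fourier series *)

(** The inequality with error [eps * (b - a)] is additive in the interval, so Cousin's lemma reduces
    it to the neighbourhood of one point. *)
Lemma J_FTC f F a b : Bm1 f -> a <= b -> (forall x, a <= x <= b -> continuity_pt f x) ->
  (forall x, a <= x <= b -> derivable_pt_lim F x (f x)) -> J a b f = F b - F a.
Proof.
intros bf ab cf dF.
assert (key : forall eps, 0 < eps -> Rabs (J a b f - (F b - F a)) <= eps * (b - a)).
{ intros eps e0.
  apply (cousin (fun a b => Rabs (J a b f - (F b - F a)) <= eps * (b - a))); [assumption| |].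
  - intros p m q h1 h2 h3 h4 k1 k2. rewrite (J_chasles p m q f bf h2 h3).
    apply Rabs_bnd in k1, k2. apply Rabs_le. lra.
  - intros x hx. destruct (cont_delta f x (eps / 2) (cf x hx) ltac:(lra)) as [d1 [p1 k1]].
    destruct (dF x hx (eps / 2) ltac:(lra)) as [d2 k2].
    exists (Rmin d1 d2 / 2). pose proof (Rmin_l d1 d2); pose proof (Rmin_r d1 d2). pose proof (cond_pos d2).
    assert (0 < Rmin d1 d2) by (apply Rmin_pos; assumption). split; [lra|].
    intros p q h1 h2 h3 h4 h5 h6.
    assert (s : forall y, Rabs (y - x) < d2 -> Rabs (F y - F x - f x * (y - x)) <= eps / 2 * Rabs (y - x)).
    { intros y hy. destruct (Req_dec (y - x) 0) as [e|ne].
      - replace y with x by lra. rewrite !Rminus_diag, Rmult_0_r, Rminus_0_r, !Rabs_R0. lra.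
      - specialize (k2 (y - x) ne hy). replace (x + (y - x)) with y in k2 by ring.
        replace (F y - F x - f x * (y - x)) with (((F y - F x) / (y - x) - f x) * (y - x)) by (field; exact ne).
        rewrite Rabs_mult. apply Rmult_le_compat_r; [apply Rabs_pos|lra]. }
    pose proof (s p ltac:(apply Rle_lt_trans with (Rmin d1 d2 / 2); [apply Rabs_le; lra|lra])) as sp.
    pose proof (s q ltac:(apply Rle_lt_trans with (Rmin d1 d2 / 2); [apply Rabs_le; lra|lra])) as sq.
    rewrite (Rabs_left1 (p - x)) in sp by lra. rewrite (Rabs_right (q - x)) in sq by lra.
    assert (sj : Rabs (J p q (fun y => f y - f x)) <= eps / 2 * (q - p)).
    { apply J_abs_le; [apply Bm1_minus; [assumption|apply Bm1_const]|lra|]. intros y hy. left. apply k1.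
      apply Rle_lt_trans with (Rmin d1 d2 / 2); [apply Rabs_le; lra|lra]. }
    rewrite J_minus, J_const in sj by (assumption || apply Bm1_const || lra).
    apply Rabs_bnd in sp, sq, sj. apply Rabs_le. lra. }
destruct (Req_dec (J a b f - (F b - F a)) 0) as [e|ne]; [lra|]. exfalso.
apply Rabs_no_R0 in ne. pose proof (Rabs_pos (J a b f - (F b - F a))).
set (z := Rabs (J a b f - (F b - F a))) in *. assert (0 < z) by lra.
assert (p : 0 < b - a + 1) by lra.
specialize (key (z / (2 * (b - a + 1))) ltac:(apply Rdiv_lt_0_compat; lra)).
assert (z / (2 * (b - a + 1)) * (b - a) < z); [|lra].
replace (z / (2 * (b - a + 1)) * (b - a)) with (z * ((b - a) / (2 * (b - a + 1)))) by (field; lra).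
rewrite <- (Rmult_1_r z) at 2. apply Rmult_lt_compat_l; [assumption|].
apply Rmult_lt_reg_r with (2 * (b - a + 1)); [lra|]. unfold Rdiv. rewrite Rmult_assoc, Rinv_l by lra. lra.
Qed.

Lemma deriv_of_J F G : Bm1 G -> continuity G -> (forall x y, x <= y -> F y - F x = J x y G) ->
  forall x, derivable_pt_lim F x (G x).
Proof.
intros bG cG h x eps e0. destruct (cont_delta G x (eps / 2) (cG x) ltac:(lra)) as [d [p k]].
exists (mkposreal d p). intros y y0 hy. simpl in hy.
assert (sj : forall p q, p <= q -> (forall z, p <= z <= q -> Rabs (z - x) < d) -> Rabs (J p q G - G x * (q - p)) <= eps / 2 * (q - p)).
{ intros p' q pq hz. rewrite <- (J_const p' q (G x) pq). rewrite <- J_minus by (assumption || apply Bm1_const).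
  apply J_abs_le; [apply Bm1_minus; [assumption|apply Bm1_const]|lra|]. intros z z1. left. apply k. apply hz; assumption. }
assert (key : Rabs (F (x + y) - F x - G x * y) <= eps / 2 * Rabs y).
{ apply Rabs_def2 in hy. destruct (Rle_lt_dec 0 y).
  - rewrite (Rabs_right y) by lra. rewrite (h x (x + y)) by lra.
    replace y with (x + y - x) at 2 3 by ring. apply sj; [lra|]. intros z hz. apply Rabs_def1; lra.
  - rewrite (Rabs_left y) by lra. rewrite <- Rabs_Ropp.
    replace (- (F (x + y) - F x - G x * y)) with (F x - F (x + y) - G x * (x - (x + y))) by ring.
    rewrite (h (x + y) x) by lra. replace (- y) with (x - (x + y)) by ring. apply sj; [lra|]. intros z hz. apply Rabs_def1; lra. }
replace ((F (x + y) - F x) / y - G x) with ((F (x + y) - F x - G x * y) * / y) by (field; assumption).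
rewrite Rabs_mult, Rabs_inv. assert (0 < Rabs y) by (apply Rabs_pos_lt; assumption).
apply Rmult_lt_reg_r with (Rabs y); [assumption|]. rewrite Rmult_assoc, Rinv_l by lra. nra.
Qed.

Definition cz (k : Z) t := cos (IZR k * t).
Definition sz (k : Z) t := sin (IZR k * t).
Lemma deriv_cz k t : derivable_pt_lim (cz k) t (- IZR k * sz k t).
Proof.
unfold cz, sz. replace (- IZR k * sin (IZR k * t)) with (- sin (IZR k * t) * (IZR k * 1)) by ring.
apply (derivable_pt_lim_comp (fun t => IZR k * t) cos).
- apply (derivable_pt_lim_scal id). apply derivable_pt_lim_id.
- apply derivable_pt_lim_cos.
Qed.

Lemma deriv_sz k t : derivable_pt_lim (sz k) t (IZR k * cz k t).
Proof.
unfold cz, sz. replace (IZR k * cos (IZR k * t)) with (cos (IZR k * t) * (IZR k * 1)) by ring.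
apply (derivable_pt_lim_comp (fun t => IZR k * t) sin).
- apply (derivable_pt_lim_scal id). apply derivable_pt_lim_id.
- apply derivable_pt_lim_sin.
Qed.

Lemma continuity_cz k : continuity (cz k). Proof. intros t; apply (derivable_pt_lim_continuity_pt _ _ _ (deriv_cz k t)). Qed.

Lemma continuity_sz k : continuity (sz k). Proof. intros t; apply (derivable_pt_lim_continuity_pt _ _ _ (deriv_sz k t)). Qed.

Lemma cz_le k t : Rabs (cz k t) <= 1.
Proof. apply Rabs_le; apply COS_bound. Qed.

Lemma sz_le k t : Rabs (sz k t) <= 1.
Proof. apply Rabs_le; apply SIN_bound. Qed.

Lemma Bm1_cz k : Bm1 (cz k). Proof. apply (Bm1_cont _ 1 (continuity_cz k)); apply cz_le. Qed.

Lemma Bm1_sz k : Bm1 (sz k). Proof. apply (Bm1_cont _ 1 (continuity_sz k)); apply sz_le. Qed.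

Lemma cz_plus j k t : cz (j + k) t = cz j t * cz k t - sz j t * sz k t.
Proof. unfold cz, sz. rewrite plus_IZR, Rmult_plus_distr_r. apply cos_plus. Qed.

Lemma sz_plus j k t : sz (j + k) t = sz j t * cz k t + cz j t * sz k t.
Proof. unfold cz, sz. rewrite plus_IZR, Rmult_plus_distr_r. apply sin_plus. Qed.

Lemma cz_opp k t : cz (- k) t = cz k t.
Proof. unfold cz. rewrite opp_IZR, <- Ropp_mult_distr_l. apply cos_neg. Qed.

Lemma sz_opp k t : sz (- k) t = - sz k t.
Proof. unfold sz. rewrite opp_IZR, <- Ropp_mult_distr_l. apply sin_neg. Qed.

Lemma cz_minus j k t : cz (j - k) t = cz j t * cz k t + sz j t * sz k t.
Proof. unfold Z.sub. rewrite cz_plus, cz_opp, sz_opp. ring. Qed.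

Lemma sz_minus j k t : sz (j - k) t = sz j t * cz k t - cz j t * sz k t.
Proof. unfold Z.sub. rewrite sz_plus, cz_opp, sz_opp. ring. Qed.

Lemma cz0 t : cz 0 t = 1. Proof. unfold cz. rewrite Rmult_0_l. apply cos_0. Qed.

Lemma sz0 t : sz 0 t = 0. Proof. unfold sz. rewrite Rmult_0_l. apply sin_0. Qed.

Lemma per_nat k t : cz (Z.of_nat k) (t + 2 * PI) = cz (Z.of_nat k) t /\ sz (Z.of_nat k) (t + 2 * PI) = sz (Z.of_nat k) t.
Proof.
unfold cz, sz. rewrite <- INR_IZR_INZ.
replace (INR k * (t + 2 * PI)) with (INR k * t + 2 * INR k * PI) by ring. split; [apply cos_period|apply sin_period].
Qed.

Lemma cz_per k t : cz k (t + 2 * PI) = cz k t.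
Proof.
destruct (Z.le_gt_cases 0 k).
- rewrite <- (Z2Nat.id k) by assumption. apply per_nat.
- rewrite <- (Z.opp_involutive k). rewrite !(cz_opp (- k)). rewrite <- (Z2Nat.id (- k)) by lia. apply per_nat.
Qed.

Lemma sz_per k t : sz k (t + 2 * PI) = sz k t.
Proof.
destruct (Z.le_gt_cases 0 k).
- rewrite <- (Z2Nat.id k) by assumption. apply per_nat.
- rewrite <- (Z.opp_involutive k). rewrite !(sz_opp (- k)). rewrite <- (Z2Nat.id (- k)) by lia. f_equal. apply per_nat.
Qed.

Ltac bm := repeat first
  [ assumption | apply Bm1_cz | apply Bm1_sz | apply Bm1_const | apply Bm1_scal | apply Bm1_minus | apply Bm1_plus | apply Bm1_opp | apply Bm1_mult ].

Lemma PI2_pos : 0 <= 2 * PI. Proof. pose proof PI_RGT_0; lra. Qed.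

Lemma J_cz k : k <> 0%Z -> J 0 (2 * PI) (cz k) = 0.
Proof.
intros k0. apply (IZR_neq k 0%Z) in k0.
rewrite (J_FTC (cz k) (fun t => / IZR k * sz k t)); [|apply Bm1_cz|apply PI2_pos|intros; apply continuity_cz|].
- replace (2 * PI) with (0 + 2 * PI) by ring. rewrite sz_per. ring.
- intros t _. replace (cz k t) with (/ IZR k * (IZR k * cz k t)) by (field; exact k0).
  apply (derivable_pt_lim_scal (sz k)). apply deriv_sz.
Qed.

Lemma J_sz k : J 0 (2 * PI) (sz k) = 0.
Proof.
destruct (Z.eq_dec k 0) as [->|k0].
- rewrite (J_ext _ _ _ (fun _ => 0)) by apply sz0. rewrite J_const by apply PI2_pos. ring.
- apply (IZR_neq k 0%Z) in k0.
  rewrite (J_FTC (sz k) (fun t => - / IZR k * cz k t)); [|apply Bm1_sz|apply PI2_pos|intros; apply continuity_sz|].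
  + replace (2 * PI) with (0 + 2 * PI) by ring. rewrite cz_per. ring.
  + intros t _. replace (sz k t) with (- / IZR k * (- IZR k * sz k t)) by (field; exact k0).
    apply (derivable_pt_lim_scal (cz k)). apply deriv_cz.
Qed.

Lemma J_per_bound f M : Bm1 f -> (forall t, Rabs (f t) <= M) -> Rabs (J 0 (2 * PI) f) <= M * (2 * PI).
Proof.
intros bf h. replace (M * (2 * PI)) with (M * (2 * PI - 0)) by ring. apply J_abs_le; [assumption|apply PI2_pos|].
intros; apply h.
Qed.

Section Uniqueness.
Variable f : R -> R.
Variable M : R.
Hypothesis cf : continuity f.
Hypothesis mf : forall t, Rabs (f t) <= M.
Hypothesis hc : forall k, J 0 (2 * PI) (fun t => f t * cz k t) = 0.
Hypothesis hs : forall k, J 0 (2 * PI) (fun t => f t * sz k t) = 0.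
Let bf : Bm1 f. Proof. apply (Bm1_cont f M); assumption. Qed.

Let kills phi := Bm1 phi /\ forall k, J 0 (2 * PI) (fun t => f t * phi t * cz k t) = 0 /\ J 0 (2 * PI) (fun t => f t * phi t * sz k t) = 0.

(** By the product-to-sum formulas, multiplication by [cz 1] or [sz 1] shifts the frequency by one,
    and [kills] concerns all frequencies. *)
Lemma kills_step phi al be ga : kills phi -> kills (fun t => phi t * (al + be * cz 1 t + ga * sz 1 t)).
Proof.
intros [bphi h]. split; [bm|]. intros k.
assert (e : forall u v w x y z : R -> R, (forall t, z t = al * u t + be / 2 * (v t + w t) + ga / 2 * (x t - y t)) ->
   Bm1 u -> Bm1 v -> Bm1 w -> Bm1 x -> Bm1 y -> J 0 (2 * PI) u = 0 -> J 0 (2 * PI) v = 0 -> J 0 (2 * PI) w = 0 ->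
   J 0 (2 * PI) x = 0 -> J 0 (2 * PI) y = 0 -> J 0 (2 * PI) z = 0).
{ intros u v w x y z hz bu bv bw bx by' e1 e2 e3 e4 e5. rewrite (J_ext _ _ _ _ hz).
  rewrite J_plus by bm. rewrite J_plus by bm. rewrite !J_scal by bm. rewrite J_plus by bm. rewrite J_minus by bm.
  rewrite e1, e2, e3, e4, e5. ring. }
split.
- apply (e (fun t => f t * phi t * cz k t) (fun t => f t * phi t * cz (k + 1) t) (fun t => f t * phi t * cz (k - 1) t)
   (fun t => f t * phi t * sz (k + 1) t) (fun t => f t * phi t * sz (k - 1) t)); try (bm; fail); try apply h.
  intros t. rewrite cz_plus, cz_minus, sz_plus, sz_minus. field.
- apply (e (fun t => f t * phi t * sz k t) (fun t => f t * phi t * sz (k + 1) t) (fun t => f t * phi t * sz (k - 1) t)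
   (fun t => f t * phi t * cz (k - 1) t) (fun t => f t * phi t * cz (k + 1) t)); try (bm; fail); try apply h.
  intros t. rewrite cz_plus, cz_minus, sz_plus, sz_minus. field.
Qed.

Lemma kills_pow al be ga n : kills (fun t => (al + be * cz 1 t + ga * sz 1 t) ^ n).
Proof.
induction n as [|n IH].
- split; [apply (Bm1_ext (fun _ => 1)); [reflexivity|bm]|]. intros k. simpl.
  rewrite (J_ext _ _ _ (fun t => f t * cz k t)) by (intros; ring).
  rewrite (J_ext _ _ (fun t => f t * 1 * sz k t) (fun t => f t * sz k t)) by (intros; ring). split; auto.
- replace (fun t => (al + be * cz 1 t + ga * sz 1 t) ^ S n) with
    (fun t => (al + be * cz 1 t + ga * sz 1 t) ^ n * (al + be * cz 1 t + ga * sz 1 t)).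
  + apply kills_step. exact IH.
  + apply functional_extensionality; intros t. simpl. ring.
Qed.

(** Lebesgue's argument: [1 + cos (t - t0) - cos dl] exceeds 1 near [t0], where [f] is positive, and
    has modulus at most 1 on the rest of the period. The integral of [f] against its powers would
    tend to infinity, whereas it vanishes. *)
Lemma fourier_pos_false t0 : 0 < t0 < 2 * PI -> 0 < f t0 -> False.
Proof.
intros ht f0. pose proof PI_RGT_0 as pi0.
destruct (cont_delta f t0 (f t0 / 2) (cf t0) ltac:(lra)) as [d0 [p0 k0]].
set (dl := Rmin (Rmin (d0 / 2) (PI / 2)) (Rmin t0 (2 * PI - t0))).
assert (d1 : 0 < dl) by (unfold dl; repeat apply Rmin_pos; lra).
assert (hd : dl <= d0 / 2 /\ dl <= PI / 2 /\ dl <= t0 /\ dl <= 2 * PI - t0).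
{ unfold dl. pose proof (Rmin_l (Rmin (d0 / 2) (PI / 2)) (Rmin t0 (2 * PI - t0))).
  pose proof (Rmin_r (Rmin (d0 / 2) (PI / 2)) (Rmin t0 (2 * PI - t0))).
  pose proof (Rmin_l (d0 / 2) (PI / 2)); pose proof (Rmin_r (d0 / 2) (PI / 2)).
  pose proof (Rmin_l t0 (2 * PI - t0)); pose proof (Rmin_r t0 (2 * PI - t0)). repeat split; lra. }
destruct hd as [hd1 [hd2 [hd3 hd4]]].
set (T := fun t => 1 - cos dl + cos t0 * cz 1 t + sin t0 * sz 1 t).
assert (T1 : forall t, T t = 1 + cos (t - t0) - cos dl).
{ intros t. unfold T, cz, sz. rewrite cos_minus. rewrite Rmult_1_l. ring. }
assert (cd0 : 0 <= cos dl) by (apply cos_ge_0; lra).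
assert (cd1 : cos dl <= 1) by apply COS_bound.
set (eta := cos (dl / 2) - cos dl).
assert (eta0 : 0 < eta) by (unfold eta; assert (cos dl < cos (dl / 2)) by (apply cos_decreasing_1; lra); lra).
assert (far : forall t, 0 <= t <= 2 * PI -> dl <= Rabs (t - t0) -> Rabs (T t) <= 1).
{ intros t h1 h2. rewrite T1. pose proof (COS_bound (t - t0)).
  assert (cos (t - t0) <= cos dl); [|apply Rabs_le; lra].
  assert (ev : cos (t - t0) = cos (Rabs (t - t0))).
  { unfold Rabs. destruct (Rcase_abs (t - t0)); [rewrite cos_neg; reflexivity|reflexivity]. }
  rewrite ev. assert (Rabs (t - t0) <= 2 * PI - dl) by (apply Rabs_le; lra).
  destruct (Rle_lt_dec (Rabs (t - t0)) PI).
  - apply cos_decr_1; lra.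
  - replace (cos (Rabs (t - t0))) with (cos (2 * PI - Rabs (t - t0))).
    + apply cos_decr_1; lra.
    + replace (2 * PI - Rabs (t - t0)) with (- Rabs (t - t0) + 2 * 1 * PI) by ring.
      rewrite <- (cos_neg (Rabs (t - t0))). apply (cos_period (- Rabs (t - t0)) 1). }
assert (near1 : forall t, Rabs (t - t0) <= dl -> 1 <= T t).
{ intros t h. rewrite T1. assert (cos dl <= cos (t - t0)); [|lra].
  assert (ev : cos (t - t0) = cos (Rabs (t - t0))).
  { unfold Rabs. destruct (Rcase_abs (t - t0)); [rewrite cos_neg; reflexivity|reflexivity]. }
  rewrite ev. pose proof (Rabs_pos (t - t0)). apply cos_decr_1; lra. }
assert (near2 : forall t, Rabs (t - t0) <= dl / 2 -> 1 + eta <= T t).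
{ intros t h. rewrite T1. unfold eta. assert (cos (dl / 2) <= cos (t - t0)); [|lra].
  assert (ev : cos (t - t0) = cos (Rabs (t - t0))).
  { unfold Rabs. destruct (Rcase_abs (t - t0)); [rewrite cos_neg; reflexivity|reflexivity]. }
  rewrite ev. pose proof (Rabs_pos (t - t0)). apply cos_decr_1; lra. }
assert (fpos : forall t, Rabs (t - t0) <= dl -> f t0 / 2 <= f t).
{ intros t h. specialize (k0 t ltac:(lra)). apply Rlt_le, Rabs_bnd in k0. lra. }
assert (M0 : 0 <= M) by (pose proof (mf 0); pose proof (Rabs_pos (f 0)); lra).
assert (low : forall n, f t0 / 2 * (1 + eta) ^ n * dl <= M * (2 * PI)).
{ intros n. destruct (kills_pow (1 - cos dl) (cos t0) (sin t0) n) as [bT z]. specialize (z 0%Z).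
  destruct z as [z _].
  set (g := fun t => f t * T t ^ n).
  assert (bg : Bm1 g) by (unfold g, T; bm).
  assert (zg : J 0 (2 * PI) g = 0).
  { rewrite (J_ext _ _ _ (fun t => f t * (1 - cos dl + cos t0 * cz 1 t + sin t0 * sz 1 t) ^ n * cz 0 t)); [exact z|].
    intros t. unfold g. rewrite cz0. unfold T. ring. }
  rewrite (J_chasles 0 (t0 - dl / 2) (2 * PI)) in zg by (try assumption; lra).
  rewrite (J_chasles (t0 - dl / 2) (t0 + dl / 2) (2 * PI)) in zg by (try assumption; lra).
  assert (lowg : forall t, 0 <= t <= 2 * PI -> - M <= g t).
  { intros t h. unfold g. destruct (Rle_lt_dec dl (Rabs (t - t0))) as [q|q].
    - assert (Rabs (f t * T t ^ n) <= M * 1).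
      { rewrite Rabs_mult. apply Rmult_le_compat; try apply Rabs_pos; [apply mf|]. rewrite <- RPow_abs.
        rewrite <- (pow1 n). apply pow_incr. split; [apply Rabs_pos|apply far; assumption]. }
      apply Rabs_bnd in H. lra.
    - assert (0 <= f t * T t ^ n); [|lra]. apply Rmult_le_pos; [pose proof (fpos t ltac:(lra)); lra|].
      apply pow_le. pose proof (near1 t ltac:(lra)). lra. }
  assert (g1 : - M * (t0 - dl / 2 - 0) <= J 0 (t0 - dl / 2) g).
  { rewrite <- J_const by lra. apply J_le; [apply Bm1_const|assumption|]. intros; apply lowg; lra. }
  assert (g3 : - M * (2 * PI - (t0 + dl / 2)) <= J (t0 + dl / 2) (2 * PI) g).
  { rewrite <- J_const by lra. apply J_le; [apply Bm1_const|assumption|]. intros; apply lowg; lra. }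
  assert (g2 : f t0 / 2 * (1 + eta) ^ n * (t0 + dl / 2 - (t0 - dl / 2)) <= J (t0 - dl / 2) (t0 + dl / 2) g).
  { rewrite <- J_const by lra. apply J_le; [apply Bm1_const|assumption|]. intros t h. unfold g.
    assert (ab : Rabs (t - t0) <= dl / 2) by (apply Rabs_le; lra).
    apply Rmult_le_compat; [lra|apply pow_le; lra|apply fpos; lra|]. apply pow_incr. split; [lra|apply near2; assumption]. }
  replace (t0 + dl / 2 - (t0 - dl / 2)) with dl in g2 by lra. nra. }
set (B := M * (2 * PI) / (f t0 / 2 * dl)).
assert (q0 : 0 < f t0 / 2 * dl) by (apply Rmult_lt_0_compat; lra).
destruct (Pow_x_infinity (1 + eta) ltac:(rewrite Rabs_right; lra) (B + 1)) as [n hn].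
specialize (hn n ltac:(lia)). rewrite Rabs_right in hn by (apply Rle_ge, pow_le; lra).
specialize (low n).
assert ((1 + eta) ^ n <= B); [|lra]. unfold B. apply Rmult_le_reg_r with (f t0 / 2 * dl); [assumption|].
unfold Rdiv at 2. rewrite Rmult_assoc, Rinv_l by lra. lra.
Qed.
End Uniqueness.

Lemma fourier_unique f M : continuity f -> (forall t, Rabs (f t) <= M) ->
  (forall k, J 0 (2 * PI) (fun t => f t * cz k t) = 0) -> (forall k, J 0 (2 * PI) (fun t => f t * sz k t) = 0) ->
  forall t, 0 <= t <= 2 * PI -> f t = 0.
Proof.
intros cf mf hc hs. pose proof PI_RGT_0 as pi0.
assert (bf : Bm1 f) by (apply (Bm1_cont f M); assumption).
assert (inn : forall t, 0 < t < 2 * PI -> f t = 0).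
{ intros t ht. destruct (Rtotal_order (f t) 0) as [h|[h|h]]; [|exact h|].
  - exfalso. apply (fourier_pos_false (fun t => - f t) M) with (t0 := t); try assumption; try lra.
    + apply continuity_opp; assumption.
    + intros; rewrite Rabs_Ropp; apply mf.
    + intros k. rewrite (J_ext _ _ _ (fun t => (-1) * (f t * cz k t))) by (intros; ring). rewrite J_scal by bm. rewrite hc. ring.
    + intros k. rewrite (J_ext _ _ _ (fun t => (-1) * (f t * sz k t))) by (intros; ring). rewrite J_scal by bm. rewrite hs. ring.
  - exfalso. apply (fourier_pos_false f M cf mf hc hs t); assumption. }
intros t ht. destruct (Req_dec (f t) 0) as [e|ne]; [exact e|]. exfalso.
destruct (cont_delta f t (Rabs (f t)) (cf t)) as [d [d0 k]]; [apply Rabs_pos_lt; assumption|].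
assert (exists s, 0 < s < 2 * PI /\ Rabs (s - t) < d) as [s [h1 h2]].
{ destruct (Rle_lt_dec t PI).
  - exists (t + Rmin (d / 2) (PI / 2)). assert (0 < Rmin (d / 2) (PI / 2)) by (apply Rmin_pos; lra).
    pose proof (Rmin_l (d / 2) (PI / 2)); pose proof (Rmin_r (d / 2) (PI / 2)). split; [lra|]. apply Rabs_def1; lra.
  - exists (t - Rmin (d / 2) (PI / 2)). assert (0 < Rmin (d / 2) (PI / 2)) by (apply Rmin_pos; lra).
    pose proof (Rmin_l (d / 2) (PI / 2)); pose proof (Rmin_r (d / 2) (PI / 2)). split; [lra|]. apply Rabs_def1; lra. }
specialize (k s h2). rewrite (inn s h1) in k. rewrite Rminus_0_l, Rabs_Ropp in k. lra.
Qed.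

(** * Finite sums over sets of integers *)

Fixpoint lsum (l : list Z) (f : Z -> R) : R := match l with nil => 0 | k :: l => f k + lsum l f end.
Lemma lsum_ext l f g : (forall k, In k l -> f k = g k) -> lsum l f = lsum l g.
Proof. induction l as [|k l IH]; simpl; intros h; [reflexivity|]. rewrite h, IH by auto. reflexivity. Qed.

Lemma lsum_plus l f g : lsum l (fun k => f k + g k) = lsum l f + lsum l g.
Proof. induction l as [|k l IH]; simpl; [ring|]. rewrite IH. ring. Qed.

Lemma lsum_scal l c f : lsum l (fun k => c * f k) = c * lsum l f.
Proof. induction l as [|k l IH]; simpl; [ring|]. rewrite IH. ring. Qed.

Lemma lsum_le l f g : (forall k, In k l -> f k <= g k) -> lsum l f <= lsum l g.
Proof. induction l as [|k l IH]; simpl; intros h; [lra|]. pose proof (h k (or_introl eq_refl)). specialize (IH (fun j hj => h j (or_intror hj))). lra. Qed.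

Lemma lsum_abs l f : Rabs (lsum l f) <= lsum l (fun k => Rabs (f k)).
Proof. induction l as [|k l IH]; simpl; [rewrite Rabs_R0; lra|]. pose proof (Rabs_triang (f k) (lsum l f)). lra. Qed.

Lemma lsum_0 l : lsum l (fun _ => 0) = 0.
Proof. induction l as [|k l IH]; simpl; [reflexivity|]. rewrite IH. ring. Qed.

Lemma lsum_ge0 l f : (forall k, In k l -> 0 <= f k) -> 0 <= lsum l f.
Proof. intros h. rewrite <- (lsum_0 l). apply lsum_le; exact h. Qed.

Lemma lsum_exch l l' f : lsum l (fun k => lsum l' (fun j => f k j)) = lsum l' (fun j => lsum l (fun k => f k j)).
Proof. induction l as [|k l IH]; simpl; [rewrite lsum_0; reflexivity|]. rewrite IH, <- lsum_plus. reflexivity. Qed.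

Lemma lsum_app l l' f : lsum (l ++ l') f = lsum l f + lsum l' f.
Proof. induction l as [|k l IH]; simpl; [ring|]. rewrite IH. ring. Qed.

Lemma lsum_perm l l' f : Permutation l l' -> lsum l f = lsum l' f.
Proof. induction 1; simpl; lra. Qed.

Lemma lsum_map l g f : lsum (map g l) f = lsum l (fun k => f (g k)).
Proof. induction l as [|k l IH]; simpl; [reflexivity|]. rewrite IH. reflexivity. Qed.

Lemma lsum_in l f j : (forall k, In k l -> 0 <= f k) -> In j l -> f j <= lsum l f.
Proof.
induction l as [|k l IH]; simpl; intros h hj; [contradiction|destruct hj as [->|hj]].
- pose proof (lsum_ge0 l f (fun i hi => h i (or_intror hi))). lra.
- pose proof (h k (or_introl eq_refl)). specialize (IH (fun i hi => h i (or_intror hi)) hj). lra.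
Qed.

Definition rest (l l' : list Z) := filter (fun k => negb (if in_dec Z.eq_dec k l then true else false)) l'.
Lemma rest_In l l' k : In k (rest l l') <-> In k l' /\ ~ In k l.
Proof.
unfold rest. rewrite filter_In. destruct (in_dec Z.eq_dec k l); simpl; split; intros [h1 h2]; split; auto; try discriminate; contradiction.
Qed.

Lemma lsum_sub l l' f : NoDup l -> NoDup l' -> incl l l' -> lsum l' f = lsum l f + lsum (rest l l') f.
Proof.
intros n1 n2 hi. rewrite <- lsum_app. apply lsum_perm. apply NoDup_Permutation; [assumption| |].
- apply NoDup_app; [assumption|apply NoDup_filter; assumption|]. intros k hk hr. apply rest_In in hr. tauto.
- intros k. rewrite in_app_iff, rest_In. split; [intros h; destruct (in_dec Z.eq_dec k l); tauto|intros [h|h]; [apply hi; exact h|tauto]].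
Qed.

Lemma lsum_incl l l' f : NoDup l -> NoDup l' -> incl l l' -> (forall k, 0 <= f k) -> lsum l f <= lsum l' f.
Proof. intros n1 n2 hi h. rewrite (lsum_sub l l' f n1 n2 hi). pose proof (lsum_ge0 (rest l l') f (fun k _ => h k)). lra. Qed.

Fixpoint zr (n : nat) : list Z := match n with O => [0%Z] | S m => Z.of_nat n :: (- Z.of_nat n)%Z :: zr m end.
Lemma lsum_zr n f : lsum (zr (S n)) f = f (Z.of_nat (S n)) + (f (- Z.of_nat (S n))%Z + lsum (zr n) f).
Proof. reflexivity. Qed.

Lemma zr_In n k : In k (zr n) <-> (Z.abs k <= Z.of_nat n)%Z.
Proof.
induction n as [|n IH]; simpl zr; simpl In.
- lia.
- rewrite IH. lia.
Qed.

Lemma zr_NoDup n : NoDup (zr n).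
Proof.
induction n as [|n IH].
- constructor; [intros []|constructor].
- simpl zr. constructor.
  + intros [h|h]; [lia|]. apply zr_In in h. lia.
  + constructor; [|exact IH]. intros h. apply zr_In in h. lia.
Qed.

Lemma incl_zr l : exists n, incl l (zr n).
Proof.
induction l as [|k l [n IH]]; [exists 0%nat; intros k []|]. exists (n + Z.abs_nat k)%nat. intros j [->|hj].
- apply zr_In. lia.
- apply IH in hj. apply zr_In in hj. apply zr_In. lia.
Qed.

Definition q2 (k : Z) := / (1 + IZR k * IZR k).
Lemma q2_pos k : 0 < q2 k.
Proof. unfold q2. apply Rinv_0_lt_compat. nra. Qed.

(** Telescoping: [1 / (1 + m^2)] is at most [1 / (m - 1/2) - 1 / (m + 1/2)] for [m >= 1], and the
    starting value [2 / (T - 1/2)] is at most [4 / T]. The maximum with 0 covers ranges that do not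
    reach [T]. *)
Lemma zr_tail T n : (1 <= T)%nat ->
  lsum (zr n) (fun k => if Z_le_dec (Z.of_nat T) (Z.abs k) then q2 k else 0) <= Rmax 0 (4 / INR T - 2 / (INR n + / 2)).
Proof.
intros hT. assert (T0 : 1 <= INR T) by (apply (le_INR 1); assumption).
induction n as [|n IH].
- simpl. destruct (Z_le_dec (Z.of_nat T) 0); [lia|]. rewrite Rplus_0_r. apply Rmax_l.
- rewrite lsum_zr. rewrite Z.abs_opp, (Z.abs_eq (Z.of_nat (S n))) by lia.
  pose proof (pos_INR n) as pn.
  destruct (Z_le_dec (Z.of_nat T) (Z.of_nat (S n))) as [h|h].
  + assert (hTn : INR T <= INR n + 1) by (rewrite <- S_INR; apply le_INR; lia).
    assert (e : forall s, IZR s * IZR s = (INR n + 1) * (INR n + 1) -> q2 s <= / (INR n + / 2) - / (INR n + 1 + / 2)).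
    { intros s es. unfold q2. rewrite es.
      replace (/ (INR n + / 2) - / (INR n + 1 + / 2)) with (/ ((INR n + 1) * (INR n + 1) - / 4)) by (field; nra).
      apply Rinv_le_contravar; nra. }
    assert (en : IZR (Z.of_nat (S n)) = INR n + 1).
    { rewrite <- S_INR, INR_IZR_INZ. reflexivity. }
    pose proof (e (Z.of_nat (S n)) ltac:(rewrite en; ring)) as e1.
    pose proof (e (- Z.of_nat (S n))%Z ltac:(rewrite opp_IZR, en; ring)) as e2.
    assert (IH' : lsum (zr n) (fun k => if Z_le_dec (Z.of_nat T) (Z.abs k) then q2 k else 0) <= 4 / INR T - 2 / (INR n + / 2)).
    { apply Rle_trans with (1 := IH). apply Req_le, Rmax_right.
      assert (2 / (INR n + / 2) <= 4 / INR T); [|lra]. unfold Rdiv.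
      apply Rmult_le_reg_r with (INR T); [lra|]. apply Rmult_le_reg_r with (INR n + / 2); [lra|].
      replace (2 * / (INR n + / 2) * INR T * (INR n + / 2)) with (2 * INR T) by (field; lra).
      replace (4 * / INR T * INR T * (INR n + / 2)) with (4 * INR n + 2) by (field; lra).
      lra. }
    apply Rle_trans with (2 := Rmax_r _ _). rewrite S_INR. unfold Rdiv in *. lra.
  + rewrite !Rplus_0_l. apply Rle_trans with (1 := IH). rewrite S_INR.
    apply Rmax_lub; [apply Rmax_l|]. apply Rle_trans with (2 := Rmax_r _ _).
    assert (2 / (INR n + 1 + / 2) <= 2 / (INR n + / 2)); [|lra]. unfold Rdiv. apply Rmult_le_compat_l; [lra|].
    apply Rinv_le_contravar; lra.
Qed.

Lemma q2_tail T l : (1 <= T)%nat -> NoDup l -> lsum l (fun k => if Z_le_dec (Z.of_nat T) (Z.abs k) then q2 k else 0) <= 4 / INR T.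
Proof.
intros hT nl. destruct (incl_zr l) as [n hn]. assert (T0 : 1 <= INR T) by (apply (le_INR 1); assumption).
apply Rle_trans with (lsum (zr n) (fun k => if Z_le_dec (Z.of_nat T) (Z.abs k) then q2 k else 0)).
- apply lsum_incl; try assumption; [apply zr_NoDup|]. intros k. destruct (Z_le_dec _ _); [left; apply q2_pos|lra].
- apply Rle_trans with (1 := zr_tail T n hT). apply Rmax_lub.
  + apply Rmult_le_pos; [lra|]. left; apply Rinv_0_lt_compat; lra.
  + pose proof (pos_INR n). assert (0 < 2 / (INR n + / 2)) by (apply Rdiv_lt_0_compat; lra). lra.
Qed.

(** The term at 0 plus the tail from 1, that is [1 + 4]. *)
Lemma q2_total l : NoDup l -> lsum l q2 <= 5.
Proof.
intros nl. destruct (incl_zr l) as [n hn].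
apply Rle_trans with (lsum (zr n) q2).
{ apply lsum_incl; try assumption; [apply zr_NoDup|]. intros k. left; apply q2_pos. }
apply Rle_trans with (lsum (zr n) (fun k => if Z_le_dec (Z.of_nat 1) (Z.abs k) then q2 k else 0) + 1).
- clear. induction n as [|n IH].
  + simpl. destruct (Z_le_dec 1 0); [lia|]. unfold q2. replace (1 + 0 * 0) with 1 by ring. rewrite Rinv_1. lra.
  + rewrite !lsum_zr. rewrite Z.abs_opp, (Z.abs_eq (Z.of_nat (S n))) by lia.
    destruct (Z_le_dec (Z.of_nat 1) (Z.of_nat (S n))); [|lia]. lra.
- pose proof (q2_tail 1 (zr n) ltac:(lia) (zr_NoDup n)). simpl INR in H. lra.
Qed.

Lemma Bm1_lsum l (g : Z -> R -> R) : (forall k, Bm1 (g k)) -> Bm1 (fun t => lsum l (fun k => g k t)).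
Proof. intros h. induction l as [|k l IH]; simpl; [apply Bm1_const|]. apply Bm1_plus; [apply h|exact IH]. Qed.

Lemma J_lsum a b l (g : Z -> R -> R) : a <= b -> (forall k, Bm1 (g k)) ->
  J a b (fun t => lsum l (fun k => g k t)) = lsum l (fun k => J a b (g k)).
Proof.
intros ab h. induction l as [|k l IH]; simpl.
- rewrite J_const by assumption. ring.
- rewrite (J_plus a b (g k)); [|apply h|apply Bm1_lsum; exact h]. rewrite IH. reflexivity.
Qed.

Lemma lsum_continuity l (g : Z -> R -> R) : (forall k, continuity (g k)) -> continuity (fun t => lsum l (fun k => g k t)).
Proof.
intros h. induction l as [|k l IH]; simpl.
- apply continuity_const. intros x y; reflexivity.
- apply (continuity_plus (g k)); [apply h|exact IH].
Qed.

Lemma lsum_delta l f j : NoDup l -> In j l -> (forall k, k <> j -> f k = 0) -> lsum l f = f j.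
Proof.
induction l as [|k l IH]; simpl; intros nd hj h; [contradiction|]. inversion nd; subst.
destruct hj as [->|hj].
- rewrite (lsum_ext l f (fun _ => 0)); [rewrite lsum_0; ring|]. intros i hi. apply h. intros ->. contradiction.
- rewrite (h k); [rewrite IH by assumption; ring|]. intros ->. contradiction.
Qed.

(** The hypotheses are the real and imaginary parts of the Fourier integrals of [f + i h]; the
    frequencies [k] and [- k] together separate the four real integrals. *)
Lemma pair_unique f h M : continuity f -> continuity h -> (forall t, Rabs (f t) <= M) -> (forall t, Rabs (h t) <= M) ->
  (forall k, J 0 (2 * PI) (fun t => f t * cz k t + h t * sz k t) = 0) ->
  (forall k, J 0 (2 * PI) (fun t => h t * cz k t - f t * sz k t) = 0) ->
  forall t, 0 <= t <= 2 * PI -> f t = 0 /\ h t = 0.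
Proof.
intros cf ch mf mh e1 e2.
assert (bf : Bm1 f) by (apply (Bm1_cont f M); assumption). assert (bh : Bm1 h) by (apply (Bm1_cont h M); assumption).
assert (z : forall k, (J 0 (2 * PI) (fun t => f t * cz k t) = 0 /\ J 0 (2 * PI) (fun t => h t * sz k t) = 0) /\
  (J 0 (2 * PI) (fun t => h t * cz k t) = 0 /\ J 0 (2 * PI) (fun t => f t * sz k t) = 0)).
{ intros k. pose proof (e1 k) as a1. pose proof (e1 (- k)%Z) as a2. pose proof (e2 k) as a3. pose proof (e2 (- k)%Z) as a4.
  rewrite (J_ext _ _ _ (fun t => f t * cz k t - h t * sz k t)) in a2 by (intros; rewrite cz_opp, sz_opp; ring).
  rewrite (J_ext _ _ _ (fun t => h t * cz k t + f t * sz k t)) in a4 by (intros; rewrite cz_opp, sz_opp; ring).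
  rewrite J_plus in a1, a4 by bm. rewrite J_minus in a2, a3 by bm. lra. }
intros t ht. split.
- apply (fourier_unique f M); try assumption; intros k; apply z.
- apply (fourier_unique h M); try assumption; intros k; apply z.
Qed.

(** Two integrations by parts at once: [k^2 f cos(k t) + f'' cos(k t)] is the derivative of the
    periodic function [k f sin(k t) + f' cos(k t)], and similarly with the sine. *)
Lemma coef_bound f f1 f2 M M2 : (forall t, derivable_pt_lim f t (f1 t)) -> (forall t, derivable_pt_lim f1 t (f2 t)) ->
  continuity f2 -> (forall t, Rabs (f t) <= M) -> (forall t, Rabs (f2 t) <= M2) ->
  (forall t, f (t + 2 * PI) = f t) -> (forall t, f1 (t + 2 * PI) = f1 t) ->
  forall k, Rabs (J 0 (2 * PI) (fun t => f t * cz k t)) <= (M + M2) * (2 * PI) * q2 k /\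
            Rabs (J 0 (2 * PI) (fun t => f t * sz k t)) <= (M + M2) * (2 * PI) * q2 k.
Proof.
intros d1 d2 c2 m m2 per per1 k.
assert (cf : continuity f) by (intros t; apply (derivable_pt_lim_continuity_pt _ _ _ (d1 t))).
assert (cf1 : continuity f1) by (intros t; apply (derivable_pt_lim_continuity_pt _ _ _ (d2 t))).
assert (bf : Bm1 f) by (apply (Bm1_cont f M); assumption). assert (bf2 : Bm1 f2) by (apply (Bm1_cont f2 M2); assumption).
set (n := IZR k).
assert (prodle : forall u w K : R, Rabs u <= K -> Rabs w <= 1 -> Rabs (u * w) <= K).
{ intros u w K hu hw. rewrite Rabs_mult. rewrite <- (Rmult_1_r K). apply Rmult_le_compat; try apply Rabs_pos; assumption. }
assert (fin : forall j1 j2, Rabs j1 <= M * (2 * PI) -> Rabs j2 <= M2 * (2 * PI) -> n * n * j1 + j2 = 0 ->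
   Rabs j1 <= (M + M2) * (2 * PI) * q2 k).
{ intros j1 j2 h1 h2 h3. unfold q2. fold n. apply Rmult_le_reg_r with (1 + n * n); [nra|].
  rewrite (Rmult_assoc _ (/ _)), Rinv_l by nra. rewrite Rmult_1_r.
  assert (Rabs (n * n * j1) <= M2 * (2 * PI)) by (replace (n * n * j1) with (- j2) by lra; rewrite Rabs_Ropp; assumption).
  rewrite Rabs_mult, (Rabs_right (n * n)) in H by nra. lra. }
split.
- apply (fin _ (J 0 (2 * PI) (fun t => f2 t * cz k t))).
  + apply J_per_bound; [bm|]. intros t. apply prodle; [apply m|apply cz_le].
  + apply J_per_bound; [bm|]. intros t. apply prodle; [apply m2|apply cz_le].
  + rewrite <- J_scal by bm. rewrite <- J_plus by bm.
    rewrite (J_FTC _ (fun t => n * (f t * sz k t) + f1 t * cz k t)); [|bm|apply PI2_pos| |].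
    * replace (2 * PI) with (0 + 2 * PI) by ring. rewrite per, per1, cz_per, sz_per. ring.
    * intros t _. apply continuity_pt_plus; [apply continuity_pt_scal|]; apply continuity_pt_mult; try apply cf; try apply continuity_cz; try apply c2.
    * intros t _. replace (n * n * (f t * cz k t) + f2 t * cz k t) with
        (n * (f1 t * sz k t + f t * (IZR k * cz k t)) + (f2 t * cz k t + f1 t * (- IZR k * sz k t))) by (unfold n; ring).
      apply derivable_pt_lim_plus.
      -- apply (derivable_pt_lim_scal (fun t => f t * sz k t)). apply (derivable_pt_lim_mult f (sz k)); [apply d1|apply deriv_sz].
      -- apply (derivable_pt_lim_mult f1 (cz k)); [apply d2|apply deriv_cz].
- apply (fin _ (J 0 (2 * PI) (fun t => f2 t * sz k t))).
  + apply J_per_bound; [bm|]. intros t. apply prodle; [apply m|apply sz_le].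
  + apply J_per_bound; [bm|]. intros t. apply prodle; [apply m2|apply sz_le].
  + rewrite <- J_scal by bm. rewrite <- J_plus by bm.
    rewrite (J_FTC _ (fun t => - n * (f t * cz k t) + f1 t * sz k t)); [|bm|apply PI2_pos| |].
    * replace (2 * PI) with (0 + 2 * PI) by ring. rewrite per, per1, cz_per, sz_per. ring.
    * intros t _. apply continuity_pt_plus; [apply continuity_pt_scal|]; apply continuity_pt_mult; try apply cf; try apply continuity_sz; try apply c2.
    * intros t _. replace (n * n * (f t * sz k t) + f2 t * sz k t) with
        (- n * (f1 t * cz k t + f t * (- IZR k * sz k t)) + (f2 t * sz k t + f1 t * (IZR k * cz k t))) by (unfold n; ring).
      apply derivable_pt_lim_plus.
      -- apply (derivable_pt_lim_scal (fun t => f t * cz k t)). apply (derivable_pt_lim_mult f (cz k)); [apply d1|apply deriv_cz].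
      -- apply (derivable_pt_lim_mult f1 (sz k)); [apply d2|apply deriv_sz].
Qed.

Lemma unif_lim_seq (u : nat -> R -> R) C : (forall k, continuity (u k)) ->
  (forall S T t, (1 <= T)%nat -> (T <= S)%nat -> Rabs (u S t - u T t) <= C / INR T) ->
  exists F, continuity F /\ forall T t, (1 <= T)%nat -> Rabs (F t - u T t) <= C / INR T.
Proof.
intros cu hu.
assert (C0 : 0 <= C).
{ pose proof (hu 1%nat 1%nat 0 ltac:(lia) ltac:(lia)). rewrite Rminus_diag, Rabs_R0 in H. simpl in H. lra. }
assert (small : forall eps, 0 < eps -> exists N, (1 <= N)%nat /\ C / INR N < eps).
{ intros eps e0. destruct (INR_unbounded (C / eps)) as [N hN]. exists (S N). split; [lia|].
  assert (0 <= INR N) by apply pos_INR. rewrite S_INR. apply Rmult_lt_reg_r with (INR N + 1); [lra|].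
  unfold Rdiv. rewrite Rmult_assoc, Rinv_l, Rmult_1_r by lra.
  apply Rmult_lt_compat_l with (r := eps) in hN; [|assumption]. replace (eps * (C / eps)) with C in hN by (field; lra). lra. }
assert (lim : forall t, {l | Un_cv (fun n => u n t) l}).
{ intros t. apply R_complete. intros eps e0. destruct (small (eps / 2) ltac:(lra)) as [N [N1 hN]]. exists N. intros n m hn hm.
  unfold Rdist. pose proof (hu n N t N1 hn) as h1. pose proof (hu m N t N1 hm) as h2.
  apply Rabs_bnd in h1, h2. apply Rabs_def1; lra. }
set (F := fun t => proj1_sig (lim t)).
assert (hF : forall T t, (1 <= T)%nat -> Rabs (F t - u T t) <= C / INR T).
{ intros T t hT. unfold F. destruct (lim t) as [l hl]; simpl. apply le_epsilon. intros eps e0.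
  destruct (hl eps e0) as [N hN]. specialize (hN (N + T)%nat ltac:(lia)). unfold Rdist in hN.
  pose proof (hu (N + T)%nat T t hT ltac:(lia)) as h. apply Rabs_bnd in h. apply Rabs_def2 in hN. apply Rabs_le; lra. }
exists F. split; [|exact hF].
intros t eps e0. destruct (small (eps / 3) ltac:(lra)) as [N [N1 hN]].
destruct (cont_delta (u N) t (eps / 3) (cu N t) ltac:(lra)) as [d [d0 k]].
exists d. split; [exact d0|]. intros s [_ hs]. simpl in *. unfold Rdist in *.
specialize (k s hs). pose proof (hF N s N1) as h1. pose proof (hF N t N1) as h2.
apply Rabs_bnd in h1, h2. apply Rabs_def2 in k. apply Rabs_def1; lra.
Qed.

(** * Absolutely convergent Fourier series *)

Section Series.
Variables e1 e2 : R -> R.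
Variables M Ce : R.
Hypothesis ce1 : continuity e1.
Hypothesis ce2 : continuity e2.
Hypothesis me1 : forall t, Rabs (e1 t) <= M.
Hypothesis me2 : forall t, Rabs (e2 t) <= M.
(** [cfp k + i cfq k] is the Fourier coefficient of [e1 + i e2] at frequency [k], and
    [ser1 T + i ser2 T] is the partial sum over [|k| <= T]. *)
Definition cfp k := / (2 * PI) * J 0 (2 * PI) (fun t => e1 t * cz k t + e2 t * sz k t).
Definition cfq k := / (2 * PI) * J 0 (2 * PI) (fun t => e2 t * cz k t - e1 t * sz k t).
Hypothesis hp : forall k, Rabs (cfp k) <= Ce * q2 k.
Hypothesis hq : forall k, Rabs (cfq k) <= Ce * q2 k.
Definition ser1 T t := lsum (zr T) (fun k => cfp k * cz k t - cfq k * sz k t).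
Definition ser2 T t := lsum (zr T) (fun k => cfp k * sz k t + cfq k * cz k t).
Let be1 : Bm1 e1. Proof. apply (Bm1_cont e1 M); assumption. Qed.

Let be2 : Bm1 e2. Proof. apply (Bm1_cont e2 M); assumption. Qed.

Let pi0 : 0 < 2 * PI. Proof. pose proof PI_RGT_0; lra. Qed.

Let Ce0 : 0 <= Ce.
Proof. pose proof (hp 0%Z). pose proof (Rabs_pos (cfp 0%Z)). pose proof (q2_pos 0). nra. Qed.

Lemma ser_cauchy (g : Z -> R -> R) S T t : (forall k t, Rabs (g k t) <= 2 * Ce * q2 k) -> (1 <= T)%nat -> (T <= S)%nat ->
  Rabs (lsum (zr S) (fun k => g k t) - lsum (zr T) (fun k => g k t)) <= 8 * Ce / INR T.
Proof.
intros hg hT hS. rewrite (lsum_sub (zr T) (zr S)); [|apply zr_NoDup|apply zr_NoDup|intros k hk; apply zr_In in hk; apply zr_In; lia].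
replace (lsum (zr T) (fun k => g k t) + lsum (rest (zr T) (zr S)) (fun k => g k t) - lsum (zr T) (fun k => g k t))
  with (lsum (rest (zr T) (zr S)) (fun k => g k t)) by ring.
apply Rle_trans with (1 := lsum_abs _ _).
apply Rle_trans with (lsum (rest (zr T) (zr S)) (fun k => 2 * Ce * (if Z_le_dec (Z.of_nat T) (Z.abs k) then q2 k else 0))).
- apply lsum_le. intros k hk. apply rest_In in hk. destruct hk as [_ hk]. rewrite zr_In in hk.
  destruct (Z_le_dec (Z.of_nat T) (Z.abs k)); [apply hg|lia].
- rewrite lsum_scal. replace (8 * Ce / INR T) with (2 * Ce * (4 / INR T)) by (field; apply not_0_INR; lia).
  apply Rmult_le_compat_l; [lra|]. apply q2_tail; [assumption|apply NoDup_filter, zr_NoDup].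
Qed.

Lemma trig_bound p q c s K : Rabs p <= K -> Rabs q <= K -> Rabs c <= 1 -> Rabs s <= 1 -> Rabs (p * c + q * s) <= 2 * K /\ Rabs (p * c - q * s) <= 2 * K.
Proof.
intros h1 h2 h3 h4.
assert (pr : forall u w, Rabs u <= K -> Rabs w <= 1 -> Rabs (u * w) <= K).
{ intros u w hu hw. rewrite Rabs_mult. rewrite <- (Rmult_1_r K). apply Rmult_le_compat; try apply Rabs_pos; assumption. }
pose proof (pr p c h1 h3) as a1. pose proof (pr q s h2 h4) as a2. apply Rabs_bnd in a1, a2. split; apply Rabs_le; lra.
Qed.

(** The partial sums are uniformly Cauchy. Their limit has the same coefficients as [e1 + i e2] and
    so equals it on a period; the Cauchy rate passes to the limit. *)
Lemma fourier_series : forall T t, (1 <= T)%nat -> 0 <= t <= 2 * PI ->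
  Rabs (e1 t - ser1 T t) <= 8 * Ce / INR T /\ Rabs (e2 t - ser2 T t) <= 8 * Ce / INR T.
Proof.
assert (g1 : forall k t, Rabs (cfp k * cz k t - cfq k * sz k t) <= 2 * Ce * q2 k).
{ intros k t. rewrite Rmult_assoc. apply trig_bound; [apply hp|apply hq|apply cz_le|apply sz_le]. }
assert (g2 : forall k t, Rabs (cfp k * sz k t + cfq k * cz k t) <= 2 * Ce * q2 k).
{ intros k t. rewrite Rmult_assoc. apply trig_bound; [apply hp|apply hq|apply sz_le|apply cz_le]. }
assert (cc1 : forall T, continuity (ser1 T)).
{ intros T. apply (lsum_continuity (zr T) (fun k t => cfp k * cz k t - cfq k * sz k t)). intros k.
  apply continuity_minus; apply continuity_scal; [apply continuity_cz|apply continuity_sz]. }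
assert (cc2 : forall T, continuity (ser2 T)).
{ intros T. apply (lsum_continuity (zr T) (fun k t => cfp k * sz k t + cfq k * cz k t)). intros k.
  apply continuity_plus; apply continuity_scal; [apply continuity_sz|apply continuity_cz]. }
destruct (unif_lim_seq ser1 (8 * Ce) cc1) as [F1 [cF1 hF1]].
{ intros S T t hT hS. apply (ser_cauchy (fun k t => cfp k * cz k t - cfq k * sz k t) S T t g1 hT hS). }
destruct (unif_lim_seq ser2 (8 * Ce) cc2) as [F2 [cF2 hF2]].
{ intros S T t hT hS. apply (ser_cauchy (fun k t => cfp k * sz k t + cfq k * cz k t) S T t g2 hT hS). }
assert (bs1 : forall T, Bm1 (ser1 T)).
{ intros T. apply (Bm1_lsum (zr T) (fun k t => cfp k * cz k t - cfq k * sz k t)). intros k. bm. }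
assert (bs2 : forall T, Bm1 (ser2 T)).
{ intros T. apply (Bm1_lsum (zr T) (fun k t => cfp k * sz k t + cfq k * cz k t)). intros k. bm. }
assert (bd1 : exists K, forall t, Rabs (F1 t) <= K).
{ destruct (Bm1_bounded _ (bs1 1%nat)) as [K hK]. exists (K + 8 * Ce / INR 1). intros t.
  pose proof (hK t) as h1. pose proof (hF1 1%nat t ltac:(lia)) as h2. apply Rabs_bnd in h1, h2. apply Rabs_le; lra. }
assert (bd2 : exists K, forall t, Rabs (F2 t) <= K).
{ destruct (Bm1_bounded _ (bs2 1%nat)) as [K hK]. exists (K + 8 * Ce / INR 1). intros t.
  pose proof (hK t) as h1. pose proof (hF2 1%nat t ltac:(lia)) as h2. apply Rabs_bnd in h1, h2. apply Rabs_le; lra. }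
destruct bd1 as [K1 hK1]. destruct bd2 as [K2 hK2].
assert (bF1 : Bm1 F1) by (apply (Bm1_cont F1 K1); assumption).
assert (bF2 : Bm1 F2) by (apply (Bm1_cont F2 K2); assumption).
assert (orth : forall T j, (Z.abs j <= Z.of_nat T)%Z ->
  J 0 (2 * PI) (fun t => ser1 T t * cz j t + ser2 T t * sz j t) = 2 * PI * cfp j /\
  J 0 (2 * PI) (fun t => ser2 T t * cz j t - ser1 T t * sz j t) = 2 * PI * cfq j).
{ intros T j hj. split.
  - rewrite (J_ext _ _ _ (fun t => lsum (zr T) (fun k => cfp k * cz (k - j) t - cfq k * sz (k - j) t))).
    + rewrite J_lsum; [|apply PI2_pos|intros; bm]. rewrite (lsum_delta _ _ j); [|apply zr_NoDup|apply zr_In; exact hj|].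
      * rewrite J_minus by bm. rewrite !J_scal by bm. rewrite J_sz. rewrite Z.sub_diag.
        rewrite (J_ext _ _ _ (fun _ => 1)) by apply cz0. rewrite J_const by lra. ring.
      * intros k hk. rewrite J_minus by bm. rewrite !J_scal by bm. rewrite J_sz, J_cz by lia. ring.
    + intros t. unfold ser1, ser2. rewrite <- !(Rmult_comm (cz j t)), <- !(Rmult_comm (sz j t)). rewrite <- !lsum_scal, <- lsum_plus.
      apply lsum_ext. intros k _. rewrite cz_minus, sz_minus. ring.
  - rewrite (J_ext _ _ _ (fun t => lsum (zr T) (fun k => cfp k * sz (k - j) t + cfq k * cz (k - j) t))).
    + rewrite J_lsum; [|apply PI2_pos|intros; bm]. rewrite (lsum_delta _ _ j); [|apply zr_NoDup|apply zr_In; exact hj|].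
      * rewrite J_plus by bm. rewrite !J_scal by bm. rewrite J_sz. rewrite Z.sub_diag.
        rewrite (J_ext _ _ _ (fun _ => 1)) by apply cz0. rewrite J_const by lra. ring.
      * intros k hk. rewrite J_plus by bm. rewrite !J_scal by bm. rewrite J_sz, J_cz by lia. ring.
    + intros t. unfold ser1, ser2.
      replace (lsum (zr T) (fun k => cfp k * sz k t + cfq k * cz k t) * cz j t - lsum (zr T) (fun k => cfp k * cz k t - cfq k * sz k t) * sz j t)
       with (cz j t * lsum (zr T) (fun k => cfp k * sz k t + cfq k * cz k t) + (- sz j t) * lsum (zr T) (fun k => cfp k * cz k t - cfq k * sz k t)) by ring.
      rewrite <- !lsum_scal, <- lsum_plus.
      apply lsum_ext. intros k _. rewrite cz_minus, sz_minus. ring. }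
(* Used for a Fourier integral of the difference between [e1 + i e2] and the limit: once [T >= |j|]
   the partial sum has the right coefficient at [j], and only its distance to the limit remains. *)
assert (tend : forall X, (exists K T0, forall T, (T0 <= T)%nat -> (1 <= T)%nat -> Rabs X <= K / INR T) -> X = 0).
{ intros X [K [T0 h]]. destruct (Req_dec X 0) as [e|ne]; [exact e|]. exfalso. apply Rabs_pos_lt in ne.
  destruct (INR_unbounded (K / Rabs X)) as [n hn]. specialize (h (S (T0 + n)) ltac:(lia) ltac:(lia)).
  assert (hm : INR n < INR (S (T0 + n))) by (apply lt_INR; lia). pose proof (pos_INR n).
  assert (K < INR (S (T0 + n)) * Rabs X).
  { apply Rmult_lt_reg_r with (/ Rabs X); [apply Rinv_0_lt_compat; lra|]. rewrite Rmult_assoc, Rinv_r, Rmult_1_r by lra. unfold Rdiv in hn. lra. }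
  apply Rmult_le_compat_r with (r := INR (S (T0 + n))) in h; [|lra]. unfold Rdiv in h. rewrite Rmult_assoc, Rinv_l in h by lra. lra. }
assert (uniq : forall t, 0 <= t <= 2 * PI -> e1 t - F1 t = 0 /\ e2 t - F2 t = 0).
{ apply (pair_unique (fun t => e1 t - F1 t) (fun t => e2 t - F2 t) (M + Rmax K1 K2)).
  - apply continuity_minus; assumption.
  - apply continuity_minus; assumption.
  - intros t. pose proof (me1 t) as h1. pose proof (hK1 t) as h2. pose proof (Rmax_l K1 K2). apply Rabs_bnd in h1, h2. apply Rabs_le; lra.
  - intros t. pose proof (me2 t) as h1. pose proof (hK2 t) as h2. pose proof (Rmax_r K1 K2). apply Rabs_bnd in h1, h2. apply Rabs_le; lra.
  - intros j. apply tend. exists (2 * (8 * Ce) * (2 * PI)), (Z.abs_nat j). intros T hT T1.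
    destruct (orth T j ltac:(lia)) as [o1 _].
    assert (E : J 0 (2 * PI) (fun t => (e1 t - F1 t) * cz j t + (e2 t - F2 t) * sz j t) =
      J 0 (2 * PI) (fun t => (ser1 T t - F1 t) * cz j t + (ser2 T t - F2 t) * sz j t)).
    { assert (d : J 0 (2 * PI) (fun t => e1 t * cz j t + e2 t * sz j t) = 2 * PI * cfp j) by (unfold cfp; field; lra).
      rewrite (J_ext _ _ _ (fun t => (e1 t * cz j t + e2 t * sz j t) - (F1 t * cz j t + F2 t * sz j t))) by (intros; ring).
      rewrite (J_ext _ _ (fun t => (ser1 T t - F1 t) * cz j t + (ser2 T t - F2 t) * sz j t) (fun t => (ser1 T t * cz j t + ser2 T t * sz j t) - (F1 t * cz j t + F2 t * sz j t))) by (intros; ring).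
      pose proof (bs1 T); pose proof (bs2 T). rewrite !J_minus by bm. rewrite d, o1. reflexivity. }
    rewrite E. pose proof (bs1 T); pose proof (bs2 T).
    replace (2 * (8 * Ce) * (2 * PI) / INR T) with (2 * (8 * Ce / INR T) * (2 * PI)) by (field; apply not_0_INR; lia).
    apply J_per_bound; [bm|]. intros t. apply trig_bound; [| |apply cz_le|apply sz_le]; rewrite Rabs_minus_sym; [apply hF1|apply hF2]; assumption.
  - intros j. apply tend. exists (2 * (8 * Ce) * (2 * PI)), (Z.abs_nat j). intros T hT T1.
    destruct (orth T j ltac:(lia)) as [_ o1].
    assert (E : J 0 (2 * PI) (fun t => (e2 t - F2 t) * cz j t - (e1 t - F1 t) * sz j t) =
      J 0 (2 * PI) (fun t => (ser2 T t - F2 t) * cz j t - (ser1 T t - F1 t) * sz j t)).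
    { assert (d : J 0 (2 * PI) (fun t => e2 t * cz j t - e1 t * sz j t) = 2 * PI * cfq j) by (unfold cfq; field; lra).
      rewrite (J_ext _ _ _ (fun t => (e2 t * cz j t - e1 t * sz j t) - (F2 t * cz j t - F1 t * sz j t))) by (intros; ring).
      rewrite (J_ext _ _ (fun t => (ser2 T t - F2 t) * cz j t - (ser1 T t - F1 t) * sz j t) (fun t => (ser2 T t * cz j t - ser1 T t * sz j t) - (F2 t * cz j t - F1 t * sz j t))) by (intros; ring).
      pose proof (bs1 T); pose proof (bs2 T).
      rewrite (J_minus _ _ (fun t => e2 t * cz j t - e1 t * sz j t)) by bm.
      rewrite (J_minus _ _ (fun t => ser2 T t * cz j t - ser1 T t * sz j t)) by bm. rewrite d, o1. reflexivity. }
    rewrite E. pose proof (bs1 T); pose proof (bs2 T).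
    replace (2 * (8 * Ce) * (2 * PI) / INR T) with (2 * (8 * Ce / INR T) * (2 * PI)) by (field; apply not_0_INR; lia).
    apply J_per_bound; [bm|]. intros t. apply trig_bound; [| |apply cz_le|apply sz_le]; rewrite Rabs_minus_sym; [apply hF2|apply hF1]; assumption. }
intros T t hT ht. destruct (uniq t ht) as [u1 u2].
replace (e1 t) with (F1 t) by lra. replace (e2 t) with (F2 t) by lra. split; [apply hF1|apply hF2]; assumption.
Qed.
End Series.

(** * The energy argument on Fourier modes *)

Lemma deriv_ge_incr f f' p q m : p <= q -> (forall x, p <= x <= q -> derivable_pt_lim f x (f' x)) ->
  (forall x, p <= x <= q -> m <= f' x) -> m * (q - p) <= f q - f p.
Proof.
intros pq d h. destruct (Req_dec p q) as [->|ne]; [lra|].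
destruct (MVT_cor2 f f' p q ltac:(lra) d) as [c [e hc]]. rewrite e.
apply Rmult_le_compat_r; [lra|]. apply h. lra.
Qed.

Lemma derivable_pt_lim_ext f g x l : (forall x, f x = g x) -> derivable_pt_lim f x l -> derivable_pt_lim g x l.
Proof. intros h. replace g with f; [tauto|]. apply functional_extensionality; exact h. Qed.

Lemma deriv_expo c x : derivable_pt_lim (fun x => exp (c * x)) x (c * exp (c * x)).
Proof.
replace (c * exp (c * x)) with (exp (c * x) * (c * 1)) by ring.
apply (derivable_pt_lim_comp (fun x => c * x) exp).
- apply (derivable_pt_lim_scal id). apply derivable_pt_lim_id.
- apply derivable_pt_lim_exp.
Qed.

Lemma exp_decay c eps K : 0 < c -> 0 < eps -> exists X0, forall X, X0 <= X -> K * exp (- (c * X)) < eps.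
Proof.
intros c0 e0. exists ((Rabs K / eps) / c + 1). intros X hX. pose proof (Rabs_pos K).
assert (0 <= Rabs K / eps / c).
{ apply Rmult_le_pos; [apply Rmult_le_pos; [lra|left; apply Rinv_0_lt_compat; lra]|left; apply Rinv_0_lt_compat; lra]. }
assert (h1 : Rabs K / eps < c * X).
{ assert (c * (Rabs K / eps / c + 1) <= c * X) by (apply Rmult_le_compat_l; lra).
  replace (c * (Rabs K / eps / c + 1)) with (Rabs K / eps + c) in H1 by (field; lra). lra. }
assert (cx : 0 <= c * X) by (apply Rmult_le_pos; lra).
pose proof (exp_ineq1_le (c * X)). pose proof (exp_pos (c * X)). rewrite exp_Ropp.
apply Rle_lt_trans with (Rabs K * / exp (c * X)).
{ apply Rmult_le_compat_r; [left; apply Rinv_0_lt_compat; lra|apply Rle_abs]. }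
apply Rmult_lt_reg_r with (exp (c * X)); [lra|]. rewrite Rmult_assoc, Rinv_l, Rmult_1_r by lra.
apply Rmult_lt_compat_l with (r := eps) in h1; [|lra].
replace (eps * (Rabs K / eps)) with (Rabs K) in h1 by (field; lra). nra.
Qed.

(** The arithmetic-geometric inequality with unequal weights; [s] is a lower bound of their
    geometric mean. *)
Lemma amgm s w w' x y : 0 <= s -> 0 <= w -> 0 <= w' -> s * s <= w * w' -> 2 * s * Rabs (x * y) <= w * (x * x) + w' * (y * y).
Proof.
intros s0 w0 w0' h. rewrite Rabs_mult.
replace (x * x) with (Rabs x * Rabs x) by (rewrite <- Rabs_mult; apply Rabs_right; nra).
replace (y * y) with (Rabs y * Rabs y) by (rewrite <- Rabs_mult; apply Rabs_right; nra).
pose proof (Rabs_pos x). pose proof (Rabs_pos y). set (a := Rabs x) in *. set (b := Rabs y) in *.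
apply Rsqr_incr_0_var; [unfold Rsqr|nra].
assert (0 <= a * a) by nra. assert (0 <= b * b) by nra.
assert (s * s * (a * a * (b * b)) <= w * w' * (a * a * (b * b))) by (apply Rmult_le_compat_r; nra).
pose proof (Rle_0_sqr (w * (a * a) - w' * (b * b))). unfold Rsqr in *. nra.
Qed.

(** * A bounded solution of one forced linear equation on the line *)

Section Decay.
Variables A B H1 H2 : R -> R.
Variables al be K : R.
Hypothesis al0 : al <> 0.
Hypothesis dA : forall x, derivable_pt_lim A x (al * A x - be * B x + H1 x).
Hypothesis dB : forall x, derivable_pt_lim B x (be * A x + al * B x + H2 x).
Hypothesis mA : forall x, Rabs (A x) <= K.
Hypothesis mB : forall x, Rabs (B x) <= K.
Hypothesis mH1 : forall x, Rabs (H1 x) <= K.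
Hypothesis mH2 : forall x, Rabs (H2 x) <= K.

Let Y x := A x * A x + B x * B x.
Lemma modulus_deriv x : derivable_pt_lim Y x (2 * al * Y x + 2 * (A x * H1 x + B x * H2 x)).
Proof.
unfold Y. replace (2 * al * (A x * A x + B x * B x) + 2 * (A x * H1 x + B x * H2 x)) with
  (((al * A x - be * B x + H1 x) * A x + A x * (al * A x - be * B x + H1 x)) + ((be * A x + al * B x + H2 x) * B x + B x * (be * A x + al * B x + H2 x))) by ring.
apply derivable_pt_lim_plus; [apply (derivable_pt_lim_mult A A)|apply (derivable_pt_lim_mult B B)]; auto.
Qed.

(** Above the level [c] the rate [al] beats the forcing: [al * psi'] is nonnegative everywhere, so a
    positive value of [psi] persists in the direction given by the sign of [al]. Boundedness of [Y]
    forces [psi] below any positive number there. *)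
Lemma mode_decay x : Y x <= 2 * (K * K) / (al * al).
Proof.
assert (K0 : 0 <= K) by (pose proof (mA 0); pose proof (Rabs_pos (A 0)); lra).
assert (sq : forall u, Rabs u <= K -> u * u <= K * K).
{ intros u hu. apply Rabs_bnd in hu. nra. }
assert (Yb : forall x, 0 <= Y x <= 2 * (K * K)).
{ intros y. unfold Y. pose proof (sq _ (mA y)). pose proof (sq _ (mB y)). nra. }
assert (al2 : 0 < al * al) by nra.
set (c := 2 * (K * K) / (al * al)).
assert (ec : c * (al * al) = 2 * (K * K)) by (unfold c; field; lra).
assert (c0 : 0 <= c) by (unfold c; apply Rmult_le_pos; [nra|left; apply Rinv_0_lt_compat; lra]).
set (psi := fun x => (Y x - c) * exp (- al * x)).
set (psi' := fun x => (2 * al * Y x + 2 * (A x * H1 x + B x * H2 x)) * exp (- al * x) + (Y x - c) * (- al * exp (- al * x))).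
assert (dpsi : forall x, derivable_pt_lim psi x (psi' x)).
{ intros y. unfold psi, psi'. apply (derivable_pt_lim_mult (fun x => Y x - c) (fun x => exp (- al * x))); [|apply deriv_expo].
  replace (2 * al * Y y + 2 * (A y * H1 y + B y * H2 y)) with (2 * al * Y y + 2 * (A y * H1 y + B y * H2 y) - 0) by ring.
  apply derivable_pt_lim_minus; [apply modulus_deriv|apply derivable_pt_lim_const]. }
assert (young : forall y, 2 * Rabs (al * (A y * H1 y + B y * H2 y)) <= al * al * Y y + 2 * (K * K)).
{ intros y. pose proof (sq _ (mH1 y)). pose proof (sq _ (mH2 y)).
  assert (z : forall u, - (al * al * Y y + 2 * (K * K)) <= 2 * u <= al * al * Y y + 2 * (K * K) -> 2 * Rabs u <= al * al * Y y + 2 * (K * K)).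
  { intros u hu. unfold Rabs. destruct (Rcase_abs u); lra. }
  apply z. unfold Y. pose proof (Rle_0_sqr (al * A y - H1 y)). pose proof (Rle_0_sqr (al * A y + H1 y)).
  pose proof (Rle_0_sqr (al * B y - H2 y)). pose proof (Rle_0_sqr (al * B y + H2 y)). unfold Rsqr in *. split; nra. }
assert (sgn : forall y, 0 <= al * psi' y).
{ intros y. unfold psi'. pose proof (exp_pos (- al * y)).
  replace (al * ((2 * al * Y y + 2 * (A y * H1 y + B y * H2 y)) * exp (- al * y) + (Y y - c) * (- al * exp (- al * y))))
   with ((al * al * Y y + 2 * (al * (A y * H1 y + B y * H2 y)) + c * (al * al)) * exp (- al * y)) by ring.
  apply Rmult_le_pos; [|lra]. pose proof (young y) as h. rewrite ec.
  pose proof (Rle_abs (- (al * (A y * H1 y + B y * H2 y)))). rewrite Rabs_Ropp in H0. lra. }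
destruct (Rle_lt_dec (Y x) c) as [h|h]; [exact h|]. exfalso.
assert (px : 0 < psi x) by (apply Rmult_lt_0_compat; [lra|apply exp_pos]).
destruct (Rdichotomy al 0 al0) as [neg|pos].
- destruct (exp_decay (- al) (psi x) (2 * (K * K)) ltac:(lra) px) as [X0 hX0].
  set (X := Rmax X0 (Rabs x)). specialize (hX0 X (Rmax_l _ _)).
  pose proof (Rmax_r X0 (Rabs x)). fold X in H. pose proof (Rle_abs (- x)). rewrite Rabs_Ropp in H0.
  assert (0 * (x - - X) <= (- psi x) - (- psi (- X))).
  { apply (deriv_ge_incr (fun x => - psi x) (fun x => - psi' x)); [lra| |].
    - intros y _. apply derivable_pt_lim_opp. apply dpsi.
    - intros y _. pose proof (sgn y). nra. }
  assert (psi (- X) <= 2 * (K * K) * exp (- (- al * X))).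
  { unfold psi. replace (- al * - X) with (- (- al * X)) by ring. apply Rmult_le_compat_r; [left; apply exp_pos|]. pose proof (Yb (- X)). lra. }
  lra.
- destruct (exp_decay al (psi x) (2 * (K * K)) ltac:(lra) px) as [X0 hX0].
  set (X := Rmax X0 (Rabs x)). specialize (hX0 X (Rmax_l _ _)).
  pose proof (Rmax_r X0 (Rabs x)). fold X in H. pose proof (Rle_abs x).
  assert (0 * (X - x) <= psi X - psi x).
  { apply (deriv_ge_incr psi psi'); [lra| |].
    - intros y _. apply dpsi.
    - intros y _. pose proof (sgn y). nra. }
  assert (psi X <= 2 * (K * K) * exp (- (al * X))).
  { unfold psi. replace (- al * X) with (- (al * X)) by ring. apply Rmult_le_compat_r; [left; apply exp_pos|]. pose proof (Yb X). lra. }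
  lra.
Qed.
End Decay.

(** * The infinite system of modes *)

Section Energy.
Variables a b nu Ce K : R.
Hypothesis a0 : 0 < a.
Hypothesis nu0 : 0 <= nu.
Hypothesis nu1 : nu < 1.
Variables p q : Z -> R.
Hypothesis hp : forall k, Rabs (p k) <= Ce * q2 k.
Hypothesis hq : forall k, Rabs (q k) <= Ce * q2 k.
Variables A B H1 H2 : Z -> R -> R.
Hypothesis dA : forall n x, derivable_pt_lim (A n) x ((IZR n + nu) * (a * A n x - b * B n x) + H1 n x).
Hypothesis dB : forall n x, derivable_pt_lim (B n) x ((IZR n + nu) * (b * A n x + a * B n x) + H2 n x).
Hypothesis mA : forall n x, Rabs (A n x) <= K.
Hypothesis mB : forall n x, Rabs (B n x) <= K.
Hypothesis mH1 : forall n x, Rabs (H1 n x) <= K.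
Hypothesis mH2 : forall n x, Rabs (H2 n x) <= K.
Hypothesis coup1 : forall T n x, (1 <= T)%nat ->
  Rabs (H1 n x - lsum (zr T) (fun j => p j * A (j - n) x + q j * B (j - n) x)) <= K / INR T.
Hypothesis coup2 : forall T n x, (1 <= T)%nat ->
  Rabs (H2 n x - lsum (zr T) (fun j => q j * A (j - n) x - p j * B (j - n) x)) <= K / INR T.

Let Y n x := A n x * A n x + B n x * B n x.
Let Ce0 : 0 <= Ce.
Proof. pose proof (hp 0%Z). pose proof (Rabs_pos (p 0%Z)). pose proof (q2_pos 0). nra. Qed.

Let K0 : 0 <= K.
Proof. pose proof (mA 0%Z 0). pose proof (Rabs_pos (A 0%Z 0)). lra. Qed.

Let Y0 n x : 0 <= Y n x. Proof. unfold Y. nra. Qed.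

Lemma mode_modulus_deriv n x : derivable_pt_lim (Y n) x (2 * (a * (IZR n + nu)) * Y n x + 2 * (A n x * H1 n x + B n x * H2 n x)).
Proof.
apply (modulus_deriv (A n) (B n) (H1 n) (H2 n) (a * (IZR n + nu)) (b * (IZR n + nu))).
- intros y. replace (a * (IZR n + nu) * A n y - b * (IZR n + nu) * B n y + H1 n y) with ((IZR n + nu) * (a * A n y - b * B n y) + H1 n y) by ring. apply dA.
- intros y. replace (b * (IZR n + nu) * A n y + a * (IZR n + nu) * B n y + H2 n y) with ((IZR n + nu) * (b * A n y + a * B n y) + H2 n y) by ring. apply dB.
Qed.

(** The first term serves the modes [|n| <= 1], for which [n + nu] can vanish or be small and
    [mode_decay] gives no uniform bound; the second serves [|n| >= 2], where
    [n^2 <= 4 (n + nu)^2]. *)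
Let K4 := 4 * (K * K) + 16 * (K * K) / (a * a).
Let K40 : 0 <= K4.
Proof.
unfold K4. assert (0 < a * a) by nra. assert (0 <= K * K) by nra.
assert (0 <= 16 * (K * K) / (a * a)) by (apply Rmult_le_pos; [lra|left; apply Rinv_0_lt_compat; lra]). lra.
Qed.

Lemma modulus_decay n x : Y n x <= K4 * q2 n.
Proof.
assert (aa : 0 < a * a) by nra. assert (kk : 0 <= K * K) by nra.
assert (sq : forall u, Rabs u <= K -> u * u <= K * K) by (intros u hu; apply Rabs_bnd in hu; nra).
assert (t1 : 0 <= 16 * (K * K) / (a * a)) by (apply Rmult_le_pos; [lra|left; apply Rinv_0_lt_compat; lra]).
pose proof (q2_pos n) as qp.
destruct (Z_le_gt_dec (Z.abs n) 1) as [h|h].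
- assert (IZR n * IZR n <= 1).
  { rewrite <- mult_IZR. apply (IZR_le _ 1). nia. }
  assert (/ 2 <= q2 n) by (unfold q2; apply Rinv_le_contravar; nra).
  assert (Y n x <= 2 * (K * K)) by (unfold Y; pose proof (sq _ (mA n x)); pose proof (sq _ (mB n x)); lra).
  unfold K4. nra.
- assert (n2 : 4 <= IZR n * IZR n) by (rewrite <- mult_IZR; apply (IZR_le 4); nia).
  assert (big : IZR n * IZR n <= 4 * ((IZR n + nu) * (IZR n + nu))).
  { destruct (Z_le_gt_dec 0 n).
    - assert (2 <= IZR n) by (apply (IZR_le 2); lia). nra.
    - assert (IZR n <= -2) by (apply (IZR_le n (-2)); lia). nra. }
  assert (al0 : a * (IZR n + nu) <> 0) by (intros e; assert (a * a * ((IZR n + nu) * (IZR n + nu)) = 0) by (replace (a * a * ((IZR n + nu) * (IZR n + nu))) with ((a * (IZR n + nu)) * (a * (IZR n + nu))) by ring; rewrite e; ring); nra).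
  assert (d : Y n x <= 2 * (K * K) / ((a * (IZR n + nu)) * (a * (IZR n + nu)))).
  { apply (mode_decay (A n) (B n) (H1 n) (H2 n) (a * (IZR n + nu)) (b * (IZR n + nu)) K); try assumption; auto.
    - intros y. replace (a * (IZR n + nu) * A n y - b * (IZR n + nu) * B n y + H1 n y) with ((IZR n + nu) * (a * A n y - b * B n y) + H1 n y) by ring. apply dA.
    - intros y. replace (b * (IZR n + nu) * A n y + a * (IZR n + nu) * B n y + H2 n y) with ((IZR n + nu) * (b * A n y + a * B n y) + H2 n y) by ring. apply dB. }
  apply Rle_trans with (1 := d).
  apply Rle_trans with (16 * (K * K) / (a * a) * q2 n); [|unfold K4; nra].
  unfold q2. set (m := IZR n) in *. set (z := (m + nu) * (m + nu)) in *.
  assert (z0 : 0 < z) by lra.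
  replace (2 * (K * K) / (a * (m + nu) * (a * (m + nu)))) with (2 * (K * K) / (a * a) * / z) by (unfold z; field; split; nra).
  replace (16 * (K * K) / (a * a) * / (1 + m * m)) with (2 * (K * K) / (a * a) * (8 * / (1 + m * m))) by (field; split; nra).
  apply Rmult_le_compat_l; [apply Rmult_le_pos; [lra|left; apply Rinv_0_lt_compat; lra]|].
  apply Rmult_le_reg_r with z; [lra|]. rewrite Rinv_l by lra.
  apply Rmult_le_reg_r with (1 + m * m); [nra|].
  replace (8 * / (1 + m * m) * z * (1 + m * m)) with (8 * z) by (field; nra). nra.
Qed.

Let K6 := K + 10 * Ce * sqrt K4.
Let K60 : 0 <= K6.
Proof. unfold K6. pose proof (sqrt_pos K4). nra. Qed.

Lemma mode_abs_decay n x : (0 < Z.abs n)%Z -> Rabs (A n x) <= sqrt K4 / IZR (Z.abs n) /\ Rabs (B n x) <= sqrt K4 / IZR (Z.abs n).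
Proof.
intros hn. apply (IZR_lt 0) in hn.
assert (z : forall u, u * u <= Y n x -> Rabs u <= sqrt K4 / IZR (Z.abs n)).
{ intros u hu. apply Rsqr_incr_0_var; [|apply Rmult_le_pos; [apply sqrt_pos|left; apply Rinv_0_lt_compat; lra]].
  rewrite <- Rsqr_abs. unfold Rsqr. apply Rle_trans with (1 := hu). apply Rle_trans with (1 := modulus_decay n x).
  replace (sqrt K4 / IZR (Z.abs n) * (sqrt K4 / IZR (Z.abs n))) with ((sqrt K4 * sqrt K4) * / (IZR (Z.abs n) * IZR (Z.abs n))) by (field; lra).
  rewrite sqrt_sqrt by assumption. apply Rmult_le_compat_l; [assumption|]. unfold q2.
  assert (e : IZR (Z.abs n) * IZR (Z.abs n) = IZR n * IZR n) by (rewrite <- !mult_IZR; f_equal; apply Z.abs_square).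
  rewrite e in *. apply Rinv_le_contravar; nra. }
split; apply z; unfold Y; nra.
Qed.

(** With [m = j - n], the indices [|j| <= 2 L] include all [|m| <= L]; for the surplus ones the
    modes are at most [sqrt K4 / L], while the coefficients have a bounded sum. A common range for
    [n] and [m] is what makes the truncated coupling symmetric. *)
Lemma coupling_sub (f : Z -> Z -> R) (Hn : R) n L : (1 <= L)%nat -> (Z.abs n <= Z.of_nat L)%Z ->
  (forall k m, (Z.of_nat L < Z.abs m)%Z -> Rabs (f k m) <= 2 * Ce * q2 k * (sqrt K4 / INR L)) ->
  Rabs (Hn - lsum (zr (2 * L)) (fun j => f j (j - n)%Z)) <= K / INR (2 * L) ->
  Rabs (Hn - lsum (zr L) (fun m => f (n + m)%Z m)) <= K6 / INR L.
Proof.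
intros hL hn hf h. assert (L1 : 1 <= INR L) by (apply (le_INR 1); assumption).
set (l' := map (fun j => (j - n)%Z) (zr (2 * L))).
assert (nd : NoDup l').
{ apply FinFun.Injective_map_NoDup; [intros i j; lia|apply zr_NoDup]. }
assert (e1 : lsum (zr (2 * L)) (fun j => f j (j - n)%Z) = lsum l' (fun m => f (n + m)%Z m)).
{ unfold l'. rewrite lsum_map. apply lsum_ext. intros j _. f_equal. lia. }
rewrite e1 in h. rewrite (lsum_sub (zr L) l') in h; [|apply zr_NoDup|exact nd|].
2:{ intros m hm. apply zr_In in hm. unfold l'. apply in_map_iff. exists (m + n)%Z. split; [lia|]. apply zr_In. lia. }
assert (r : Rabs (lsum (rest (zr L) l') (fun m => f (n + m)%Z m)) <= 10 * Ce * sqrt K4 / INR L).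
{ apply Rle_trans with (1 := lsum_abs _ _).
  apply Rle_trans with (lsum (rest (zr L) l') (fun m => 2 * Ce * (sqrt K4 / INR L) * q2 (n + m))).
  - apply lsum_le. intros m hm. apply rest_In in hm. destruct hm as [_ hm]. rewrite zr_In in hm.
    pose proof (hf (n + m)%Z m ltac:(lia)). lra.
  - rewrite lsum_scal. pose proof (sqrt_pos K4).
    assert (0 <= sqrt K4 / INR L) by (apply Rmult_le_pos; [lra|left; apply Rinv_0_lt_compat; lra]).
    replace (10 * Ce * sqrt K4 / INR L) with (2 * Ce * (sqrt K4 / INR L) * 5) by (field; lra).
    apply Rmult_le_compat_l; [nra|].
    rewrite <- (lsum_map (rest (zr L) l') (fun m => (n + m)%Z) q2). apply q2_total.
    apply FinFun.Injective_map_NoDup; [intros i j; lia|apply NoDup_filter; exact nd]. }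
assert (h2 : K / INR (2 * L) <= K / INR L).
{ unfold Rdiv. apply Rmult_le_compat_l; [assumption|]. apply Rinv_le_contravar; [lra|apply le_INR; lia]. }
replace (K6 / INR L) with (K / INR L + 10 * Ce * sqrt K4 / INR L) by (unfold K6; field; lra).
apply Rabs_bnd in h, r. apply Rabs_le. lra.
Qed.

Lemma coupling L n x : (1 <= L)%nat -> (Z.abs n <= Z.of_nat L)%Z ->
  Rabs (H1 n x - lsum (zr L) (fun m => p (n + m) * A m x + q (n + m) * B m x)) <= K6 / INR L /\
  Rabs (H2 n x - lsum (zr L) (fun m => q (n + m) * A m x - p (n + m) * B m x)) <= K6 / INR L.
Proof.
intros hL hn. assert (L1 : 1 <= INR L) by (apply (le_INR 1); assumption).
assert (sm : forall k m, (Z.of_nat L < Z.abs m)%Z -> forall u v, Rabs u <= Ce * q2 k -> Rabs v <= Ce * q2 k ->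
   Rabs (u * A m x + v * B m x) <= 2 * Ce * q2 k * (sqrt K4 / INR L)).
{ intros k m hm u v hu hv. destruct (mode_abs_decay m x ltac:(lia)) as [s1 s2].
  assert (d : sqrt K4 / IZR (Z.abs m) <= sqrt K4 / INR L).
  { unfold Rdiv. apply Rmult_le_compat_l; [apply sqrt_pos|]. apply Rinv_le_contravar; [lra|]. rewrite INR_IZR_INZ. apply IZR_le. lia. }
  assert (pr : forall u w, Rabs u <= Ce * q2 k -> Rabs w <= sqrt K4 / INR L -> Rabs (u * w) <= Ce * q2 k * (sqrt K4 / INR L)).
  { intros u' w hu' hw. rewrite Rabs_mult. apply Rmult_le_compat; try apply Rabs_pos; assumption. }
  pose proof (pr u _ hu (Rle_trans _ _ _ s1 d)) as r1. pose proof (pr v _ hv (Rle_trans _ _ _ s2 d)) as r2.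
  apply Rabs_bnd in r1, r2. apply Rabs_le. lra. }
split.
- apply (coupling_sub (fun k m => p k * A m x + q k * B m x) (H1 n x) n L hL hn).
  + intros k m hm. apply sm; auto.
  + apply coup1. lia.
- apply (coupling_sub (fun k m => q k * A m x - p k * B m x) (H2 n x) n L hL hn).
  + intros k m hm. replace (q k * A m x - p k * B m x) with (q k * A m x + (- p k) * B m x) by ring.
    apply sm; auto. rewrite Rabs_Ropp. auto.
  + apply coup2. lia.
Qed.

Section Split.
Variable N : Z.
Variables (T : nat) (s : R).
Hypothesis T1 : (1 <= T)%nat.
Hypothesis s1 : 1 <= s.
Hypothesis small : 4 * Ce * (4 / INR T + 5 / s) <= a / 4.
Hypothesis wide : (Z.of_nat T <= Z.abs N - 1)%Z.
Hypothesis sN : s * s <= IZR (2 * Z.abs N - 3).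
Definition sg (n : Z) := if Z_lt_dec N n then 1 else -1.
(** Twice the distance from [n] to the half-integer [N + 1/2], hence never 0. Correspondingly [gam]
    is the rate at which the squared modulus of a free mode would grow at the index [N + 1/2]. *)
Let W n := IZR (Z.abs (2 * n - (2 * N + 1))).
Let gam := a * (2 * IZR N + 1 + 2 * nu).

Lemma weight_ge1 n : 1 <= W n.
Proof. unfold W. apply (IZR_le 1). lia. Qed.

Lemma sign_weight n : sg n * (2 * (a * (IZR n + nu)) - gam) = a * W n.
Proof.
unfold sg, W, gam. destruct (Z_lt_dec N n).
- rewrite Z.abs_eq by lia. rewrite minus_IZR, plus_IZR, !mult_IZR. simpl. ring.
- rewrite Z.abs_neq by lia. rewrite opp_IZR, minus_IZR, plus_IZR, !mult_IZR. simpl. ring.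
Qed.

(* Re(e_{n+m} conj V_n conj V_m) is symmetric in (n,m): the terms with n, m on opposite sides of N cancel. *)
Definition cpl n m x := p (n + m) * (A n x * A m x - B n x * B m x) + q (n + m) * (A n x * B m x + B n x * A m x).
(** The first summand serves the tail [|n + m| >= T], where the coefficient itself is small; in the
    second, large weights gain the factor [1 / s]. *)
Let phi k := 2 * Ce * ((if Z_le_dec (Z.of_nat T) (Z.abs k) then q2 k else 0) + q2 k / s).
Let phi0 k : 0 <= phi k.
Proof.
unfold phi. pose proof (q2_pos k). apply Rmult_le_pos; [lra|].
assert (0 < q2 k / s) by (apply Rdiv_lt_0_compat; lra). destruct (Z_le_dec _ _); lra.
Qed.

(** If [|n + m| < T], two indices on the same side of [N] have weights with sum at least
    [2 |N| - 2]. Both weights being at least 1, their product is at least the sum minus 1, hence at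
    least [s^2], and the weighted inequality gains [1 / s]. *)
Lemma cpl_bound n m x : sg n = sg m -> 2 * Rabs (cpl n m x) <= phi (n + m) * (W n * Y n x + W m * Y m x).
Proof.
intros hs. pose proof (weight_ge1 n) as w1. pose proof (weight_ge1 m) as w2. pose proof (q2_pos (n + m)) as qp.
assert (gen : forall r, 1 <= r -> r * r <= W n * W m -> 2 * Rabs (cpl n m x) <= 2 * Ce * (q2 (n + m) / r) * (W n * Y n x + W m * Y m x)).
{ intros r r1 hr.
  pose proof (amgm r (W n) (W m) (A n x) (A m x) ltac:(lra) ltac:(lra) ltac:(lra) hr) as g1.
  pose proof (amgm r (W n) (W m) (B n x) (B m x) ltac:(lra) ltac:(lra) ltac:(lra) hr) as g2.
  pose proof (amgm r (W n) (W m) (A n x) (B m x) ltac:(lra) ltac:(lra) ltac:(lra) hr) as g3.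
  pose proof (amgm r (W n) (W m) (B n x) (A m x) ltac:(lra) ltac:(lra) ltac:(lra) hr) as g4.
  set (Q := W n * Y n x + W m * Y m x).
  assert (u1 : Rabs (A n x * A m x - B n x * B m x) <= Q / (2 * r)).
  { apply Rmult_le_reg_r with (2 * r); [lra|]. unfold Rdiv. rewrite Rmult_assoc, Rinv_l, Rmult_1_r by lra.
    pose proof (Rabs_triang (A n x * A m x) (- (B n x * B m x))) as tr. rewrite Rabs_Ropp in tr. unfold Rminus. unfold Q, Y. nra. }
  assert (u2 : Rabs (A n x * B m x + B n x * A m x) <= Q / (2 * r)).
  { apply Rmult_le_reg_r with (2 * r); [lra|]. unfold Rdiv. rewrite Rmult_assoc, Rinv_l, Rmult_1_r by lra.
    pose proof (Rabs_triang (A n x * B m x) (B n x * A m x)) as tr. unfold Q, Y. nra. }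
  assert (pr : forall u w, Rabs u <= Ce * q2 (n + m) -> Rabs w <= Q / (2 * r) -> Rabs (u * w) <= Ce * q2 (n + m) * (Q / (2 * r))).
  { intros u' w hu' hw. rewrite Rabs_mult. apply Rmult_le_compat; try apply Rabs_pos; assumption. }
  pose proof (pr _ _ (hp (n + m)%Z) u1) as r1'. pose proof (pr _ _ (hq (n + m)%Z) u2) as r2'.
  replace (2 * Ce * (q2 (n + m) / r) * Q) with (2 * (Ce * q2 (n + m) * (Q / (2 * r)) + Ce * q2 (n + m) * (Q / (2 * r)))) by (field; lra).
  apply Rmult_le_compat_l; [lra|]. unfold cpl. apply Rle_trans with (1 := Rabs_triang _ _). lra. }
assert (Q0 : 0 <= W n * Y n x + W m * Y m x) by (pose proof (Y0 n x); pose proof (Y0 m x); nra).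
assert (qs : 0 < q2 (n + m) / s) by (apply Rdiv_lt_0_compat; lra).
unfold phi. destruct (Z_le_dec (Z.of_nat T) (Z.abs (n + m))) as [h|h].
- apply Rle_trans with (1 := gen 1 ltac:(lra) ltac:(nra)). apply Rmult_le_compat_r; [assumption|].
  apply Rmult_le_compat_l; [lra|]. unfold Rdiv at 1. rewrite Rinv_1. lra.
- apply Rle_trans with (1 := gen s s1 ltac:(idtac;
    assert (wsum : IZR (2 * Z.abs N - 2) <= W n + W m);
    [unfold W; rewrite <- plus_IZR; apply IZR_le; unfold sg in hs; destruct (Z_lt_dec N n); destruct (Z_lt_dec N m); try lra; lia|];
    replace (2 * Z.abs N - 2)%Z with (2 * Z.abs N - 3 + 1)%Z in wsum by ring; rewrite plus_IZR in wsum; nra)).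
  apply Rmult_le_compat_r; [assumption|]. apply Rmult_le_compat_l; [lra|]. lra.
Qed.

Let kap := 24 * (K6 * K6) / a.
Let kap0 : 0 <= kap.
Proof. unfold kap. apply Rmult_le_pos; [nra|left; apply Rinv_0_lt_compat; lra]. Qed.

Definition energy L x := exp (- gam * x) * lsum (zr L) (fun n => sg n * Y n x).
Definition energy' L x := exp (- gam * x) * lsum (zr L) (fun n => sg n * ((2 * (a * (IZR n + nu)) - gam) * Y n x + 2 * (A n x * H1 n x + B n x * H2 n x))).

Lemma lsum_deriv l (f f' : Z -> R -> R) x : (forall n, derivable_pt_lim (f n) x (f' n x)) ->
  derivable_pt_lim (fun x => lsum l (fun n => f n x)) x (lsum l (fun n => f' n x)).
Proof.
intros h. induction l as [|k l IH]; simpl; [apply derivable_pt_lim_const|].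
apply (derivable_pt_lim_plus (f k)); [apply h|exact IH].
Qed.

Lemma energy_deriv L x : derivable_pt_lim (energy L) x (energy' L x).
Proof.
unfold energy, energy'.
replace (exp (- gam * x) * lsum (zr L) (fun n => sg n * ((2 * (a * (IZR n + nu)) - gam) * Y n x + 2 * (A n x * H1 n x + B n x * H2 n x)))) with
 ((- gam * exp (- gam * x)) * lsum (zr L) (fun n => sg n * Y n x) + exp (- gam * x) * lsum (zr L) (fun n => sg n * (2 * (a * (IZR n + nu)) * Y n x + 2 * (A n x * H1 n x + B n x * H2 n x)))).
- apply (derivable_pt_lim_mult (fun x => exp (- gam * x)) (fun x => lsum (zr L) (fun n => sg n * Y n x))); [apply deriv_expo|].
  apply (lsum_deriv (zr L) (fun n x => sg n * Y n x) (fun n x => sg n * (2 * (a * (IZR n + nu)) * Y n x + 2 * (A n x * H1 n x + B n x * H2 n x)))).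
  intros n. apply (derivable_pt_lim_scal (Y n)). apply mode_modulus_deriv.
- rewrite (lsum_ext (zr L) (fun n => sg n * ((2 * (a * (IZR n + nu)) - gam) * Y n x + 2 * (A n x * H1 n x + B n x * H2 n x)))
    (fun n => sg n * (2 * (a * (IZR n + nu)) * Y n x + 2 * (A n x * H1 n x + B n x * H2 n x)) + (- gam) * (sg n * Y n x))) by (intros; ring).
  rewrite lsum_plus, lsum_scal. ring.
Qed.

Lemma zr_len L : lsum (zr L) (fun _ => 1) = 2 * INR L + 1.
Proof. induction L as [|L IH]; [simpl; ring|]. rewrite lsum_zr, IH, S_INR. ring. Qed.

(** The diagonal part is [a * SW]. A quarter of it absorbs the truncation error by Young's
    inequality, a quarter absorbs the coupling, and half is left. *)
Lemma energy_main L x : (1 <= L)%nat ->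
  exp (- gam * x) * (a / 2 * lsum (zr L) (fun n => Y n x) - kap / INR L) <= energy' L x.
Proof.
intros hL. assert (L1 : 1 <= INR L) by (apply (le_INR 1); assumption).
unfold energy'. apply Rmult_le_compat_l; [left; apply exp_pos|].
set (dl := K6 / INR L).
assert (dl0 : 0 <= dl) by (unfold dl; apply Rmult_le_pos; [assumption|left; apply Rinv_0_lt_compat; lra]).
set (SW := lsum (zr L) (fun n => W n * Y n x)).
set (hh1 := fun n => lsum (zr L) (fun m => p (n + m) * A m x + q (n + m) * B m x)).
set (hh2 := fun n => lsum (zr L) (fun m => q (n + m) * A m x - p (n + m) * B m x)).
assert (s2 : forall n, Rabs (sg n) = 1).
{ intros n. unfold sg. destruct (Z_lt_dec N n); [apply Rabs_R1|rewrite Rabs_left; lra]. }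
assert (step1 : lsum (zr L) (fun n => (a * W n * Y n x + 2 * (sg n * (A n x * hh1 n + B n x * hh2 n))) + (- (a / 4) * (W n * Y n x) + (- (8 / a * (dl * dl))) * 1)) <=
  lsum (zr L) (fun n => sg n * ((2 * (a * (IZR n + nu)) - gam) * Y n x + 2 * (A n x * H1 n x + B n x * H2 n x)))).
{ apply lsum_le. intros n hn. apply zr_In in hn. destruct (coupling L n x hL hn) as [c1 c2].
  fold (hh1 n) in c1. fold (hh2 n) in c2. fold dl in c1, c2.
  replace (sg n * ((2 * (a * (IZR n + nu)) - gam) * Y n x + 2 * (A n x * H1 n x + B n x * H2 n x))) with
   (sg n * (2 * (a * (IZR n + nu)) - gam) * Y n x + 2 * (sg n * (A n x * hh1 n + B n x * hh2 n)) + 2 * (sg n * (A n x * (H1 n x - hh1 n) + B n x * (H2 n x - hh2 n)))) by ring.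
  rewrite sign_weight.
  assert (er : forall u w, Rabs w <= dl -> Rabs (u * w) <= a / 8 * (u * u) + 2 / a * (dl * dl)).
  { intros u w hw. rewrite Rabs_mult. apply Rle_trans with (Rabs u * dl); [apply Rmult_le_compat_l; [apply Rabs_pos|exact hw]|].
    replace (u * u) with (Rabs u * Rabs u) by (rewrite <- Rabs_mult; apply Rabs_right; nra).
    pose proof (Rle_0_sqr (a * Rabs u - 4 * dl)) as sq. unfold Rsqr in sq.
    apply Rmult_le_reg_r with (8 * a); [nra|].
    replace ((a / 8 * (Rabs u * Rabs u) + 2 / a * (dl * dl)) * (8 * a)) with (a * a * (Rabs u * Rabs u) + 16 * (dl * dl)) by (field; lra). nra. }
  pose proof (er (A n x) _ c1) as r1. pose proof (er (B n x) _ c2) as r2.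
  assert (r3 : Rabs (sg n * (A n x * (H1 n x - hh1 n) + B n x * (H2 n x - hh2 n))) <= a / 8 * Y n x + 4 / a * (dl * dl)).
  { rewrite Rabs_mult, s2, Rmult_1_l. apply Rle_trans with (1 := Rabs_triang _ _). unfold Y.
    replace (4 / a * (dl * dl)) with (2 / a * (dl * dl) + 2 / a * (dl * dl)) by (field; lra). lra. }
  apply Rabs_bnd in r3. pose proof (weight_ge1 n). pose proof (Y0 n x).
  assert (Y n x <= W n * Y n x) by nra.
  replace (8 / a * (dl * dl)) with (2 * (4 / a * (dl * dl))) by (field; lra). nra. }
apply Rle_trans with (2 := step1).
rewrite !lsum_plus, !lsum_scal. fold SW. rewrite zr_len.
rewrite (lsum_ext (zr L) (fun n => a * W n * Y n x) (fun n => a * (W n * Y n x))) by (intros; ring). rewrite lsum_scal. fold SW.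
assert (cp : Rabs (2 * lsum (zr L) (fun n => sg n * (A n x * hh1 n + B n x * hh2 n))) <= a / 4 * SW).
{ assert (e1 : lsum (zr L) (fun n => sg n * (A n x * hh1 n + B n x * hh2 n)) = lsum (zr L) (fun n => lsum (zr L) (fun m => sg n * cpl n m x))).
  { apply lsum_ext. intros n _. unfold hh1, hh2. rewrite lsum_scal. f_equal. rewrite <- !lsum_scal, <- lsum_plus. apply lsum_ext. intros m _. unfold cpl. ring. }
  (* By the symmetry of [cpl], [sg n] may be replaced by the mean of [sg n] and [sg m], which is 0
     for indices on opposite sides. *)
  assert (e2 : lsum (zr L) (fun n => lsum (zr L) (fun m => sg n * cpl n m x)) = lsum (zr L) (fun n => lsum (zr L) (fun m => sg m * cpl n m x))).
  { rewrite lsum_exch. apply lsum_ext. intros m _. apply lsum_ext. intros n _. f_equal. unfold cpl. rewrite (Z.add_comm n m). ring. }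
  assert (e3 : 2 * lsum (zr L) (fun n => sg n * (A n x * hh1 n + B n x * hh2 n)) = lsum (zr L) (fun n => lsum (zr L) (fun m => (sg n + sg m) * cpl n m x))).
  { rewrite e1. set (X := lsum (zr L) (fun n => lsum (zr L) (fun m => sg n * cpl n m x))) in *.
    replace (2 * X) with (X + X) by ring. rewrite e2 at 2. unfold X. rewrite <- lsum_plus.
    apply lsum_ext. intros n _. rewrite <- lsum_plus. apply lsum_ext. intros; ring. }
  rewrite e3. apply Rle_trans with (1 := lsum_abs _ _).
  apply Rle_trans with (lsum (zr L) (fun n => lsum (zr L) (fun m => phi (n + m) * (W n * Y n x) + phi (n + m) * (W m * Y m x)))).
  { apply lsum_le. intros n _. apply Rle_trans with (1 := lsum_abs _ _). apply lsum_le. intros m _.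
    destruct (Req_dec (sg n) (sg m)) as [e|ne].
    - pose proof (cpl_bound n m x e) as cb. rewrite Rabs_mult. replace (Rabs (sg n + sg m)) with 2; [lra|].
      rewrite <- e. replace (sg n + sg n) with (2 * sg n) by ring. rewrite Rabs_mult, s2, Rabs_right; lra.
    - assert (z : sg n + sg m = 0) by (unfold sg in *; destruct (Z_lt_dec N n); destruct (Z_lt_dec N m); lra).
      rewrite z, Rmult_0_l, Rabs_R0. pose proof (phi0 (n + m)). pose proof (weight_ge1 n); pose proof (weight_ge1 m). pose proof (Y0 n x); pose proof (Y0 m x).
      assert (0 <= W n * Y n x) by nra. assert (0 <= W m * Y m x) by nra. nra. }
  assert (Phi : forall n, lsum (zr L) (fun m => phi (n + m)) <= 2 * Ce * (4 / INR T + 5 / s)).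
  { intros n. rewrite <- (lsum_map (zr L) (fun m => (n + m)%Z) phi).
    assert (nd : NoDup (map (fun m => (n + m)%Z) (zr L))) by (apply FinFun.Injective_map_NoDup; [intros i j; lia|apply zr_NoDup]).
    unfold phi. rewrite lsum_scal, lsum_plus. apply Rmult_le_compat_l; [lra|].
    pose proof (q2_tail T _ T1 nd).
    rewrite (lsum_ext _ (fun k => q2 k / s) (fun k => / s * q2 k)) by (intros; unfold Rdiv; ring). rewrite lsum_scal.
    pose proof (q2_total _ nd) as tt. apply Rmult_le_compat_l with (r := / s) in tt; [|left; apply Rinv_0_lt_compat; lra].
    unfold Rdiv in *. lra. }
  rewrite (lsum_ext (zr L) (fun n => lsum (zr L) (fun m => phi (n + m) * (W n * Y n x) + phi (n + m) * (W m * Y m x)))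
     (fun n => lsum (zr L) (fun m => phi (n + m) * (W n * Y n x)) + lsum (zr L) (fun m => phi (n + m) * (W m * Y m x)))) by (intros; apply lsum_plus).
  rewrite lsum_plus. rewrite (lsum_exch (zr L) (zr L) (fun n m => phi (n + m) * (W m * Y m x))).
  rewrite (lsum_ext (zr L) (fun j => lsum (zr L) (fun k => phi (k + j) * (W j * Y j x))) (fun n => lsum (zr L) (fun m => phi (n + m) * (W n * Y n x)))).
  2:{ intros n _. apply lsum_ext. intros m _. rewrite Z.add_comm. reflexivity. }
  assert (half : lsum (zr L) (fun n => lsum (zr L) (fun m => phi (n + m) * (W n * Y n x))) <= 2 * Ce * (4 / INR T + 5 / s) * SW).
  { unfold SW. rewrite <- lsum_scal. apply lsum_le. intros n _.
    rewrite (lsum_ext (zr L) _ (fun m => (W n * Y n x) * phi (n + m))) by (intros; ring). rewrite lsum_scal.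
    rewrite Rmult_comm. apply Rmult_le_compat_r; [pose proof (weight_ge1 n); pose proof (Y0 n x); nra|apply Phi]. }
  assert (SW0 : 0 <= SW) by (apply lsum_ge0; intros n _; pose proof (weight_ge1 n); pose proof (Y0 n x); nra).
  assert (4 * Ce * (4 / INR T + 5 / s) * SW <= a / 4 * SW) by (apply Rmult_le_compat_r; assumption). lra. }
apply Rabs_bnd in cp.
assert (SY : lsum (zr L) (fun n => Y n x) <= SW).
{ apply lsum_le. intros n _. pose proof (weight_ge1 n); pose proof (Y0 n x). nra. }
(* Each of the [2 L + 1 <= 3 L] modes pays [8 / a * dl^2] with [dl = K6 / L]; this is where [kap]
   comes from. *)
assert (err : 8 / a * (dl * dl) * (2 * INR L + 1) <= kap / INR L).
{ unfold dl, kap. replace (24 * (K6 * K6) / a / INR L) with (8 * (K6 * K6) / (a * (INR L * INR L)) * (3 * INR L)) by (field; lra).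
  replace (8 / a * (K6 / INR L * (K6 / INR L)) * (2 * INR L + 1)) with (8 * (K6 * K6) / (a * (INR L * INR L)) * (2 * INR L + 1)) by (field; lra).
  apply Rmult_le_compat_l; [|lra]. apply Rmult_le_pos; [nra|]. left; apply Rinv_0_lt_compat. repeat apply Rmult_lt_0_compat; lra. }
assert (a / 2 * lsum (zr L) (fun n => Y n x) <= a / 2 * SW) by (apply Rmult_le_compat_l; lra).
lra.
Qed.

(** The sign of [gam * x] keeps the exponential at most 1, so the error stays [kap / L] uniformly in
    [x]. *)
Lemma energy'_lower L x : (1 <= L)%nat -> 0 <= gam * x -> - (kap / INR L) <= energy' L x /\
  forall j eta, (Z.abs j <= Z.of_nat L)%Z -> 0 <= eta -> eta <= Y j x -> exp (- gam * x) * (a / 2 * eta) - kap / INR L <= energy' L x.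
Proof.
intros hL hg. pose proof (energy_main L x hL) as h. assert (L1 : 1 <= INR L) by (apply (le_INR 1); assumption).
assert (ex : 0 < exp (- gam * x) <= 1).
{ split; [apply exp_pos|]. rewrite <- exp_0. destruct (Req_dec (gam * x) 0) as [e|ne].
  - right. f_equal. lra.
  - left. apply exp_increasing. lra. }
assert (kl : 0 <= kap / INR L) by (apply Rmult_le_pos; [assumption|left; apply Rinv_0_lt_compat; lra]).
assert (S0 : 0 <= lsum (zr L) (fun n => Y n x)) by (apply lsum_ge0; intros; apply Y0).
assert (k2 : exp (- gam * x) * (kap / INR L) <= kap / INR L).
{ rewrite <- (Rmult_1_l (kap / INR L)) at 2. apply Rmult_le_compat_r; lra. }
split.
- apply Rle_trans with (2 := h). rewrite Rmult_minus_distr_l.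
  assert (0 <= exp (- gam * x) * (a / 2 * lsum (zr L) (fun n => Y n x))); [|lra].
  apply Rmult_le_pos; [lra|]. apply Rmult_le_pos; lra.
- intros j eta hj e0 he. apply Rle_trans with (2 := h). rewrite Rmult_minus_distr_l.
  assert (Y j x <= lsum (zr L) (fun n => Y n x)).
  { apply (lsum_in (zr L) (fun n => Y n x)); [intros; apply Y0|apply zr_In; exact hj]. }
  assert (exp (- gam * x) * (a / 2 * eta) <= exp (- gam * x) * (a / 2 * lsum (zr L) (fun n => Y n x))); [|lra].
  apply Rmult_le_compat_l; [lra|]. apply Rmult_le_compat_l; lra.
Qed.

Lemma energy_bound L x : Rabs (energy L x) <= 5 * K4 * exp (- gam * x).
Proof.
unfold energy. rewrite Rabs_mult, (Rabs_right (exp _)) by (left; apply exp_pos). rewrite Rmult_comm.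
apply Rmult_le_compat_r; [left; apply exp_pos|]. apply Rle_trans with (1 := lsum_abs _ _).
apply Rle_trans with (lsum (zr L) (fun n => K4 * q2 n)).
- apply lsum_le. intros n _. rewrite Rabs_mult. rewrite (Rabs_right (Y n x)) by (apply Rle_ge, Y0).
  replace (Rabs (sg n)) with 1; [rewrite Rmult_1_l; apply modulus_decay|].
  unfold sg. destruct (Z_lt_dec N n); [rewrite Rabs_R1; reflexivity|rewrite Rabs_left; lra].
- rewrite lsum_scal. pose proof (q2_total _ (zr_NoDup L)). rewrite (Rmult_comm 5). apply Rmult_le_compat_l; [assumption|lra].
Qed.
End Split.

(** The energies for the thresholds [N0] and [- N0 - 1] agree at 0, since the modes whose signs
    differ vanish there. Up to [O(1 / L)], the first increases on the positive axis and tends to 0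
    at its end, the second increases on the negative axis starting from 0; so neither can vary. A
    nonzero mode would produce an increase [m0] independent of [L]. *)
Lemma modes_vanish (N0 T : nat) (s : R) : (1 <= T)%nat -> 1 <= s -> 4 * Ce * (4 / INR T + 5 / s) <= a / 4 ->
  (T + 1 <= N0)%nat -> s * s <= IZR (2 * Z.of_nat N0 - 3) ->
  (forall n, (Z.abs n <= Z.of_nat N0)%Z -> A n 0 = 0 /\ B n 0 = 0) ->
  forall n x, A n x = 0 /\ B n x = 0.
Proof.
intros T1 s1 small wide sN van.
(* The mode [- N0 - 1] is not assumed to vanish at 0; the threshold [- N0 - 1] gives it the sign -1
   in both energies. *)
set (Np := Z.of_nat N0). set (Nm := (- Z.of_nat N0 - 1)%Z).
set (gp := a * (2 * IZR Np + 1 + 2 * nu)). set (gm := a * (2 * IZR Nm + 1 + 2 * nu)).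
assert (n0 : 2 <= IZR Np) by (unfold Np; apply (IZR_le 2); lia).
assert (eNm : IZR Nm = - IZR Np - 1) by (unfold Nm, Np; rewrite minus_IZR, opp_IZR; reflexivity).
assert (gp0 : 0 < gp) by (unfold gp; apply Rmult_lt_0_compat; lra).
assert (gm0 : gm < 0).
{ unfold gm. rewrite eNm. assert (0 < a * (2 * IZR Np + 1 - 2 * nu)) by (apply Rmult_lt_0_compat; lra). lra. }
assert (wp : (Z.of_nat T <= Z.abs Np - 1)%Z) by (unfold Np; lia).
assert (wm : (Z.of_nat T <= Z.abs Nm - 1)%Z) by (unfold Nm; lia).
assert (sp : s * s <= IZR (2 * Z.abs Np - 3)) by (unfold Np; rewrite Z.abs_eq by lia; exact sN).
assert (sm : s * s <= IZR (2 * Z.abs Nm - 3)) by (apply Rle_trans with (1 := sN); apply IZR_le; unfold Nm; lia).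
assert (start : forall L, energy Np L 0 = energy Nm L 0).
{ intros L. unfold energy. rewrite !Rmult_0_r. f_equal. apply lsum_ext. intros n _.
  destruct (Z_le_gt_dec (Z.abs n) (Z.of_nat N0)) as [h|h].
  - destruct (van n h) as [z1 z2]. unfold Y. rewrite z1, z2. ring.
  - f_equal. unfold sg, Np, Nm. destruct (Z_lt_dec (Z.of_nat N0) n); destruct (Z_lt_dec (- Z.of_nat N0 - 1) n); lra || lia. }
set (kap := 24 * (K6 * K6) / a).
assert (kap0 : 0 <= kap) by (unfold kap; apply Rmult_le_pos; [nra|left; apply Rinv_0_lt_compat; lra]).
assert (lowp : forall L x, (1 <= L)%nat -> 0 <= x -> - (kap / INR L) <= energy' Np L x /\
  forall j eta, (Z.abs j <= Z.of_nat L)%Z -> 0 <= eta -> eta <= Y j x -> exp (- gp * x) * (a / 2 * eta) - kap / INR L <= energy' Np L x).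
{ intros L x hL hx. apply (energy'_lower Np T s); try assumption. apply Rmult_le_pos; [left; exact gp0|exact hx]. }
assert (lowm : forall L x, (1 <= L)%nat -> x <= 0 -> - (kap / INR L) <= energy' Nm L x /\
  forall j eta, (Z.abs j <= Z.of_nat L)%Z -> 0 <= eta -> eta <= Y j x -> exp (- gm * x) * (a / 2 * eta) - kap / INR L <= energy' Nm L x).
{ intros L x hL hx. apply (energy'_lower Nm T s); try assumption. fold gm. nra. }
(* Three errors, each below [m0 / 4], cannot compensate the gain [m0]: the two energies at distance
   [X] from 0 and the accumulated truncation error. The latter grows with [X], so [X] is fixed
   before [L]. *)
assert (final : forall m0 X1 (j : Z), 0 < m0 -> 0 <= X1 ->
  (forall L X, (1 <= L)%nat -> (Z.abs j <= Z.of_nat L)%Z -> X1 <= X -> m0 - kap / INR L * (2 * X) <= energy Np L X - energy Nm L (- X)) -> False).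
{ intros m0 X1 j m0p X10 h.
  destruct (exp_decay gp (m0 / 4) (5 * K4) gp0 ltac:(lra)) as [Xa ha].
  destruct (exp_decay (- gm) (m0 / 4) (5 * K4) ltac:(lra) ltac:(lra)) as [Xb hb].
  set (X := Rmax X1 (Rmax Xa Xb)).
  assert (x1 : X1 <= X) by apply Rmax_l. assert (x2 : Rmax Xa Xb <= X) by apply Rmax_r.
  pose proof (Rmax_l Xa Xb). pose proof (Rmax_r Xa Xb).
  specialize (ha X ltac:(lra)). specialize (hb X ltac:(lra)).
  destruct (INR_unbounded (kap * (2 * X) / (m0 / 4))) as [L0 hL0].
  set (L := (1 + L0 + Z.abs_nat j)%nat).
  assert (hL : INR L0 <= INR L) by (apply le_INR; unfold L; lia).
  assert (L1 : 1 <= INR L) by (apply (le_INR 1); unfold L; lia).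
  specialize (h L X ltac:(unfold L; lia) ltac:(unfold L; lia) x1).
  pose proof (energy_bound Np L X) as sz1. pose proof (energy_bound Nm L (- X)) as sz2. fold gp in sz1. fold gm in sz2.
  replace (- gp * X) with (- (gp * X)) in sz1 by ring. replace (- gm * - X) with (- (- gm * X)) in sz2 by ring.
  assert (kl : kap / INR L * (2 * X) < m0 / 4).
  { apply Rmult_lt_reg_r with (INR L); [lra|]. replace (kap / INR L * (2 * X) * INR L) with (kap * (2 * X)) by (field; lra).
    apply Rmult_lt_reg_r with (/ (m0 / 4)); [apply Rinv_0_lt_compat; lra|].
    replace (m0 / 4 * INR L * / (m0 / 4)) with (INR L) by (field; lra). unfold Rdiv in *. lra. }
  apply Rabs_bnd in sz1, sz2. lra. }
assert (dE : forall N L x, derivable_pt_lim (energy N L) x (energy' N L x)) by (intros; apply energy_deriv).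
assert (allY : forall j x, Y j x = 0).
{ intros j xs. destruct (Req_dec (Y j xs) 0) as [e|ne]; [exact e|]. exfalso.
  pose proof (Y0 j xs) as yp. assert (yp' : 0 < Y j xs) by lra.
  set (eta := Y j xs / 2).
  destruct (cont_delta (Y j) xs eta (derivable_pt_lim_continuity_pt _ _ _ (mode_modulus_deriv j xs)) ltac:(unfold eta; lra)) as [d [d0 hd]].
  assert (near : forall x, Rabs (x - xs) <= d / 2 -> eta <= Y j x).
  { intros x hx. specialize (hd x ltac:(lra)). apply Rabs_def2 in hd. unfold eta in *. lra. }
  assert (eta0 : 0 < eta) by (unfold eta; lra).
  assert (K3 : forall L, (1 <= L)%nat -> 0 <= kap / INR L).
  { intros L hL. apply Rmult_le_pos; [assumption|left; apply Rinv_0_lt_compat; apply lt_0_INR; lia]. }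
  destruct (Rle_lt_dec 0 xs) as [hx|hx].
  - set (m0 := exp (- gp * (xs + d / 2)) * (a / 2 * eta) * (d / 2)).
    assert (m0p : 0 < m0) by (unfold m0; pose proof (exp_pos (- gp * (xs + d / 2))); repeat apply Rmult_lt_0_compat; lra).
    apply (final m0 (xs + d / 2) j m0p ltac:(lra)). intros L X hL hj hX. specialize (K3 L hL).
    pose proof (deriv_ge_incr (energy Np L) (energy' Np L) 0 xs (- (kap / INR L)) hx (fun x _ => dE Np L x) (fun x h => proj1 (lowp L x hL (proj1 h)))) as i1.
    pose proof (deriv_ge_incr (energy Np L) (energy' Np L) (xs + d / 2) X (- (kap / INR L)) hX (fun x _ => dE Np L x) (fun x h => proj1 (lowp L x hL ltac:(lra)))) as i3.
    pose proof (deriv_ge_incr (energy Nm L) (energy' Nm L) (- X) 0 (- (kap / INR L)) ltac:(lra) (fun x _ => dE Nm L x) (fun x h => proj1 (lowm L x hL (proj2 h)))) as i4.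
    assert (i2 : (exp (- gp * (xs + d / 2)) * (a / 2 * eta) - kap / INR L) * (xs + d / 2 - xs) <= energy Np L (xs + d / 2) - energy Np L xs).
    { apply (deriv_ge_incr (energy Np L) (energy' Np L)); [lra|intros; apply dE|]. intros x hx'.
      apply Rle_trans with (2 := proj2 (lowp L x hL ltac:(lra)) j eta hj ltac:(lra) (near x ltac:(apply Rabs_le; lra))).
      assert (exp (- gp * (xs + d / 2)) <= exp (- gp * x)).
      { destruct (Req_dec x (xs + d / 2)) as [->|nx]; [lra|]. left. apply exp_increasing. nra. }
      assert (exp (- gp * (xs + d / 2)) * (a / 2 * eta) <= exp (- gp * x) * (a / 2 * eta)); [|lra].
      apply Rmult_le_compat_r; [|assumption]. apply Rmult_le_pos; lra. }
    rewrite (start L) in i1. unfold m0. lra.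
  - set (m0 := exp (- gm * (xs - d / 2)) * (a / 2 * eta) * (d / 2)).
    assert (m0p : 0 < m0) by (unfold m0; pose proof (exp_pos (- gm * (xs - d / 2))); repeat apply Rmult_lt_0_compat; lra).
    apply (final m0 (- (xs - d / 2)) j m0p ltac:(lra)). intros L X hL hj hX. specialize (K3 L hL).
    pose proof (deriv_ge_incr (energy Nm L) (energy' Nm L) xs 0 (- (kap / INR L)) ltac:(lra) (fun x _ => dE Nm L x) (fun x h => proj1 (lowm L x hL (proj2 h)))) as i1.
    pose proof (deriv_ge_incr (energy Nm L) (energy' Nm L) (- X) (xs - d / 2) (- (kap / INR L)) ltac:(lra) (fun x _ => dE Nm L x) (fun x h => proj1 (lowm L x hL ltac:(lra)))) as i3.
    pose proof (deriv_ge_incr (energy Np L) (energy' Np L) 0 X (- (kap / INR L)) ltac:(lra) (fun x _ => dE Np L x) (fun x h => proj1 (lowp L x hL (proj1 h)))) as i4.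
    assert (i2 : (exp (- gm * (xs - d / 2)) * (a / 2 * eta) - kap / INR L) * (xs - (xs - d / 2)) <= energy Nm L xs - energy Nm L (xs - d / 2)).
    { apply (deriv_ge_incr (energy Nm L) (energy' Nm L)); [lra|intros; apply dE|]. intros x hx'.
      apply Rle_trans with (2 := proj2 (lowm L x hL ltac:(lra)) j eta hj ltac:(lra) (near x ltac:(apply Rabs_le; lra))).
      assert (exp (- gm * (xs - d / 2)) <= exp (- gm * x)).
      { destruct (Req_dec x (xs - d / 2)) as [->|nx]; [lra|]. left. apply exp_increasing. nra. }
      assert (exp (- gm * (xs - d / 2)) * (a / 2 * eta) <= exp (- gm * x) * (a / 2 * eta)); [|lra].
      apply Rmult_le_compat_r; [|assumption]. apply Rmult_le_pos; lra. }
    rewrite <- (start L) in i1. unfold m0. lra. }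
intros n x. specialize (allY n x). unfold Y in allY. split; nra.
Qed.
End Energy.

(** * Fourier modes of a bounded solution *)

Lemma period_Z (T : Type) (f : R -> T) : (forall t, f (t + 2 * PI) = f t) -> forall k t, f (t + 2 * PI * IZR k) = f t.
Proof.
intros h. assert (nat_case : forall n t, f (t + 2 * PI * INR n) = f t).
{ induction n as [|n IH]; intros t; [simpl; f_equal; ring|]. rewrite S_INR.
  replace (t + 2 * PI * (INR n + 1)) with (t + 2 * PI * INR n + 2 * PI) by ring. rewrite h. apply IH. }
intros k t. destruct (Z.le_gt_cases 0 k) as [hk|hk].
- rewrite <- (Z2Nat.id k) by assumption. rewrite <- INR_IZR_INZ. apply nat_case.
- rewrite <- (nat_case (Z.to_nat (- k)) (t + 2 * PI * IZR k)). f_equal. rewrite INR_IZR_INZ, Z2Nat.id by lia. rewrite opp_IZR. ring.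
Qed.

Lemma period_reduce t : exists k, 0 <= t + 2 * PI * IZR k <= 2 * PI.
Proof.
pose proof PI_RGT_0 as pi0. destruct (archimed (t / (2 * PI))) as [h1 h2].
exists (1 - up (t / (2 * PI)))%Z. rewrite minus_IZR. set (u := IZR (up (t / (2 * PI)))) in *.
assert (e : t = 2 * PI * (t / (2 * PI))) by (field; lra). set (y := t / (2 * PI)) in *. rewrite e. split; nra.
Qed.

Lemma periodic_bounded f : continuity f -> (forall t, f (t + 2 * PI) = f t) -> exists M, forall t, Rabs (f t) <= M.
Proof.
intros cf per. pose proof PI_RGT_0 as pi0.
destruct (continuity_ab_maj (fun t => Rabs (f t)) 0 (2 * PI) ltac:(lra)) as [m [hm _]].
{ intros t _. apply (continuity_pt_comp f Rabs); [apply cf|apply Rcontinuity_abs]. }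
exists (Rabs (f m)). intros t. destruct (period_reduce t) as [k hk]. rewrite <- (period_Z R f per k t). apply hm. exact hk.
Qed.

Lemma period_deriv f f' : (forall t, derivable_pt_lim f t (f' t)) -> (forall t, f (t + 2 * PI) = f t) -> forall t, f' (t + 2 * PI) = f' t.
Proof.
intros d per t. apply (uniqueness_limite f t); [|apply d].
apply (derivable_pt_lim_ext (fun s => f (s + 2 * PI))); [exact per|].
replace (f' (t + 2 * PI)) with (f' (t + 2 * PI) * (1 + 0)) by ring.
apply (derivable_pt_lim_comp (fun s => s + 2 * PI) f); [|apply d].
apply derivable_pt_lim_plus; [apply derivable_pt_lim_id|apply derivable_pt_lim_const].
Qed.

Lemma seq_continuity f x : (forall u, Un_cv u x -> Un_cv (fun n => f (u n)) (f x)) -> continuity_pt f x.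
Proof.
intros h eps e0. apply NNPP; intros hn.
assert (ex : forall n : nat, exists y, Rabs (y - x) < / (INR n + 1) /\ eps <= Rabs (f y - f x)).
{ intros n. apply NNPP; intros hm. apply hn. exists (/ (INR n + 1)). pose proof (pos_INR n).
  split; [apply Rinv_0_lt_compat; lra|]. intros y [_ hy]. simpl in *. unfold Rdist in *.
  destruct (Rlt_le_dec (Rabs (f y - f x)) eps); [assumption|]. exfalso; apply hm; exists y; auto. }
set (u := fun n => proj1_sig (constructive_indefinite_description _ (ex n))).
assert (hu : forall n, Rabs (u n - x) < / (INR n + 1) /\ eps <= Rabs (f (u n) - f x)).
{ intros n. unfold u. apply (proj2_sig (constructive_indefinite_description _ (ex n))). }
assert (cu : Un_cv u x).
{ intros e e1. destruct (Un_cv_inv e e1) as [N hN]. exists N. intros n hnn. specialize (hN n hnn). unfold Rdist in *.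
  rewrite Rminus_0_r in hN. pose proof (Rle_abs (/ (INR n + 1))). destruct (hu n). lra. }
destruct (h u cu eps e0) as [N hN]. specialize (hN N ltac:(lia)). unfold Rdist in hN. destruct (hu N). lra.
Qed.

(** Sequential continuity by dominated convergence, since [g] is only separately continuous. *)
Lemma J_param_cont g M c d : (forall t, continuity (fun x => g x t)) -> (forall x, continuity (g x)) ->
  (forall x t, Rabs (g x t) <= M) -> continuity (fun x => J c d (fun t => g x t)).
Proof.
intros c1 c2 m x. apply seq_continuity. intros u hu.
apply (J_lim c d (fun n t => g (u n) t) (fun t => g x t) M).
- intros n. apply (Bm1_cont _ M); [apply c2|apply m].
- apply (Bm1_cont _ M); [apply c2|apply m].
- intros; apply m.
- intros t _. apply (cont_seq (fun x => g x t)); [apply c1|exact hu].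
Qed.

Lemma abs_mult_le u w K L : Rabs u <= K -> Rabs w <= L -> Rabs (u * w) <= K * L.
Proof. intros hu hw. rewrite Rabs_mult. apply Rmult_le_compat; try apply Rabs_pos; assumption. Qed.

Lemma abs_plus_le u w K L : Rabs u <= K -> Rabs w <= L -> Rabs (u + w) <= K + L.
Proof. intros hu hw. apply Rle_trans with (1 := Rabs_triang _ _). lra. Qed.

Lemma abs_minus_le u w K L : Rabs u <= K -> Rabs w <= L -> Rabs (u - w) <= K + L.
Proof. intros hu hw. unfold Rminus. apply abs_plus_le; [assumption|rewrite Rabs_Ropp; assumption]. Qed.

Ltac eta_J := repeat match goal with |- context [J ?a ?b (fun t => ?f t)] => progress change (J a b (fun t => f t)) with (J a b f) end.
Section Modes.
Variables a b nu : R.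
Variables e1 e2 : R -> R.
Variables Me Ce : R.
Hypothesis ce1 : continuity e1.
Hypothesis ce2 : continuity e2.
Hypothesis me1 : forall t, Rabs (e1 t) <= Me.
Hypothesis me2 : forall t, Rabs (e2 t) <= Me.
Hypothesis hp : forall k, Rabs (cfp e1 e2 k) <= Ce * q2 k.
Hypothesis hq : forall k, Rabs (cfq e1 e2 k) <= Ce * q2 k.
Variables v1 v2 v1x v2x v1t v2t : R -> R -> R.
Variable Mv : R.
Hypothesis per1 : forall x t, v1 x (t + 2 * PI) = v1 x t.
Hypothesis per2 : forall x t, v2 x (t + 2 * PI) = v2 x t.
Hypothesis d1x : forall x t, derivable_pt_lim (fun x => v1 x t) x (v1x x t).
Hypothesis d2x : forall x t, derivable_pt_lim (fun x => v2 x t) x (v2x x t).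
Hypothesis d1t : forall x t, derivable_pt_lim (v1 x) t (v1t x t).
Hypothesis d2t : forall x t, derivable_pt_lim (v2 x) t (v2t x t).
Hypothesis m1 : forall x t, Rabs (v1 x t) <= Mv.
Hypothesis m2 : forall x t, Rabs (v2 x t) <= Mv.
Hypothesis eq1 : forall x t, v1x x t = b * v1t x t + a * v2t x t + nu * (a * v1 x t - b * v2 x t) + (e1 t * v1 x t + e2 t * v2 x t).
Hypothesis eq2 : forall x t, v2x x t = - a * v1t x t + b * v2t x t + nu * (b * v1 x t + a * v2 x t) + (e2 t * v1 x t - e1 t * v2 x t).

(* [md1 + i md2 = (f + i g) exp (- i k t)]: [VA + i VB] is the [k]-th Fourier integral of [f + i g]. *)
Definition md1 (f g : R -> R -> R) k x t := f x t * cz k t + g x t * sz k t.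
Definition md2 (f g : R -> R -> R) k x t := g x t * cz k t - f x t * sz k t.
Definition VA (f g : R -> R -> R) k x := J 0 (2 * PI) (fun t => md1 f g k x t).
Definition VB (f g : R -> R -> R) k x := J 0 (2 * PI) (fun t => md2 f g k x t).
(** [f1 + i f2] is [e conj(v)] with [e = e1 + i e2] and [v = v1 + i v2]. *)
Let f1 x t := e1 t * v1 x t + e2 t * v2 x t.
Let f2 x t := e2 t * v1 x t - e1 t * v2 x t.

(** The regularity that a solution directly provides; with the bound it implies measurability in the
    plane. *)
Definition sepb f M := (forall t, continuity (fun x => f x t)) /\ (forall x, continuity (f x)) /\ (forall x t, Rabs (f x t) <= M).
Lemma sepb_Bm2 f M : sepb f M -> Bm2 f.
Proof. intros [h1 [h2 h3]]. apply (Bm2_sepcont f M); assumption. Qed.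

Lemma sepb_plus f g M N : sepb f M -> sepb g N -> sepb (fun x t => f x t + g x t) (M + N).
Proof.
intros [h1 [h2 h3]] [k1 [k2 k3]]. split; [|split].
- intros t. apply (continuity_plus (fun x => f x t)); auto.
- intros x. apply (continuity_plus (f x)); auto.
- intros; apply abs_plus_le; auto.
Qed.

Lemma sepb_mult f g M N : sepb f M -> sepb g N -> sepb (fun x t => f x t * g x t) (M * N).
Proof.
intros [h1 [h2 h3]] [k1 [k2 k3]]. split; [|split].
- intros t. apply (continuity_mult (fun x => f x t)); auto.
- intros x. apply (continuity_mult (f x)); auto.
- intros; apply abs_mult_le; auto.
Qed.

Lemma sepb_minus f g M N : sepb f M -> sepb g N -> sepb (fun x t => f x t - g x t) (M + N).
Proof.
intros [h1 [h2 h3]] [k1 [k2 k3]]. split; [|split].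
- intros t. apply (continuity_minus (fun x => f x t)); auto.
- intros x. apply (continuity_minus (f x)); auto.
- intros; apply abs_minus_le; auto.
Qed.

Lemma sepb_t h N : continuity h -> (forall t, Rabs (h t) <= N) -> sepb (fun _ t => h t) N.
Proof.
intros ch hh. split; [|split].
- intros t. apply continuity_const. intros y z; reflexivity.
- intros _. exact ch.
- intros; apply hh.
Qed.

Lemma sepb_const k : sepb (fun _ _ => k) (Rabs k).
Proof. apply (sepb_t (fun _ => k)); [apply continuity_const; intros y z; reflexivity|intros; apply Rle_refl]. Qed.

Lemma sepb_md1 f g M k : sepb f M -> sepb g M -> sepb (md1 f g k) (2 * M).
Proof.
intros hf hg. replace (2 * M) with (M * 1 + M * 1) by ring. apply (sepb_plus (fun x t => f x t * cz k t) (fun x t => g x t * sz k t)).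
- apply (sepb_mult f (fun _ t => cz k t)); [assumption|apply sepb_t; [apply continuity_cz|apply cz_le]].
- apply (sepb_mult g (fun _ t => sz k t)); [assumption|apply sepb_t; [apply continuity_sz|apply sz_le]].
Qed.

Lemma sepb_md2 f g M k : sepb f M -> sepb g M -> sepb (md2 f g k) (2 * M).
Proof.
intros hf hg. replace (2 * M) with (M * 1 + M * 1) by ring. apply (sepb_minus (fun x t => g x t * cz k t) (fun x t => f x t * sz k t)).
- apply (sepb_mult g (fun _ t => cz k t)); [assumption|apply sepb_t; [apply continuity_cz|apply cz_le]].
- apply (sepb_mult f (fun _ t => sz k t)); [assumption|apply sepb_t; [apply continuity_sz|apply sz_le]].
Qed.

Let sv1 : sepb v1 Mv.
Proof. split; [|split; [|exact m1]]; [intros t x; apply (derivable_pt_lim_continuity_pt _ _ _ (d1x x t))|intros x t; apply (derivable_pt_lim_continuity_pt _ _ _ (d1t x t))]. Qed.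

Let sv2 : sepb v2 Mv.
Proof. split; [|split; [|exact m2]]; [intros t x; apply (derivable_pt_lim_continuity_pt _ _ _ (d2x x t))|intros x t; apply (derivable_pt_lim_continuity_pt _ _ _ (d2t x t))]. Qed.

Let sf1 : sepb f1 (2 * Me * Mv).
Proof.
replace (2 * Me * Mv) with (Me * Mv + Me * Mv) by ring. apply (sepb_plus (fun x t => e1 t * v1 x t) (fun x t => e2 t * v2 x t)).
- apply (sepb_mult (fun _ t => e1 t) v1); [apply sepb_t; assumption|exact sv1].
- apply (sepb_mult (fun _ t => e2 t) v2); [apply sepb_t; assumption|exact sv2].
Qed.

Let sf2 : sepb f2 (2 * Me * Mv).
Proof.
replace (2 * Me * Mv) with (Me * Mv + Me * Mv) by ring. apply (sepb_minus (fun x t => e2 t * v1 x t) (fun x t => e1 t * v2 x t)).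
- apply (sepb_mult (fun _ t => e2 t) v1); [apply sepb_t; assumption|exact sv1].
- apply (sepb_mult (fun _ t => e1 t) v2); [apply sepb_t; assumption|exact sv2].
Qed.

Lemma sepb_weaken f M N : M <= N -> sepb f M -> sepb f N.
Proof. intros h [h1 [h2 h3]]. split; [exact h1|split; [exact h2|]]. intros x t. specialize (h3 x t). lra. Qed.

(* By periodicity the flux through [t = 0] and [t = 2 PI] cancels. *)
Lemma flux_ode P S Px Pt Sx St g M : sepb P M -> sepb S M -> sepb g M ->
  (forall x t, derivable_pt_lim (fun x => P x t) x (Px x t)) -> (forall x t, derivable_pt_lim (P x) t (Pt x t)) ->
  (forall x t, derivable_pt_lim (fun x => S x t) x (Sx x t)) -> (forall x t, derivable_pt_lim (S x) t (St x t)) ->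
  (forall x t, Px x t + St x t = g x t) -> (forall x, S x (2 * PI) = S x 0) ->
  forall x, derivable_pt_lim (fun x => J 0 (2 * PI) (fun t => P x t)) x (J 0 (2 * PI) (fun t => g x t)).
Proof.
intros sP sS sgg dPx dPt dSx dSt eqn perS. pose proof (sepb_Bm2 _ _ sP) as bP. pose proof (sepb_Bm2 _ _ sgg) as bg.
apply (deriv_of_J (fun x => J 0 (2 * PI) (fun t => P x t)) (fun x => J 0 (2 * PI) (fun t => g x t))).
- apply (Bm2_J g); assumption.
- destruct sgg as [h1 [h2 h3]]. apply (J_param_cont g M); assumption.
- intros x y xy. destruct sP as [p1 [p2 p3]]. destruct sS as [q1 [q2' q3]]. destruct sgg as [r1 [r2 r3]].
  pose proof (divergence P S g Px Pt Sx St M p3 q3 r3 dPx dPt dSx dSt eqn r1 r2 x y 0 (2 * PI) xy PI2_pos) as dv.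
  unfold Div in dv. rewrite (J_minus 0 (2 * PI) (fun t => P y t)) in dv by (apply (Bm2_sec2 P _ bP)).
  rewrite (J_ext x y (fun x => S x (2 * PI) - S x 0) (fun _ => 0)) in dv by (intros; rewrite perS; ring).
  rewrite J_const in dv by assumption. rewrite JJ_fubini in dv by (try assumption; apply PI2_pos). unfold JJ in dv. change (J 0 (2 * PI) (P x)) with (J 0 (2 * PI) (fun t => P x t)) in dv. lra.
Qed.

(** [kn k] is the factor of [lambda] in the equation of mode [k], and [Mb k] dominates its density,
    flux and source together, as the divergence theorem takes a single bound. *)
Let kn k := IZR k + nu.
Let Mb k := (1 + Rabs a + Rabs b) * (2 * Mv) + Rabs (kn k) * (Rabs a * (2 * Mv) + Rabs b * (2 * Mv)) + 2 * (2 * Me * Mv).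
Let Mv0 : 0 <= Mv. Proof. pose proof (m1 0 0). pose proof (Rabs_pos (v1 0 0)). lra. Qed.

Let Me0 : 0 <= Me. Proof. pose proof (me1 0). pose proof (Rabs_pos (e1 0)). lra. Qed.

Lemma md1_deriv_x k x t : derivable_pt_lim (fun x => md1 v1 v2 k x t) x (md1 v1x v2x k x t).
Proof.
unfold md1. apply (derivable_pt_lim_plus (fun x => v1 x t * cz k t) (fun x => v2 x t * sz k t)).
- replace (v1x x t * cz k t) with (v1x x t * cz k t + v1 x t * 0) by ring.
  apply (derivable_pt_lim_mult (fun x => v1 x t) (fun _ => cz k t)); [apply d1x|apply derivable_pt_lim_const].
- replace (v2x x t * sz k t) with (v2x x t * sz k t + v2 x t * 0) by ring.
  apply (derivable_pt_lim_mult (fun x => v2 x t) (fun _ => sz k t)); [apply d2x|apply derivable_pt_lim_const].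
Qed.

Lemma md2_deriv_x k x t : derivable_pt_lim (fun x => md2 v1 v2 k x t) x (md2 v1x v2x k x t).
Proof.
unfold md2. apply (derivable_pt_lim_minus (fun x => v2 x t * cz k t) (fun x => v1 x t * sz k t)).
- replace (v2x x t * cz k t) with (v2x x t * cz k t + v2 x t * 0) by ring.
  apply (derivable_pt_lim_mult (fun x => v2 x t) (fun _ => cz k t)); [apply d2x|apply derivable_pt_lim_const].
- replace (v1x x t * sz k t) with (v1x x t * sz k t + v1 x t * 0) by ring.
  apply (derivable_pt_lim_mult (fun x => v1 x t) (fun _ => sz k t)); [apply d1x|apply derivable_pt_lim_const].
Qed.

Lemma md1_deriv_t k x t : derivable_pt_lim (md1 v1 v2 k x) t (md1 v1t v2t k x t + IZR k * md2 v1 v2 k x t).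
Proof.
replace (md1 v1t v2t k x t + IZR k * md2 v1 v2 k x t) with
 ((v1t x t * cz k t + v1 x t * (- IZR k * sz k t)) + (v2t x t * sz k t + v2 x t * (IZR k * cz k t))) by (unfold md1, md2; ring).
apply (derivable_pt_lim_plus (fun t => v1 x t * cz k t) (fun t => v2 x t * sz k t)).
- apply (derivable_pt_lim_mult (v1 x) (cz k)); [apply d1t|apply deriv_cz].
- apply (derivable_pt_lim_mult (v2 x) (sz k)); [apply d2t|apply deriv_sz].
Qed.

Lemma md2_deriv_t k x t : derivable_pt_lim (md2 v1 v2 k x) t (md2 v1t v2t k x t - IZR k * md1 v1 v2 k x t).
Proof.
replace (md2 v1t v2t k x t - IZR k * md1 v1 v2 k x t) with
 ((v2t x t * cz k t + v2 x t * (- IZR k * sz k t)) - (v1t x t * sz k t + v1 x t * (IZR k * cz k t))) by (unfold md1, md2; ring).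
apply (derivable_pt_lim_minus (fun t => v2 x t * cz k t) (fun t => v1 x t * sz k t)).
- apply (derivable_pt_lim_mult (v2 x) (cz k)); [apply d2t|apply deriv_cz].
- apply (derivable_pt_lim_mult (v1 x) (sz k)); [apply d1t|apply deriv_sz].
Qed.

Lemma lin2_deriv (f g : R -> R) x df dg al be : derivable_pt_lim f x df -> derivable_pt_lim g x dg ->
  derivable_pt_lim (fun x => al * f x + be * g x) x (al * df + be * dg).
Proof. intros hf hg. apply derivable_pt_lim_plus; apply derivable_pt_lim_scal; assumption. Qed.

Lemma sepb_lin2 f g M al be : sepb f M -> sepb g M -> sepb (fun x t => al * f x t + be * g x t) (Rabs al * M + Rabs be * M).
Proof.
intros hf hg. apply (sepb_plus (fun x t => al * f x t) (fun x t => be * g x t)).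
- apply (sepb_mult (fun _ _ => al) f); [apply sepb_const|assumption].
- apply (sepb_mult (fun _ _ => be) g); [apply sepb_const|assumption].
Qed.

Lemma md_per k x : md1 v1 v2 k x (2 * PI) = md1 v1 v2 k x 0 /\ md2 v1 v2 k x (2 * PI) = md2 v1 v2 k x 0.
Proof. replace (2 * PI) with (0 + 2 * PI) by ring. unfold md1, md2. rewrite per1, per2, cz_per, sz_per. split; reflexivity. Qed.

Let sm1 k := sepb_md1 v1 v2 Mv k sv1 sv2.
Let sm2 k := sepb_md2 v1 v2 Mv k sv1 sv2.
Let sh1 k := sepb_md1 f1 f2 (2 * Me * Mv) k sf1 sf2.
Let sh2 k := sepb_md2 f1 f2 (2 * Me * Mv) k sf1 sf2.
Let bd1 k x : Bm1 (fun t => md1 v1 v2 k x t). Proof. apply (Bm2_sec2 _ x (sepb_Bm2 _ _ (sm1 k))). Qed.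

Let bd2 k x : Bm1 (fun t => md2 v1 v2 k x t). Proof. apply (Bm2_sec2 _ x (sepb_Bm2 _ _ (sm2 k))). Qed.

Let bh1 k x : Bm1 (fun t => md1 f1 f2 k x t). Proof. apply (Bm2_sec2 _ x (sepb_Bm2 _ _ (sh1 k))). Qed.

Let bh2 k x : Bm1 (fun t => md2 f1 f2 k x t). Proof. apply (Bm2_sec2 _ x (sepb_Bm2 _ _ (sh2 k))). Qed.

(** Multiplying [v_x + i lambda v_t = lambda nu v + e conj(v)] by [exp (- i k t)] gives a balance
    law whose flux has real part [S], the real part of [i lambda v exp (- i k t)]. Moving the
    derivative off the exponential turns [nu] into [k + nu]. *)
Lemma mode_odeA k x : derivable_pt_lim (VA v1 v2 k) x ((IZR k + nu) * (a * VA v1 v2 k x - b * VB v1 v2 k x) + VA f1 f2 k x).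
Proof.
set (g := fun x t => kn k * (a * md1 v1 v2 k x t + (- b) * md2 v1 v2 k x t) + md1 f1 f2 k x t).
replace ((IZR k + nu) * (a * VA v1 v2 k x - b * VB v1 v2 k x) + VA f1 f2 k x) with (J 0 (2 * PI) (fun t => g x t)).
2:{ unfold g. rewrite J_plus; [|apply Bm1_scal, Bm1_plus; apply Bm1_scal; auto|auto].
    rewrite J_scal by (apply Bm1_plus; apply Bm1_scal; auto). rewrite J_plus by (apply Bm1_scal; auto). rewrite !J_scal by auto.
    unfold VA, VB, kn. eta_J. ring. }
pose proof (Rabs_pos a); pose proof (Rabs_pos b); pose proof (Rabs_pos (kn k)).
assert (t1 : 0 <= Rabs (kn k) * (Rabs a * (2 * Mv) + Rabs b * (2 * Mv))) by (apply Rmult_le_pos; nra).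
assert (t2 : 0 <= Rabs a * (2 * Mv)) by nra. assert (t3 : 0 <= Rabs b * (2 * Mv)) by nra. assert (t4 : 0 <= Me * Mv) by nra.
apply (flux_ode (md1 v1 v2 k) (fun x t => (- b) * md1 v1 v2 k x t + (- a) * md2 v1 v2 k x t) (md1 v1x v2x k)
  (fun x t => md1 v1t v2t k x t + IZR k * md2 v1 v2 k x t)
  (fun x t => (- b) * md1 v1x v2x k x t + (- a) * md2 v1x v2x k x t)
  (fun x t => (- b) * (md1 v1t v2t k x t + IZR k * md2 v1 v2 k x t) + (- a) * (md2 v1t v2t k x t - IZR k * md1 v1 v2 k x t)) g (Mb k)).
- apply (sepb_weaken _ (2 * Mv)); [unfold Mb; lra|apply sm1].
- apply (sepb_weaken _ (Rabs (- b) * (2 * Mv) + Rabs (- a) * (2 * Mv))); [rewrite !Rabs_Ropp; unfold Mb; lra|].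
  apply sepb_lin2; [apply sm1|apply sm2].
- apply (sepb_weaken _ (Rabs (kn k) * (Rabs a * (2 * Mv) + Rabs (- b) * (2 * Mv)) + 2 * (2 * Me * Mv))); [rewrite Rabs_Ropp; unfold Mb; lra|].
  apply sepb_plus; [|apply sh1]. apply (sepb_mult (fun _ _ => kn k)); [apply sepb_const|]. apply sepb_lin2; [apply sm1|apply sm2].
- apply md1_deriv_x.
- apply md1_deriv_t.
- intros y t. apply (lin2_deriv (fun x => md1 v1 v2 k x t) (fun x => md2 v1 v2 k x t)); [apply md1_deriv_x|apply md2_deriv_x].
- intros y t. apply (lin2_deriv (md1 v1 v2 k y) (md2 v1 v2 k y)); [apply md1_deriv_t|apply md2_deriv_t].
- intros y t. unfold g, md1, md2, kn, f1, f2. rewrite eq1, eq2. ring.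
- intros y. destruct (md_per k y) as [q1 q2']. rewrite q1, q2'. reflexivity.
Qed.

(** The imaginary part of the same balance law. *)
Lemma mode_odeB k x : derivable_pt_lim (VB v1 v2 k) x ((IZR k + nu) * (b * VA v1 v2 k x + a * VB v1 v2 k x) + VB f1 f2 k x).
Proof.
set (g := fun x t => kn k * (b * md1 v1 v2 k x t + a * md2 v1 v2 k x t) + md2 f1 f2 k x t).
replace ((IZR k + nu) * (b * VA v1 v2 k x + a * VB v1 v2 k x) + VB f1 f2 k x) with (J 0 (2 * PI) (fun t => g x t)).
2:{ unfold g. rewrite J_plus; [|apply Bm1_scal, Bm1_plus; apply Bm1_scal; auto|auto].
    rewrite J_scal by (apply Bm1_plus; apply Bm1_scal; auto). rewrite J_plus by (apply Bm1_scal; auto). rewrite !J_scal by auto.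
    unfold VA, VB, kn. eta_J. ring. }
pose proof (Rabs_pos a); pose proof (Rabs_pos b); pose proof (Rabs_pos (kn k)).
assert (t1 : 0 <= Rabs (kn k) * (Rabs a * (2 * Mv) + Rabs b * (2 * Mv))) by (apply Rmult_le_pos; nra).
assert (t2 : 0 <= Rabs a * (2 * Mv)) by nra. assert (t3 : 0 <= Rabs b * (2 * Mv)) by nra. assert (t4 : 0 <= Me * Mv) by nra.
apply (flux_ode (md2 v1 v2 k) (fun x t => a * md1 v1 v2 k x t + (- b) * md2 v1 v2 k x t) (md2 v1x v2x k)
  (fun x t => md2 v1t v2t k x t - IZR k * md1 v1 v2 k x t)
  (fun x t => a * md1 v1x v2x k x t + (- b) * md2 v1x v2x k x t)
  (fun x t => a * (md1 v1t v2t k x t + IZR k * md2 v1 v2 k x t) + (- b) * (md2 v1t v2t k x t - IZR k * md1 v1 v2 k x t)) g (Mb k)).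
- apply (sepb_weaken _ (2 * Mv)); [unfold Mb; lra|apply sm2].
- apply (sepb_weaken _ (Rabs a * (2 * Mv) + Rabs (- b) * (2 * Mv))); [rewrite !Rabs_Ropp; unfold Mb; lra|].
  apply sepb_lin2; [apply sm1|apply sm2].
- apply (sepb_weaken _ (Rabs (kn k) * (Rabs b * (2 * Mv) + Rabs a * (2 * Mv)) + 2 * (2 * Me * Mv))); [unfold Mb; lra|].
  apply sepb_plus; [|apply sh2]. apply (sepb_mult (fun _ _ => kn k)); [apply sepb_const|]. apply sepb_lin2; [apply sm1|apply sm2].
- apply md2_deriv_x.
- apply md2_deriv_t.
- intros y t. apply (lin2_deriv (fun x => md1 v1 v2 k x t) (fun x => md2 v1 v2 k x t)); [apply md1_deriv_x|apply md2_deriv_x].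
- intros y t. apply (lin2_deriv (md1 v1 v2 k y) (md2 v1 v2 k y)); [apply md1_deriv_t|apply md2_deriv_t].
- intros y t. unfold g, md1, md2, kn, f1, f2. rewrite eq1, eq2. ring.
- intros y. destruct (md_per k y) as [q1 q2']. rewrite q1, q2'. reflexivity.
Qed.

Local Notation p := (cfp e1 e2).
Local Notation q := (cfq e1 e2).
(** [e] is replaced by its partial sum under the integral; the term of frequency [j] contributes
    [e_j] times the conjugate of the mode [j - n] of [v]. The error is 8 from the series times the 4
    products of an error with a component of [v]. *)
Lemma mode_coupling T n x : (1 <= T)%nat ->
  Rabs (VA f1 f2 n x - lsum (zr T) (fun j => p j * VA v1 v2 (j - n) x + q j * VB v1 v2 (j - n) x)) <= 32 * Ce * Mv * (2 * PI) / INR T /\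
  Rabs (VB f1 f2 n x - lsum (zr T) (fun j => q j * VA v1 v2 (j - n) x - p j * VB v1 v2 (j - n) x)) <= 32 * Ce * Mv * (2 * PI) / INR T.
Proof.
intros hT. assert (T0 : 0 < INR T) by (apply lt_0_INR; lia). pose proof PI_RGT_0 as pi0.
set (u := ser1 e1 e2 T). set (w := ser2 e1 e2 T).
assert (su : forall t, u t = lsum (zr T) (fun j => p j * cz j t - q j * sz j t)) by reflexivity.
assert (sw : forall t, w t = lsum (zr T) (fun j => p j * sz j t + q j * cz j t)) by reflexivity.
assert (r1 : forall g h, (forall k, Bm1 (fun t => g k t)) -> (forall k, Bm1 (fun t => h k t)) ->
   lsum (zr T) (fun j => p j * J 0 (2 * PI) (g j) + q j * J 0 (2 * PI) (h j)) = J 0 (2 * PI) (fun t => lsum (zr T) (fun j => p j * g j t + q j * h j t))).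
{ intros g h bg bh. rewrite (J_lsum 0 (2 * PI) (zr T) (fun j t => p j * g j t + q j * h j t)); [|apply PI2_pos|].
  - apply lsum_ext. intros j _. rewrite J_plus by (apply Bm1_scal; auto). rewrite !J_scal by auto. reflexivity.
  - intros k. apply Bm1_plus; apply Bm1_scal; auto. }
pose proof (fourier_series e1 e2 Me Ce ce1 ce2 me1 me2 hp hq T) as fs.
set (dl := 8 * Ce / INR T) in *.
assert (bound : forall t z1 z2 c s, 0 <= t <= 2 * PI -> Rabs c <= 1 -> Rabs s <= 1 -> Rabs z1 <= Mv -> Rabs z2 <= Mv ->
   Rabs (((e1 t - u t) * z1 + (e2 t - w t) * z2) * c + ((e2 t - w t) * z1 - (e1 t - u t) * z2) * s) <= 4 * (dl * Mv)).
{ intros t z1 z2 c s ht hc hs h1 h2. destruct (fs t hT ht) as [g1 g2]. fold u in g1. fold w in g2.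
  replace (4 * (dl * Mv)) with ((dl * Mv + dl * Mv) * 1 + (dl * Mv + dl * Mv) * 1) by ring.
  apply abs_plus_le; apply abs_mult_le; try assumption; [apply abs_plus_le|apply abs_minus_le]; apply abs_mult_le; assumption. }
assert (ek : 32 * Ce * Mv * (2 * PI) / INR T = 4 * (dl * Mv) * (2 * PI - 0)) by (unfold dl; field; lra).
rewrite ek. split.
- assert (E : lsum (zr T) (fun j => p j * VA v1 v2 (j - n) x + q j * VB v1 v2 (j - n) x) =
     J 0 (2 * PI) (fun t => (u t * v1 x t + w t * v2 x t) * cz n t + (w t * v1 x t - u t * v2 x t) * sz n t)).
  { unfold VA, VB. rewrite (r1 (fun j t => md1 v1 v2 (j - n) x t) (fun j t => md2 v1 v2 (j - n) x t)) by auto.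
    apply J_ext. intros t. rewrite su, sw.
    replace ((lsum (zr T) (fun j => p j * cz j t - q j * sz j t) * v1 x t + lsum (zr T) (fun j => p j * sz j t + q j * cz j t) * v2 x t) * cz n t +
      (lsum (zr T) (fun j => p j * sz j t + q j * cz j t) * v1 x t - lsum (zr T) (fun j => p j * cz j t - q j * sz j t) * v2 x t) * sz n t) with
     ((v1 x t * cz n t - v2 x t * sz n t) * lsum (zr T) (fun j => p j * cz j t - q j * sz j t) + (v2 x t * cz n t + v1 x t * sz n t) * lsum (zr T) (fun j => p j * sz j t + q j * cz j t)) by ring.
    rewrite <- !lsum_scal, <- lsum_plus. apply lsum_ext. intros j _. unfold md1, md2. rewrite cz_minus, sz_minus. ring. }
  rewrite E. unfold VA.
  assert (bb : Bm1 (fun t => (u t * v1 x t + w t * v2 x t) * cz n t + (w t * v1 x t - u t * v2 x t) * sz n t)).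
  { assert (bu : Bm1 u) by (apply (Bm1_lsum (zr T) (fun k t => p k * cz k t - q k * sz k t)); intros; bm).
    assert (bw : Bm1 w) by (apply (Bm1_lsum (zr T) (fun k t => p k * sz k t + q k * cz k t)); intros; bm).
    pose proof (Bm2_sec2 _ x (sepb_Bm2 _ _ sv1)) as b1. pose proof (Bm2_sec2 _ x (sepb_Bm2 _ _ sv2)) as b2. bm. }
  rewrite <- J_minus by (assumption || apply bh1). apply J_abs_le; [apply Bm1_minus; [apply bh1|assumption]|lra|].
  intros t ht. unfold md1, f1, f2.
  replace ((e1 t * v1 x t + e2 t * v2 x t) * cz n t + (e2 t * v1 x t - e1 t * v2 x t) * sz n t - ((u t * v1 x t + w t * v2 x t) * cz n t + (w t * v1 x t - u t * v2 x t) * sz n t))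
   with (((e1 t - u t) * v1 x t + (e2 t - w t) * v2 x t) * cz n t + ((e2 t - w t) * v1 x t - (e1 t - u t) * v2 x t) * sz n t) by ring.
  apply bound; [exact ht|apply cz_le|apply sz_le|apply m1|apply m2].
- assert (E : lsum (zr T) (fun j => q j * VA v1 v2 (j - n) x - p j * VB v1 v2 (j - n) x) =
     J 0 (2 * PI) (fun t => (w t * v1 x t - u t * v2 x t) * cz n t - (u t * v1 x t + w t * v2 x t) * sz n t)).
  { unfold VA, VB. rewrite (lsum_ext (zr T) _ (fun j => p j * J 0 (2 * PI) (fun t => (-1) * md2 v1 v2 (j - n) x t) + q j * J 0 (2 * PI) (fun t => md1 v1 v2 (j - n) x t))).
    2:{ intros j _. rewrite J_scal by auto. eta_J. ring. }
    rewrite (r1 (fun j t => (-1) * md2 v1 v2 (j - n) x t) (fun j t => md1 v1 v2 (j - n) x t)) by (auto; intros; apply Bm1_scal; auto).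
    apply J_ext. intros t. rewrite su, sw.
    replace ((lsum (zr T) (fun j => p j * sz j t + q j * cz j t) * v1 x t - lsum (zr T) (fun j => p j * cz j t - q j * sz j t) * v2 x t) * cz n t -
      (lsum (zr T) (fun j => p j * cz j t - q j * sz j t) * v1 x t + lsum (zr T) (fun j => p j * sz j t + q j * cz j t) * v2 x t) * sz n t) with
     ((- v2 x t * cz n t - v1 x t * sz n t) * lsum (zr T) (fun j => p j * cz j t - q j * sz j t) + (v1 x t * cz n t - v2 x t * sz n t) * lsum (zr T) (fun j => p j * sz j t + q j * cz j t)) by ring.
    rewrite <- !lsum_scal, <- lsum_plus. apply lsum_ext. intros j _. unfold md1, md2. rewrite cz_minus, sz_minus. ring. }
  rewrite E. unfold VB.
  assert (bb : Bm1 (fun t => (w t * v1 x t - u t * v2 x t) * cz n t - (u t * v1 x t + w t * v2 x t) * sz n t)).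
  { assert (bu : Bm1 u) by (apply (Bm1_lsum (zr T) (fun k t => p k * cz k t - q k * sz k t)); intros; bm).
    assert (bw : Bm1 w) by (apply (Bm1_lsum (zr T) (fun k t => p k * sz k t + q k * cz k t)); intros; bm).
    pose proof (Bm2_sec2 _ x (sepb_Bm2 _ _ sv1)) as b1. pose proof (Bm2_sec2 _ x (sepb_Bm2 _ _ sv2)) as b2. bm. }
  rewrite <- J_minus by (assumption || apply bh2). apply J_abs_le; [apply Bm1_minus; [apply bh2|assumption]|lra|].
  intros t ht. unfold md2, f1, f2.
  replace ((e2 t * v1 x t - e1 t * v2 x t) * cz n t - (e1 t * v1 x t + e2 t * v2 x t) * sz n t - ((w t * v1 x t - u t * v2 x t) * cz n t - (u t * v1 x t + w t * v2 x t) * sz n t))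
   with (((e1 t - u t) * v1 x t + (e2 t - w t) * v2 x t) * (- sz n t) + ((e2 t - w t) * v1 x t - (e1 t - u t) * v2 x t) * cz n t) by ring.
  apply bound; [exact ht|rewrite Rabs_Ropp; apply sz_le|apply cz_le|apply m1|apply m2].
Qed.

Hypothesis a0 : 0 < a.
Hypothesis nu0 : 0 <= nu.
Hypothesis nu1 : nu < 1.
Lemma solution_vanish (N0 T : nat) (s : R) : (1 <= T)%nat -> 1 <= s -> 4 * Ce * (4 / INR T + 5 / s) <= a / 4 ->
  (T + 1 <= N0)%nat -> s * s <= IZR (2 * Z.of_nat N0 - 3) ->
  (forall n, (Z.abs n <= Z.of_nat N0)%Z -> VA v1 v2 n 0 = 0 /\ VB v1 v2 n 0 = 0) ->
  forall x t, v1 x t = 0 /\ v2 x t = 0.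
Proof.
intros h1 h2 h3 h4 h5 van. pose proof PI_RGT_0 as pi0.
assert (Ce0 : 0 <= Ce) by (pose proof (hp 0%Z); pose proof (Rabs_pos (p 0%Z)); pose proof (q2_pos 0); nra).
set (K := 2 * Mv * (2 * PI) + 2 * (2 * Me * Mv) * (2 * PI) + 32 * Ce * Mv * (2 * PI)).
assert (k1 : 0 <= Mv * (2 * PI)) by (apply Rmult_le_pos; lra).
assert (k0 : 0 <= Me * (Mv * (2 * PI))) by (apply Rmult_le_pos; [apply Me0|lra]).
assert (k4 : 0 <= Ce * (Mv * (2 * PI))) by (apply Rmult_le_pos; lra).
assert (k2 : 0 <= 2 * (2 * Me * Mv) * (2 * PI)) by lra.
assert (k3 : 0 <= 32 * Ce * Mv * (2 * PI)) by lra.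
assert (all0 : forall n x, VA v1 v2 n x = 0 /\ VB v1 v2 n x = 0).
{ apply (modes_vanish a b nu Ce K a0 nu0 nu1 p q hp hq (VA v1 v2) (VB v1 v2) (VA f1 f2) (VB f1 f2)) with (N0 := N0) (T := T) (s := s); try assumption.
  - apply mode_odeA.
  - apply mode_odeB.
  - intros n x. apply Rle_trans with (2 * Mv * (2 * PI)); [apply J_per_bound; [apply bd1|apply sm1]|unfold K; lra].
  - intros n x. apply Rle_trans with (2 * Mv * (2 * PI)); [apply J_per_bound; [apply bd2|apply sm2]|unfold K; lra].
  - intros n x. apply Rle_trans with (2 * (2 * Me * Mv) * (2 * PI)); [apply J_per_bound; [apply bh1|apply sh1]|unfold K; lra].
  - intros n x. apply Rle_trans with (2 * (2 * Me * Mv) * (2 * PI)); [apply J_per_bound; [apply bh2|apply sh2]|unfold K; lra].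
  - intros T' n x hT. apply Rle_trans with (1 := proj1 (mode_coupling T' n x hT)). unfold Rdiv. apply Rmult_le_compat_r; [|unfold K; lra].
    left; apply Rinv_0_lt_compat; apply lt_0_INR; lia.
  - intros T' n x hT. apply Rle_trans with (1 := proj2 (mode_coupling T' n x hT)). unfold Rdiv. apply Rmult_le_compat_r; [|unfold K; lra].
    left; apply Rinv_0_lt_compat; apply lt_0_INR; lia. }
intros x t. destruct (period_reduce t) as [k hk].
rewrite <- (period_Z R (v1 x) (per1 x) k t), <- (period_Z R (v2 x) (per2 x) k t).
apply (pair_unique (v1 x) (v2 x) Mv); try assumption; try apply sv1; try apply sv2; intros j; apply (all0 j x).
Qed.
End Modes.

(** * Finite-dimensional translation-invariant spaces *)

Section Span.
Variable Y : Type.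
Notation F := (R -> Y -> R).
Implicit Types (u v w : F) (ws : list F).

Definition addm (k : R) v w : F := fun x y => v x y + k * w x y.
Definition zerof : F := fun _ _ => 0.

(** Membership by elimination: adding a multiple of the head must bring [v] into the span of the
    tail. No list of coefficients is manipulated. *)
Fixpoint span ws v : Prop :=
  match ws with
  | [] => forall x y, v x y = 0
  | w :: ws' => exists k, span ws' (addm k v w)
  end.

Lemma fun2_ext v w : (forall x y, v x y = w x y) -> v = w.
Proof. intros h. extensionality x. extensionality y. apply h. Qed.

Section Spanning.
Variable LL : list (F -> R).
(** Induction on the functionals: either the first one vanishes on the space, or some [w] outside
    its kernel is a generator and the others come from the kernel. Linearity is asked on [B] only,
    because the integrals to be used are known to be linear only there. *)
Lemma separated_span (B : F -> Prop) :
  (forall k v w, B v -> B w -> B (addm k v w)) ->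
  (forall l, In l LL -> forall k v w, B v -> B w -> l (addm k v w) = l v + k * l w) ->
  (forall v, B v -> (forall l, In l LL -> l v = 0) -> v = zerof) ->
  exists ws, (forall w, In w ws -> B w) /\ forall v, B v -> span ws v.
Proof.
revert B. induction LL as [|l L IH]; intros B Blin Llin sep.
- exists []. split; [intros w []|]. intros v hv x y. rewrite (sep v hv) by (intros l []). reflexivity.
- destruct (IH (fun v => B v /\ l v = 0)) as [ws [h1 h2]].
  + intros k v w [bv lv] [bw lw]. split; [auto|]. rewrite (Llin l (or_introl eq_refl)) by assumption. rewrite lv, lw. ring.
  + intros l' hl' k v w [bv _] [bw _]. apply Llin; [right|..]; assumption.
  + intros v [bv lv] z. apply sep; [assumption|]. intros l' [<-|hl']; auto.
  + destruct (classic (exists w, B w /\ l w <> 0)) as [[w [bw lw]]|hn].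
    * exists (w :: ws). split; [intros w' [<-|hw']; [assumption|apply h1; assumption]|].
      intros v bv. exists (- (l v / l w)). apply h2. split; [auto|].
      rewrite (Llin l (or_introl eq_refl)) by assumption. field. assumption.
    * exists ws. split; [intros w hw; apply h1; assumption|]. intros v bv. apply h2. split; [assumption|].
      destruct (Req_dec (l v) 0); [assumption|]. exfalso; apply hn; exists v; auto.
Qed.
End Spanning.

Lemma span_map ws w (g : F -> R) v : span (map (fun u => addm (g u) u w) ws) v -> span (w :: ws) v.
Proof.
revert v. induction ws as [|w1 ws IH]; intros v; simpl.
- intros h. exists 0. intros x y. unfold addm. rewrite h. ring.
- intros [k1 h]. destruct (IH _ h) as [k h']. exists (k + k1 * g w1). exists k1.
  replace (addm k1 (addm (k + k1 * g w1) v w) w1) with (addm k (addm k1 v (addm (g w1) w1 w)) w); [exact h'|].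
  apply fun2_ext. intros. unfold addm. ring.
Qed.

(** Pivoting at a point where [w] is nonzero: all functions are corrected to vanish there, which
    leaves no room for a multiple of [w]. *)
Lemma span_reduce ws w px py v : w px py <> 0 -> span (w :: ws) v ->
  span (map (fun u => addm (- (u px py / w px py)) u w) ws) (addm (- (v px py / w px py)) v w).
Proof.
intros hw [k h]. revert v k h. induction ws as [|w1 ws IH]; intros v k h; simpl in *.
- intros x y. pose proof (h x y) as h1. pose proof (h px py) as h2. unfold addm in *.
  replace (v x y) with (- k * w x y) by lra. replace (v px py) with (- k * w px py) by lra. field. assumption.
- destruct h as [k1 h]. exists k1.
  replace (addm k1 (addm (- (v px py / w px py)) v w) (addm (- (w1 px py / w px py)) w1 w)) with
    (addm (- (addm k1 v w1 px py / w px py)) (addm k1 v w1) w).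
  + apply (IH (addm k1 v w1) k). replace (addm k (addm k1 v w1) w) with (addm k1 (addm k v w) w1); [exact h|].
    apply fun2_ext. intros. unfold addm. ring.
  + apply fun2_ext. intros. unfold addm. field. assumption.
Qed.

(** The pivot coefficient of [s i] is read off from a value of [s i], hence converges; the corrected
    functions then lie in a span with one generator fewer. A generator that vanishes identically is
    discarded. *)
Lemma span_closed n : forall ws, length ws = n -> forall (s : nat -> F) u, (forall i, span ws (s i)) ->
  (forall x y, Un_cv (fun i => s i x y) (u x y)) -> span ws u.
Proof.
induction n as [|n IH]; intros [|w ws] len s u hs cv; try discriminate.
- intros x y. apply (UL_sequence (fun i => s i x y)); [apply cv|].
  intros e e0. exists 0%nat. intros m _. rewrite (hs m x y). unfold Rdist. rewrite Rminus_0_r, Rabs_R0. exact e0.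
- assert (len' : length ws = n) by (simpl in len; congruence).
  destruct (classic (exists px py, w px py <> 0)) as [[px [py hw]]|hn].
  + assert (r : span (map (fun v => addm (- (v px py / w px py)) v w) ws) (addm (- (u px py / w px py)) u w)).
    { apply (IH _ ltac:(rewrite length_map; exact len') (fun i => addm (- (s i px py / w px py)) (s i) w)).
      - intros i. apply span_reduce; [assumption|apply hs].
      - intros x y. unfold addm. apply CV_plus; [apply cv|].
        apply (CV_mult (fun i => - (s i px py / w px py)) (fun _ => w x y)).
        + apply (CV_opp (fun i => s i px py / w px py)). apply (CV_mult (fun i => s i px py) (fun _ => / w px py)); [apply cv|].
          intros e e0. exists 0%nat. intros. unfold Rdist. rewrite Rminus_diag, Rabs_R0. exact e0.
        + intros e e0. exists 0%nat. intros. unfold Rdist. rewrite Rminus_diag, Rabs_R0. exact e0. }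
    apply span_map in r. destruct r as [k r]. exists (- (u px py / w px py) + k).
    replace (addm (- (u px py / w px py) + k) u w) with (addm k (addm (- (u px py / w px py)) u w) w); [exact r|].
    apply fun2_ext. intros. unfold addm. ring.
  + assert (w0 : forall x y, w x y = 0).
    { intros x y. destruct (Req_dec (w x y) 0); [assumption|]. exfalso; apply hn; exists x, y; assumption. }
    assert (id : forall k v, addm k v w = v) by (intros; apply fun2_ext; intros; unfold addm; rewrite w0; ring).
    exists 0. rewrite id. apply (IH ws len' s); [|exact cv].
    intros i. destruct (hs i) as [k h]. rewrite id in h. exact h.
Qed.

Fixpoint rsum n (f : nat -> R) := match n with O => 0 | S m => rsum m f + f m end.
Lemma rsum_ext n f g : (forall i, (i < n)%nat -> f i = g i) -> rsum n f = rsum n g.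
Proof. induction n as [|n IH]; intros h; simpl; [reflexivity|]. rewrite IH by (intros; apply h; lia). rewrite h by lia. reflexivity. Qed.

Lemma rsum_plus n f g : rsum n (fun i => f i + g i) = rsum n f + rsum n g.
Proof. induction n as [|n IH]; simpl; [ring|]. rewrite IH. ring. Qed.

Lemma rsum_scal n k f : rsum n (fun i => f i * k) = rsum n f * k.
Proof. induction n as [|n IH]; simpl; [ring|]. rewrite IH. ring. Qed.

Lemma rsum_0 n : rsum n (fun _ => 0) = 0.
Proof. induction n as [|n IH]; simpl; [reflexivity|]. rewrite IH. ring. Qed.

Lemma rsum_app n m f : rsum (n + m) f = rsum n f + rsum m (fun i => f (n + i)%nat).
Proof. induction m as [|m IH]; simpl; [rewrite Nat.add_0_r; ring|]. rewrite Nat.add_succ_r. simpl. rewrite IH. ring. Qed.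

(** A member [s j] in which the generator [w] really occurs is used to eliminate [w] from the later
    members. Applied to the successive derivatives of a function, the relation is a monic
    differential equation. *)
Lemma span_dependent ws : forall s : nat -> F, (forall i, span ws (s i)) ->
  exists n d, forall x y, s n x y = rsum n (fun i => d i * s i x y).
Proof.
induction ws as [|w ws IH]; intros s hs.
- exists 0%nat, (fun _ => 0). intros x y. apply (hs 0%nat).
- set (k := fun i => proj1_sig (constructive_indefinite_description _ (hs i))).
  assert (hk : forall i, span ws (addm (k i) (s i) w)) by (intros i; apply (proj2_sig (constructive_indefinite_description _ (hs i)))).
  destruct (classic (exists j, k j <> 0)) as [[j kj]|hn].
  + destruct (IH (fun i => addm (- (k (j + 1 + i)%nat / k j)) (s (j + 1 + i)%nat) (s j))) as [n [d hd]].
    { intros i. assert (sub : forall ws' v1 v2 c, span ws' v1 -> span ws' v2 -> span ws' (addm c v1 v2)).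
      { induction ws' as [|w' ws' IH']; intros v1 v2 c g1 g2; simpl in *.
        - intros. unfold addm. rewrite g1, g2. ring.
        - destruct g1 as [k1 g1], g2 as [k2 g2]. exists (k1 + c * k2).
          replace (addm (k1 + c * k2) (addm c v1 v2) w') with (addm c (addm k1 v1 w') (addm k2 v2 w')); [apply IH'; assumption|].
          apply fun2_ext; intros; unfold addm; ring. }
      pose proof (sub ws _ _ (- (k (j + 1 + i)%nat / k j)) (hk (j + 1 + i)%nat) (hk j)) as h.
      replace (addm (- (k (j + 1 + i)%nat / k j)) (s (j + 1 + i)%nat) (s j)) with
        (addm (- (k (j + 1 + i)%nat / k j)) (addm (k (j + 1 + i)%nat) (s (j + 1 + i)%nat) w) (addm (k j) (s j) w)); [exact h|].
      apply fun2_ext; intros; unfold addm; field; assumption. }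
    set (kp := fun i => k (j + 1 + i)%nat / k j) in *.
    (* Members before [j] get the coefficient 0, and [s j] collects all the corrections. *)
    exists (j + 1 + n)%nat, (fun i => if lt_dec i j then 0 else if Nat.eq_dec i j then kp n - rsum n (fun i => d i * kp i) else d (i - (j + 1))%nat).
    intros x y. specialize (hd x y). unfold addm in hd. fold (kp n) in hd.
    rewrite (rsum_ext n _ (fun i => d i * s (j + 1 + i)%nat x y + (d i * kp i) * (- s j x y))) in hd by (intros; unfold kp; ring).
    rewrite rsum_plus, rsum_scal in hd.
    set (kd := rsum n (fun i => d i * kp i)) in *. rewrite !rsum_app. simpl rsum. rewrite Nat.add_0_r.
    rewrite (rsum_ext j _ (fun _ => 0)) by (intros i hi; destruct (lt_dec i j); [ring|lia]). rewrite rsum_0.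
    destruct (lt_dec j j); [lia|]. destruct (Nat.eq_dec j j); [|lia].
    rewrite (rsum_ext n _ (fun i => d i * s (j + 1 + i)%nat x y)).
    * lra.
    * intros i _. destruct (lt_dec (j + 1 + i) j); [lia|]. destruct (Nat.eq_dec (j + 1 + i) j); [lia|].
      replace (j + 1 + i - (j + 1))%nat with i by lia. reflexivity.
  + apply IH. intros i. specialize (hk i).
    replace (k i) with 0 in hk by (destruct (Req_dec (k i) 0); [auto|exfalso; apply hn; exists i; assumption]).
    replace (s i) with (addm 0 (s i) w); [exact hk|]. apply fun2_ext; intros; unfold addm; ring.
Qed.
End Span.
Arguments addm {Y}. Arguments zerof {Y}. Arguments span {Y}.

(* The product of the operators [S - z], [z] in [zs], on complex sequences [s1 + i s2], with [S] the shift. *)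
Definition cplx := (R * R)%type.
Fixpoint opr (zs : list cplx) (s1 s2 : nat -> R) : cplx :=
  match zs with
  | [] => (s1 0%nat, s2 0%nat)
  | z :: zs' => opr zs' (fun j => s1 (S j) - (fst z * s1 j - snd z * s2 j)) (fun j => s2 (S j) - (fst z * s2 j + snd z * s1 j))
  end.

(** In the direction where the exponential decays, multiplying by [x] gives a bound free of
    exponentials; comparing [x] with [2 x] isolates the slope [q]. *)
Lemma bounded_growth p q M rho : rho <> 0 -> (forall x, Rabs (p + x * q) <= M * exp (- rho * x)) -> p = 0 /\ q = 0.
Proof.
intros r0 h.
assert (pos : forall p q M rho, 0 < rho -> (forall x, Rabs (p + x * q) <= M * exp (- rho * x)) -> p = 0 /\ q = 0).
{ clear. intros p q M rho r0 h.
  assert (M0 : 0 <= M). { pose proof (h 0) as h0. rewrite Rmult_0_r, exp_0 in h0. pose proof (Rabs_pos (p + 0 * q)). lra. }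
  assert (b : forall x, 0 < x -> Rabs (p + x * q) * x <= M / rho).
  { intros x x0. apply Rle_trans with (M * exp (- rho * x) * x); [apply Rmult_le_compat_r; [lra|apply h]|].
    pose proof (exp_ineq1_le (rho * x)) as e1. pose proof (exp_pos (- rho * x)) as e2.
    assert (e3 : exp (- rho * x) * exp (rho * x) = 1) by (rewrite <- exp_plus; replace (- rho * x + rho * x) with 0 by ring; apply exp_0).
    assert (rx : 0 < rho * x) by (apply Rmult_lt_0_compat; assumption).
    assert (e4 : exp (- rho * x) * (rho * x) <= 1) by nra.
    replace (M / rho) with (M * (1 / rho)) by (field; lra). rewrite Rmult_assoc. apply Rmult_le_compat_l; [assumption|].
    apply (Rmult_le_reg_r rho); [assumption|]. replace (1 / rho * rho) with 1 by (field; lra). lra. }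
  assert (K0 : 0 <= M / rho) by (unfold Rdiv; apply Rmult_le_pos; [assumption|left; apply Rinv_0_lt_compat; assumption]).
  assert (small : forall z K, 0 <= K -> (forall x, 0 < x -> Rabs z * x <= K) -> z = 0).
  { intros z K k0 hz. destruct (Req_dec z 0) as [|zn]; [assumption|exfalso]. pose proof (Rabs_pos_lt z zn) as za.
    pose proof (hz ((K + 1) / Rabs z) ltac:(apply Rdiv_lt_0_compat; lra)) as g.
    replace (Rabs z * ((K + 1) / Rabs z)) with (K + 1) in g by (field; lra). lra. }
  assert (q0 : q = 0).
  { apply (small q (2 * (M / rho) + 0)); [lra|]. intros x x0.
    destruct (Rle_lt_dec x 1) as [x1|x1].
    - pose proof (b 1 ltac:(lra)) as b1. pose proof (b 2 ltac:(lra)) as b2.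
      assert (t : Rabs q <= Rabs (p + 2 * q) + Rabs (p + 1 * q)).
      { replace q with ((p + 2 * q) + - (p + 1 * q)) at 1 by ring. apply Rle_trans with (1 := Rabs_triang _ _). rewrite Rabs_Ropp. lra. }
      pose proof (Rabs_pos q). pose proof (Rabs_pos (p + 2 * q)). nra.
    - pose proof (b x x0) as b1. pose proof (b (2 * x) ltac:(lra)) as b2.
      assert (t : Rabs (x * q) <= Rabs (p + 2 * x * q) + Rabs (p + x * q)).
      { replace (x * q) with ((p + 2 * x * q) + - (p + x * q)) at 1 by ring. apply Rle_trans with (1 := Rabs_triang _ _). rewrite Rabs_Ropp. lra. }
      rewrite Rabs_mult, (Rabs_pos_eq x) in t by lra.
      pose proof (Rabs_pos (p + 2 * x * q)). pose proof (Rabs_pos (p + x * q)). nra. }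
  split; [|assumption]. apply (small p (M / rho) K0). intros x x0. pose proof (b x x0) as bx. rewrite q0, Rmult_0_r, Rplus_0_r in bx. exact bx. }
destruct (Rlt_le_dec 0 rho) as [r1|r1]; [apply (pos p q M rho); assumption|].
destruct (pos p (- q) M (- rho)) as [h1 h2]; [lra| |split; lra].
intros x. replace (p + x * - q) with (p + (- x) * q) by ring. replace (- - rho * x) with (- rho * - x) by ring. apply h.
Qed.

Lemma deriv0_const f : (forall x, derivable_pt_lim f x 0) -> forall x, f x = f 0.
Proof.
intros d x. assert (pr : derivable f) by (intros y; exists 0; apply d).
apply (null_derivative_1 f pr). intros y. apply derive_pt_eq_0. apply d.
Qed.

(** * Factorisation of a linear recurrence over the complex numbers *)

Module Split.
Import all_boot all_order all_algebra complex Rstruct.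
Import GRing.Theory Num.Theory.
Local Open Scope ring_scope.
Notation C := (complex R).
Definition to_complex (z : cplx) : C := Complex (fst z) (snd z).
(** The polynomial evaluated at the shift, applied to the sequence [f] and read at index 0. *)
Definition apply_poly (p : {poly C}) (f : nat -> C) : C := \sum_(i < size p) p`_i * f i.
Lemma apply_polyE (p : {poly C}) f n : (size p <= n)%N -> apply_poly p f = \sum_(i < n) p`_i * f i.
Proof.
move=> le; rewrite /apply_poly (big_ord_widen n (fun i => p`_i * f i) le) big_mkcond /=.
apply: eq_bigr => i _; case: ltnP => // h; by rewrite nth_default ?mul0r.
Qed.

Lemma apply_poly_XsubC (z : C) (q : {poly C}) f : apply_poly (('X - z%:P) * q) f = apply_poly q (fun j => f j.+1 - z * f j).
Proof.
have s1 : (size (('X - z%:P) * q)%R <= (size q).+1)%N.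
  by apply: leq_trans (size_polyMleq _ _) _; rewrite size_XsubC.
rewrite (apply_polyE _ _ _ s1) (apply_polyE q _ _ (leqnn _)).
under eq_bigr => i _ do rewrite mulrBl coefB mulrBl.
rewrite big_split /= big_ord_recl coefXM eqxx mul0r add0r.
rewrite big_ord_recr /= coefCM (nth_default 0 (leqnn (size q))) mulr0 mul0r oppr0 addr0 -big_split /=.
apply: eq_bigr => i _. by rewrite coefXM coefCM /= mulrBr mulrCA mulrA.
Qed.

Lemma opr_apply_poly zs s1 s2 : to_complex (opr zs s1 s2) = apply_poly (\prod_(z <- zs) ('X - (to_complex z)%:P)) (fun j => to_complex (s1 j, s2 j)).
Proof.
elim: zs s1 s2 => [|z zs IH] s1 s2.
  by rewrite big_nil /apply_poly size_poly1 big_ord1 coef1 mul1r.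
rewrite big_cons apply_poly_XsubC /= IH; congr (apply_poly _ _).
Qed.

(** The list consists of the complex roots of [X^n - sum d_i X^i]. It depends on the relation only
    and not on the sequence, so one list serves all points at which the derivatives of a function
    are taken. *)
Lemma split_roots (n : nat) (d : nat -> R) : exists zs : list cplx, forall s : nat -> R,
  s n = rsum n (fun i => Rmult (d i) (s i)) -> opr zs s (fun _ => IZR 0) = (IZR 0, IZR 0).
Proof.
pose p : {poly C} := 'X^n - \poly_(i < n) (to_complex (d i, IZR 0)).
have sq : (size (- \poly_(i < n) to_complex (d i, IZR 0))%R < size ('X^n : {poly C}))%N.
  by rewrite size_polyN size_polyXn ltnS size_poly.
have sp : size p = n.+1 by rewrite size_polyDl // size_polyXn.
have lp : lead_coef p = 1 by rewrite lead_coefDl // lead_coefXn.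
have [rs prs] := closed_field_poly_normal p.
rewrite lp scale1r in prs.
exists [seq (complex.Re z, complex.Im z) | z <- rs] => s hs.
have e : to_complex (opr [seq (complex.Re z, complex.Im z) | z <- rs] s (fun _ => IZR 0)) = 0.
  rewrite opr_apply_poly big_map.
  have -> : \prod_(j <- rs) ('X - (to_complex (complex.Re j, complex.Im j))%:P) = p.
    by rewrite prs; apply: eq_bigr => z _; case: z.
  rewrite (apply_polyE p _ n.+1) ?sp // big_ord_recr /= coefB coefXn eqxx coef_poly ltnn subr0 mul1r hs.
  have tcD x y : to_complex (x + y, 0) = to_complex (x, 0) + to_complex (y, 0).
    by apply/eqP; rewrite eq_complex /= addr0 !eqxx.
  have tcM x y : to_complex (x * y, 0) = to_complex (x, 0) * to_complex (y, 0).
    by apply/eqP; rewrite eq_complex /= !mul0r !mulr0 subr0 addr0 !eqxx.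
  have tcs m : to_complex (rsum m (fun i => Rmult (d i) (s i)), 0) = \sum_(i < m) to_complex (d i, 0) * to_complex (s i, 0).
    elim: m => [|m IH]; first by rewrite big_ord0.
    by rewrite big_ord_recr /= -IH -tcM; exact: tcD.
  rewrite (_ : IZR 0 = 0) // tcs -big_split /= big1 // => i _.
  by rewrite coefB coefXn coef_poly ltn_ord eqn_leq (leqNgt n) ltn_ord andbF sub0r mulNr addNr.
by case: (opr _ _ _) e => x y [-> ->].
Qed.
End Split.

Lemma derivable_pt_lim_eq f x l l' : l = l' -> derivable_pt_lim f x l -> derivable_pt_lim f x l'.
Proof. intros ->. tauto. Qed.

(** The real form of an integrating factor: if [f' = z f + k] with [f = f1 + i f2], then
    [exp (- z x) f] has derivative [exp (- z x) k]. *)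
Lemma deriv_rot z1 z2 f1 f2 k1 k2 x :
  derivable_pt_lim f1 x (z1 * f1 x - z2 * f2 x + k1) -> derivable_pt_lim f2 x (z1 * f2 x + z2 * f1 x + k2) ->
  derivable_pt_lim (fun x => exp (- z1 * x) * (cos (z2 * x) * f1 x + sin (z2 * x) * f2 x)) x
    (exp (- z1 * x) * (cos (z2 * x) * k1 + sin (z2 * x) * k2)) /\
  derivable_pt_lim (fun x => exp (- z1 * x) * (cos (z2 * x) * f2 x - sin (z2 * x) * f1 x)) x
    (exp (- z1 * x) * (cos (z2 * x) * k2 - sin (z2 * x) * k1)).
Proof.
intros d1 d2.
assert (lin : forall c, derivable_pt_lim (fun x => c * x) x c).
{ intros c. apply (derivable_pt_lim_eq _ _ (c * 1)); [ring|]. apply (derivable_pt_lim_scal (fun x => x)). apply derivable_pt_lim_id. }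
assert (de : derivable_pt_lim (fun x => exp (- z1 * x)) x (exp (- z1 * x) * - z1)).
{ apply (derivable_pt_lim_comp (fun x => - z1 * x) exp); [apply lin|apply derivable_pt_lim_exp]. }
assert (dc : derivable_pt_lim (fun x => cos (z2 * x)) x (- sin (z2 * x) * z2)).
{ apply (derivable_pt_lim_comp (fun x => z2 * x) cos); [apply lin|apply derivable_pt_lim_cos]. }
assert (ds : derivable_pt_lim (fun x => sin (z2 * x)) x (cos (z2 * x) * z2)).
{ apply (derivable_pt_lim_comp (fun x => z2 * x) sin); [apply lin|apply derivable_pt_lim_sin]. }
split.
- replace (exp (- z1 * x) * (cos (z2 * x) * k1 + sin (z2 * x) * k2)) with
    (exp (- z1 * x) * - z1 * (cos (z2 * x) * f1 x + sin (z2 * x) * f2 x) + exp (- z1 * x) *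
     ((- sin (z2 * x) * z2 * f1 x + cos (z2 * x) * (z1 * f1 x - z2 * f2 x + k1)) + (cos (z2 * x) * z2 * f2 x + sin (z2 * x) * (z1 * f2 x + z2 * f1 x + k2)))) by ring.
  apply (derivable_pt_lim_mult (fun x => exp (- z1 * x)) (fun x => cos (z2 * x) * f1 x + sin (z2 * x) * f2 x)); [exact de|].
  apply (derivable_pt_lim_plus (fun x => cos (z2 * x) * f1 x) (fun x => sin (z2 * x) * f2 x)).
  + apply (derivable_pt_lim_mult (fun x => cos (z2 * x)) f1); assumption.
  + apply (derivable_pt_lim_mult (fun x => sin (z2 * x)) f2); assumption.
- replace (exp (- z1 * x) * (cos (z2 * x) * k2 - sin (z2 * x) * k1)) with
    (exp (- z1 * x) * - z1 * (cos (z2 * x) * f2 x - sin (z2 * x) * f1 x) + exp (- z1 * x) *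
     ((- sin (z2 * x) * z2 * f2 x + cos (z2 * x) * (z1 * f2 x + z2 * f1 x + k2)) - (cos (z2 * x) * z2 * f1 x + sin (z2 * x) * (z1 * f1 x - z2 * f2 x + k1)))) by ring.
  apply (derivable_pt_lim_mult (fun x => exp (- z1 * x)) (fun x => cos (z2 * x) * f2 x - sin (z2 * x) * f1 x)); [exact de|].
  apply (derivable_pt_lim_minus (fun x => cos (z2 * x) * f2 x) (fun x => sin (z2 * x) * f1 x)).
  + apply (derivable_pt_lim_mult (fun x => cos (z2 * x)) f2); assumption.
  + apply (derivable_pt_lim_mult (fun x => sin (z2 * x)) f1); assumption.
Qed.

Lemma rot_zero z1 z2 f1 f2 x : exp (- z1 * x) * (cos (z2 * x) * f1 + sin (z2 * x) * f2) = 0 ->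
  exp (- z1 * x) * (cos (z2 * x) * f2 - sin (z2 * x) * f1) = 0 -> f1 = 0 /\ f2 = 0.
Proof.
intros h1 h2. pose proof (exp_pos (- z1 * x)) as e0. pose proof (sin2_cos2 (z2 * x)) as sc. unfold Rsqr in sc.
apply Rmult_integral in h1. apply Rmult_integral in h2. destruct h1 as [h1|h1]; [lra|]. destruct h2 as [h2|h2]; [lra|].
set (c := cos (z2 * x)) in *. set (s := sin (z2 * x)) in *.
split; [replace f1 with ((s * s + c * c) * f1) by (rewrite sc; ring)|replace f2 with ((s * s + c * c) * f2) by (rewrite sc; ring)].
- replace ((s * s + c * c) * f1) with (c * (c * f1 + s * f2) - s * (c * f2 - s * f1)) by ring. rewrite h1, h2. ring.
- replace ((s * s + c * c) * f2) with (s * (c * f1 + s * f2) + c * (c * f2 - s * f1)) by ring. rewrite h1, h2. ring.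
Qed.

Lemma bounded_line p q M : (forall x, Rabs (p + x * q) <= M) -> q = 0.
Proof.
intros h. destruct (Req_dec q 0) as [|qn]; [assumption|exfalso].
pose proof (h ((M + 1 - p) / q)) as h1. replace (p + (M + 1 - p) / q * q) with (M + 1) in h1 by (field; assumption).
pose proof (Rle_abs (M + 1)). lra.
Qed.

Section Eigen.
(* [g' = z g + k], [k' = z k] with [g] bounded: [g = exp (z x) (g 0 + x k 0)] *)
Variables z1 z2 M : R.
Variables f1 f2 k1 k2 : R -> R.
Hypothesis df1 : forall x, derivable_pt_lim f1 x (z1 * f1 x - z2 * f2 x + k1 x).
Hypothesis df2 : forall x, derivable_pt_lim f2 x (z1 * f2 x + z2 * f1 x + k2 x).
Hypothesis dk1 : forall x, derivable_pt_lim k1 x (z1 * k1 x - z2 * k2 x).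
Hypothesis dk2 : forall x, derivable_pt_lim k2 x (z1 * k2 x + z2 * k1 x).
Hypothesis m1 : forall x, Rabs (f1 x) <= M.
Hypothesis m2 : forall x, Rabs (f2 x) <= M.

Lemma rot_const : forall x, exp (- z1 * x) * (cos (z2 * x) * k1 x + sin (z2 * x) * k2 x) = k1 0 /\
  exp (- z1 * x) * (cos (z2 * x) * k2 x - sin (z2 * x) * k1 x) = k2 0.
Proof.
intros x. split.
- rewrite (deriv0_const (fun x => exp (- z1 * x) * (cos (z2 * x) * k1 x + sin (z2 * x) * k2 x))).
  + rewrite !Rmult_0_r, exp_0, cos_0, sin_0. ring.
  + intros y. destruct (deriv_rot z1 z2 k1 k2 0 0 y) as [h _]; [rewrite Rplus_0_r; apply dk1|rewrite Rplus_0_r; apply dk2|].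
    rewrite !Rmult_0_r, Rplus_0_r, Rmult_0_r in h. exact h.
- rewrite (deriv0_const (fun x => exp (- z1 * x) * (cos (z2 * x) * k2 x - sin (z2 * x) * k1 x))).
  + rewrite !Rmult_0_r, exp_0, cos_0, sin_0. ring.
  + intros y. destruct (deriv_rot z1 z2 k1 k2 0 0 y) as [_ h]; [rewrite Rplus_0_r; apply dk1|rewrite Rplus_0_r; apply dk2|].
    rewrite !Rmult_0_r, Rminus_0_r, Rmult_0_r in h. exact h.
Qed.

Lemma rot_affine : forall x, exp (- z1 * x) * (cos (z2 * x) * f1 x + sin (z2 * x) * f2 x) = f1 0 + x * k1 0 /\
  exp (- z1 * x) * (cos (z2 * x) * f2 x - sin (z2 * x) * f1 x) = f2 0 + x * k2 0.
Proof.
assert (dl : forall K y, derivable_pt_lim (fun x => x * K) y K).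
{ intros K y. pose proof (derivable_pt_lim_mult (fun x => x) (fun _ => K) y 1 0 (derivable_pt_lim_id y) (derivable_pt_lim_const K y)) as h.
  cbv beta in h. replace (1 * K + y * 0) with K in h by ring. exact h. }
intros x. split.
- pose proof (deriv0_const (fun x => exp (- z1 * x) * (cos (z2 * x) * f1 x + sin (z2 * x) * f2 x) - x * k1 0)) as h.
  cbv beta in h. rewrite !Rmult_0_r, exp_0, cos_0, sin_0 in h. specialize (fun g => h g x).
  assert (g : forall y, derivable_pt_lim (fun x => exp (- z1 * x) * (cos (z2 * x) * f1 x + sin (z2 * x) * f2 x) - x * k1 0) y 0).
  { intros y. apply (derivable_pt_lim_eq _ _ (exp (- z1 * y) * (cos (z2 * y) * k1 y + sin (z2 * y) * k2 y) - k1 0)); [rewrite (proj1 (rot_const y)); ring|].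
    apply (derivable_pt_lim_minus (fun x => exp (- z1 * x) * (cos (z2 * x) * f1 x + sin (z2 * x) * f2 x)) (fun x => x * k1 0)); [|apply dl].
    apply (proj1 (deriv_rot z1 z2 f1 f2 (k1 y) (k2 y) y (df1 y) (df2 y))). }
  specialize (h g). lra.
- pose proof (deriv0_const (fun x => exp (- z1 * x) * (cos (z2 * x) * f2 x - sin (z2 * x) * f1 x) - x * k2 0)) as h.
  cbv beta in h. rewrite !Rmult_0_r, exp_0, cos_0, sin_0 in h. specialize (fun g => h g x).
  assert (g : forall y, derivable_pt_lim (fun x => exp (- z1 * x) * (cos (z2 * x) * f2 x - sin (z2 * x) * f1 x) - x * k2 0) y 0).
  { intros y. apply (derivable_pt_lim_eq _ _ (exp (- z1 * y) * (cos (z2 * y) * k2 y - sin (z2 * y) * k1 y) - k2 0)); [rewrite (proj2 (rot_const y)); ring|].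
    apply (derivable_pt_lim_minus (fun x => exp (- z1 * x) * (cos (z2 * x) * f2 x - sin (z2 * x) * f1 x)) (fun x => x * k2 0)); [|apply dl].
    apply (proj2 (deriv_rot z1 z2 f1 f2 (k1 y) (k2 y) y (df1 y) (df2 y))). }
  specialize (h g). lra.
Qed.

Lemma rot_bound x : Rabs (f1 0 + x * k1 0) <= 2 * M * exp (- z1 * x) /\ Rabs (f2 0 + x * k2 0) <= 2 * M * exp (- z1 * x).
Proof.
destruct (rot_affine x) as [h1 h2]. rewrite <- h1, <- h2. pose proof (exp_pos (- z1 * x)) as e0.
assert (cs : forall c s g h, Rabs c <= 1 -> Rabs s <= 1 -> Rabs g <= M -> Rabs h <= M -> Rabs (exp (- z1 * x) * (c * g + s * h)) <= 2 * M * exp (- z1 * x)).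
{ intros c s g h hc hs hg hh. rewrite Rabs_mult, (Rabs_pos_eq (exp _)) by lra. rewrite (Rmult_comm (2 * M)).
  apply Rmult_le_compat_l; [lra|]. apply Rle_trans with (1 := Rabs_triang _ _). rewrite !Rabs_mult.
  assert (t : forall c g, Rabs c <= 1 -> Rabs g <= M -> Rabs c * Rabs g <= M).
  { intros c' g' hc' hg'. pose proof (Rabs_pos g'). replace M with (1 * M) by ring. apply Rmult_le_compat; try apply Rabs_pos; assumption. }
  pose proof (t c g hc hg). pose proof (t s h hs hh). lra. }
assert (cb : Rabs (cos (z2 * x)) <= 1) by (apply Rabs_le; pose proof (COS_bound (z2 * x)); lra).
assert (sb : Rabs (sin (z2 * x)) <= 1) by (apply Rabs_le; pose proof (SIN_bound (z2 * x)); lra).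
split; [apply cs; auto|].
replace (cos (z2 * x) * f2 x - sin (z2 * x) * f1 x) with (cos (z2 * x) * f2 x + (- sin (z2 * x)) * f1 x) by ring.
apply cs; auto. rewrite Rabs_Ropp. assumption.
Qed.

(** [exp (- z x) f] is affine, and [f] is bounded, so this affine function is dominated by an
    exponential that decays on one side. *)
Lemma eigen_real : z1 <> 0 -> forall x, f1 x = 0 /\ f2 x = 0.
Proof.
intros z0 x.
destruct (bounded_growth (f1 0) (k1 0) (2 * M) z1 z0) as [a1 a2]; [intros; apply rot_bound|].
destruct (bounded_growth (f2 0) (k2 0) (2 * M) z1 z0) as [b1 b2]; [intros; apply rot_bound|].
destruct (rot_affine x) as [h1 h2]. rewrite a1, a2 in h1. rewrite b1, b2 in h2.
apply (rot_zero z1 z2 (f1 x) (f2 x) x); [rewrite h1|rewrite h2]; ring.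
Qed.

(** The factor [exp (- z x)] now has modulus 1: the affine function is bounded on the line, hence
    has slope 0. *)
Lemma eigen_imag : z1 = 0 -> forall x, k1 x = 0 /\ k2 x = 0.
Proof.
intros z0 x. assert (eb : forall x, 2 * M * exp (- z1 * x) = 2 * M).
{ intros y. rewrite z0. replace (- 0 * y) with 0 by ring. rewrite exp_0. ring. }
assert (a2 : k1 0 = 0). { apply (bounded_line (f1 0) (k1 0) (2 * M)). intros y. rewrite <- (eb y). apply rot_bound. }
assert (b2 : k2 0 = 0). { apply (bounded_line (f2 0) (k2 0) (2 * M)). intros y. rewrite <- (eb y). apply rot_bound. }
destruct (rot_const x) as [h1 h2]. rewrite a2 in h1. rewrite b2 in h2. apply (rot_zero z1 z2 (k1 x) (k2 x) x); assumption.
Qed.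
End Eigen.

(** * Spectral decomposition of the derivative on the space *)

Section Decomposition.
Variable Y : Type.
Notation F := (R -> Y -> R).
Variable B : F -> Prop.
Hypothesis B0 : B zerof.
Hypothesis Blin : forall k v w, B v -> B w -> B (addm k v w).
Hypothesis Bshift : forall h v, B v -> B (fun x y => v (x + h) y).
Hypothesis Bder : forall v, B v -> forall x y, exists d, derivable_pt_lim (fun x => v x y) x d.
Hypothesis Bbd : forall v, B v -> exists M, forall x y, Rabs (v x y) <= M.
Variable ws : list F.
Hypothesis wsB : forall w, In w ws -> B w.
Hypothesis Bws : forall v, B v -> span ws v.

Lemma span_B l v : (forall w, In w l -> B w) -> span l v -> B v.
Proof.
revert v. induction l as [|w l IH]; intros v hl; simpl.
- intros z. replace v with (@zerof Y); [exact B0|]. apply fun2_ext. intros. symmetry. apply z.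
- intros [k h]. replace v with (addm (- k) (addm k v w) w); [|apply fun2_ext; intros; unfold addm; ring].
  apply Blin; [apply IH; [intros; apply hl; right; assumption|exact h]|apply hl; left; reflexivity].
Qed.

(** A total operator obtained by choice; members of [B] are differentiable in [x], and for them it
    is the derivative. *)
Definition D (v : F) : F := fun x y => epsilon (inhabits 0) (fun l => derivable_pt_lim (fun x => v x y) x l).
Lemma D_spec v : B v -> forall x y, derivable_pt_lim (fun x => v x y) x (D v x y).
Proof. intros bv x y. unfold D. apply epsilon_spec. apply Bder. exact bv. Qed.

Lemma D_uniq v d : B v -> (forall x y, derivable_pt_lim (fun x => v x y) x (d x y)) -> D v = d.
Proof. intros bv h. apply fun2_ext. intros x y. apply (uniqueness_limite (fun x => v x y) x); [apply D_spec; assumption|apply h]. Qed.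

Lemma D_lin k v w : B v -> B w -> D (addm k v w) = addm k (D v) (D w).
Proof.
intros bv bw. apply D_uniq; [apply Blin; assumption|]. intros x y. unfold addm.
apply (derivable_pt_lim_plus (fun x => v x y) (fun x => k * w x y)); [apply D_spec; assumption|].
apply (derivable_pt_lim_scal (fun x => w x y)). apply D_spec; assumption.
Qed.

Lemma D_0 : D zerof = zerof.
Proof. apply D_uniq; [exact B0|]. intros x y. apply derivable_pt_lim_const. Qed.

(** The difference quotients with steps [/ (i + 1)] are combinations of translates of [v], hence in
    the span of [ws], which is closed under pointwise limits. *)
Lemma D_B v : B v -> B (D v).
Proof.
intros bv. apply (span_B ws); [exact wsB|].
apply (span_closed Y (length ws) ws eq_refl (fun i => addm (INR i + 1) zerof (addm (-1) (fun x y => v (x + / (INR i + 1)) y) v))).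
- intros i. apply Bws. apply Blin; [exact B0|]. apply Blin; [apply Bshift|]; exact bv.
- intros x y. unfold addm, zerof. apply Un_cv_ext with (fun i => (v (x + / (INR i + 1)) y - v x y) / / (INR i + 1)).
  + intros i. pose proof (pos_INR i). field. lra.
  + intros e e0. destruct (D_spec v bv x y e e0) as [[d d0] hd]. simpl in hd.
    destruct (Un_cv_inv d d0) as [N hN]. exists N. intros n hn. specialize (hN n hn). unfold Rdist in *. rewrite Rminus_0_r in hN.
    pose proof (pos_INR n). apply hd; [|exact hN]. apply Rinv_neq_0_compat. lra.
Qed.

(** The pair stands for [h1 + i h2] in the complexification of [B], with [D] acting as
    multiplication by [i tau]. *)
Definition eig (tau : R) (h1 h2 : F) := B h1 /\ B h2 /\ (forall x y, D h1 x y = - tau * h2 x y) /\ (forall x y, D h2 x y = tau * h1 x y).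
Inductive dec : F -> F -> Prop :=
| dec_nil : dec zerof zerof
| dec_cons tau h1 h2 f1 f2 : eig tau h1 h2 -> dec f1 f2 -> dec (addm 1 f1 h1) (addm 1 f2 h2).

(** [f1 + i f2] is a generalised eigenvector of order two. If [z1] is nonzero, boundedness kills it;
    if [z1 = 0], boundedness kills [k] and leaves a true eigenvector. *)
Lemma eigen_decomposed z1 z2 f1 f2 k1 k2 : B f1 -> B f2 -> B k1 -> B k2 ->
  (forall x y, D f1 x y = z1 * f1 x y - z2 * f2 x y + k1 x y) -> (forall x y, D f2 x y = z1 * f2 x y + z2 * f1 x y + k2 x y) ->
  (forall x y, D k1 x y = z1 * k1 x y - z2 * k2 x y) -> (forall x y, D k2 x y = z1 * k2 x y + z2 * k1 x y) -> dec f1 f2.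
Proof.
intros bf1 bf2 bk1 bk2 e1 e2 e3 e4. destruct (Bbd f1 bf1) as [M1 hM1]. destruct (Bbd f2 bf2) as [M2 hM2].
assert (A1 : forall y x, derivable_pt_lim (fun x => f1 x y) x (z1 * f1 x y - z2 * f2 x y + k1 x y)) by (intros; rewrite <- e1; apply D_spec; assumption).
assert (A2 : forall y x, derivable_pt_lim (fun x => f2 x y) x (z1 * f2 x y + z2 * f1 x y + k2 x y)) by (intros; rewrite <- e2; apply D_spec; assumption).
assert (A3 : forall y x, derivable_pt_lim (fun x => k1 x y) x (z1 * k1 x y - z2 * k2 x y)) by (intros; rewrite <- e3; apply D_spec; assumption).
assert (A4 : forall y x, derivable_pt_lim (fun x => k2 x y) x (z1 * k2 x y + z2 * k1 x y)) by (intros; rewrite <- e4; apply D_spec; assumption).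
assert (L1 : forall x y, Rabs (f1 x y) <= Rmax M1 M2) by (intros; apply Rle_trans with M1; [apply hM1|apply Rmax_l]).
assert (L2 : forall x y, Rabs (f2 x y) <= Rmax M1 M2) by (intros; apply Rle_trans with M2; [apply hM2|apply Rmax_r]).
destruct (Req_dec z1 0) as [zz|zz].
- assert (kz : forall x y, k1 x y = 0 /\ k2 x y = 0).
  { intros x y. apply (eigen_imag z1 z2 (Rmax M1 M2) (fun x => f1 x y) (fun x => f2 x y) (fun x => k1 x y) (fun x => k2 x y)); auto. }
  replace f1 with (addm 1 zerof f1) by (apply fun2_ext; intros; unfold addm, zerof; ring).
  replace f2 with (addm 1 zerof f2) by (apply fun2_ext; intros; unfold addm, zerof; ring).
  apply (dec_cons z2); [|apply dec_nil]. split; [assumption|]. split; [assumption|].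
  split; intros x y; [rewrite e1|rewrite e2]; destruct (kz x y) as [q1 q2]; [rewrite q1|rewrite q2]; rewrite zz; ring.
- assert (fz : forall x y, f1 x y = 0 /\ f2 x y = 0).
  { intros x y. apply (eigen_real z1 z2 (Rmax M1 M2) (fun x => f1 x y) (fun x => f2 x y) (fun x => k1 x y) (fun x => k2 x y)); auto. }
  replace f1 with (@zerof Y) by (apply fun2_ext; intros; symmetry; apply fz).
  replace f2 with (@zerof Y) by (apply fun2_ext; intros; symmetry; apply fz). apply dec_nil.
Qed.

(* Resolution of [(D - z) f = k + g] for [g] a sum of imaginary eigenvectors: those with eigenvalue [z] are collected in [k], the others are inverted. *)
Lemma dec_resolve z1 z2 g1 g2 : dec g1 g2 -> forall f1 f2 k1 k2, B f1 -> B f2 -> B k1 -> B k2 ->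
  (forall x y, D f1 x y = z1 * f1 x y - z2 * f2 x y + k1 x y + g1 x y) -> (forall x y, D f2 x y = z1 * f2 x y + z2 * f1 x y + k2 x y + g2 x y) ->
  (forall x y, D k1 x y = z1 * k1 x y - z2 * k2 x y) -> (forall x y, D k2 x y = z1 * k2 x y + z2 * k1 x y) -> dec f1 f2.
Proof.
induction 1 as [|tau h1 h2 g1 g2 [bh1 [bh2 [eh1 eh2]]] dg IH]; intros f1 f2 k1 k2 bf1 bf2 bk1 bk2 e1 e2 e3 e4.
- apply (eigen_decomposed z1 z2 f1 f2 k1 k2); auto; intros; [rewrite e1|rewrite e2]; unfold zerof; ring.
- destruct (classic (z1 = 0 /\ z2 = tau)) as [[zz1 zz2]|hn].
  + apply (IH f1 f2 (addm 1 k1 h1) (addm 1 k2 h2)); auto.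
    * intros. rewrite e1. unfold addm. ring.
    * intros. rewrite e2. unfold addm. ring.
    * intros. rewrite D_lin by assumption. unfold addm. rewrite e3, eh1, zz1, zz2. ring.
    * intros. rewrite D_lin by assumption. unfold addm. rewrite e4, eh2, zz1, zz2. ring.
  + set (N := z1 * z1 + (tau - z2) * (tau - z2)).
    assert (N0 : N <> 0). { unfold N. intros E. apply hn. apply Rplus_sqr_eq_0 in E. lra. }
    (* [al + i be] is [1 / (i tau - z)], so that [m = (al + i be) (h1 + i h2)] solves
       [(D - z) m = h]. *)
    set (al := - z1 / N). set (be := - (tau - z2) / N).
    set (m1 := addm (- be) (addm al zerof h1) h2). set (m2 := addm be (addm al zerof h2) h1).
    assert (bm1 : B m1) by (apply Blin; [apply Blin|]; assumption).
    assert (bm2 : B m2) by (apply Blin; [apply Blin|]; assumption).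
    assert (dm1 : forall x y, D m1 x y = - tau * m2 x y).
    { intros. unfold m1, m2. rewrite !D_lin, D_0 by (try apply Blin; assumption). unfold addm, zerof. rewrite eh1, eh2. ring. }
    assert (dm2 : forall x y, D m2 x y = tau * m1 x y).
    { intros. unfold m1, m2. rewrite !D_lin, D_0 by (try apply Blin; assumption). unfold addm, zerof. rewrite eh1, eh2. ring. }
    replace f1 with (addm 1 (addm (-1) f1 m1) m1) by (apply fun2_ext; intros; unfold addm; ring).
    replace f2 with (addm 1 (addm (-1) f2 m2) m2) by (apply fun2_ext; intros; unfold addm; ring).
    apply (dec_cons tau); [repeat split; assumption|].
    apply (IH _ _ k1 k2); auto.
    * intros. rewrite D_lin by assumption. unfold addm at 1 2. rewrite e1, dm1. unfold m1, m2, addm, zerof, al, be. unfold N in *. field. assumption.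
    * intros. rewrite D_lin by assumption. unfold addm at 1 2. rewrite e2, dm2. unfold m1, m2, addm, zerof, al, be. unfold N in *. field. assumption.
Qed.

Definition jet (v : F) j : F := Nat.iter j D v.
Lemma jet_B v j : B v -> B (jet v j).
Proof. intros bv. induction j; [exact bv|apply D_B; assumption]. Qed.

Lemma jet_S v j : jet (D v) j = jet v (S j).
Proof. induction j as [|j IH]; [reflexivity|]. unfold jet in *. simpl in *. rewrite IH. reflexivity. Qed.

Lemma jet_lin k v w j : B v -> B w -> jet (addm k v w) j = addm k (jet v j) (jet w j).
Proof. intros bv bw. induction j as [|j IH]; [reflexivity|]. unfold jet in *. simpl. rewrite IH. apply D_lin; apply jet_B; assumption. Qed.

(** On the sequence of derivatives the shift acts as [D]. Peeling off the first factor gives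
    [g = (D - z) f], annihilated by the remaining factors and so decomposed by induction;
    [dec_resolve] then recovers [f]. *)
Lemma opr_dec zs : forall f1 f2, B f1 -> B f2 ->
  (forall x y, opr zs (fun j => jet f1 j x y) (fun j => jet f2 j x y) = (0, 0)) -> dec f1 f2.
Proof.
induction zs as [|[z1 z2] zs IH]; intros f1 f2 b1 b2 h.
- replace f1 with (@zerof Y) by (apply fun2_ext; intros x y; specialize (h x y); simpl in h; injection h; auto).
  replace f2 with (@zerof Y) by (apply fun2_ext; intros x y; specialize (h x y); simpl in h; injection h; auto). apply dec_nil.
- set (g1 := addm z2 (addm (- z1) (D f1) f1) f2). set (g2 := addm (- z2) (addm (- z1) (D f2) f2) f1).
  pose proof (D_B f1 b1) as b1'. pose proof (D_B f2 b2) as b2'.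
  apply (dec_resolve z1 z2 g1 g2) with (k1 := zerof) (k2 := zerof); auto.
  + apply IH; [apply Blin; auto|apply Blin; auto|]. intros x y. rewrite <- (h x y). simpl. f_equal; apply functional_extensionality; intros j.
    * unfold g1. rewrite !jet_lin, jet_S by auto. unfold addm, jet. simpl. ring.
    * unfold g2. rewrite !jet_lin, jet_S by auto. unfold addm, jet. simpl. ring.
  + intros. unfold g1, addm, zerof. ring.
  + intros. unfold g2, addm, zerof. ring.
  + intros. rewrite D_0. unfold zerof. ring.
  + intros. rewrite D_0. unfold zerof. ring.
Qed.

Theorem bounded_decomposition v : B v -> dec v zerof.
Proof.
intros bv. destruct (span_dependent Y ws (jet v)) as [n [d hd]]; [intros; apply Bws, jet_B, bv|].
(* [v] enters as the element [v + i 0] of the complexification. *)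
destruct (Split.split_roots n d) as [zs hz]. apply (opr_dec zs); [exact bv|exact B0|].
intros x y. rewrite <- (hz (fun j => jet v j x y)) by (apply hd). f_equal.
apply functional_extensionality. intros j. replace (jet zerof j) with (@zerof Y); [reflexivity|].
induction j as [|j IH]; [reflexivity|]. unfold jet in *. simpl. rewrite <- IH. symmetry. apply D_0.
Qed.

Lemma eig_trig tau h1 h2 : eig tau h1 h2 -> forall x y, h1 x y = h1 0 y * cos (tau * x) - h2 0 y * sin (tau * x).
Proof.
intros [b1 [b2 [e1 e2]]] x y.
destruct (rot_const 0 tau (fun x => h1 x y) (fun x => h2 x y)) with (x := x) as [r1 r2].
- intros z. replace (0 * h1 z y - tau * h2 z y) with (D h1 z y) by (rewrite e1; ring). apply D_spec; assumption.
- intros z. replace (0 * h2 z y + tau * h1 z y) with (D h2 z y) by (rewrite e2; ring). apply D_spec; assumption.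
- rewrite <- r1, <- r2. replace (- 0 * x) with 0 by ring. rewrite exp_0. pose proof (sin2_cos2 (tau * x)) as sc. unfold Rsqr in sc.
  replace (h1 x y) with ((sin (tau * x) * sin (tau * x) + cos (tau * x) * cos (tau * x)) * h1 x y) at 1 by (rewrite sc; ring). ring.
Qed.
End Decomposition.

(** * Bounded solutions *)

(** The [bool] selects the real ([true]) or the imaginary ([false]) part. A solution becomes a
    real-valued function on a doubled parameter space, which suits an equation that is linear over
    the reals only. *)
Notation Fn := (R -> R * bool -> R).

Section BoundedSolutions.
Variables a b nu : R.
Variables e1 e2 : R -> R.

(** Real and imaginary parts of [v_x = - i lambda v_t + lambda nu v + e conj(v)]. *)
Definition pde (v vx vt : Fn) x t : Prop :=
  vx x (t, true) = b * vt x (t, true) + a * vt x (t, false) + nu * (a * v x (t, true) - b * v x (t, false)) + (e1 t * v x (t, true) + e2 t * v x (t, false)) /\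
  vx x (t, false) = - a * vt x (t, true) + b * vt x (t, false) + nu * (b * v x (t, true) + a * v x (t, false)) + (e2 t * v x (t, true) - e1 t * v x (t, false)).
Definition bsol (v : Fn) : Prop :=
  (forall x t s, v x (t + 2 * PI, s) = v x (t, s)) /\
  (exists vx vt : Fn, (forall x y, derivable_pt_lim (fun x => v x y) x (vx x y)) /\
    (forall x t s, derivable_pt_lim (fun t => v x (t, s)) t (vt x (t, s))) /\ forall x t, pde v vx vt x t) /\
  exists M, forall x y, Rabs (v x y) <= M.

Lemma bsol_0 : bsol zerof.
Proof.
split; [reflexivity|]. split.
- exists zerof, zerof. split; [|split].
  + intros. apply derivable_pt_lim_const.
  + intros. apply derivable_pt_lim_const.
  + intros x t. unfold pde, zerof. split; ring.
- exists 0. intros. unfold zerof. rewrite Rabs_R0. lra.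
Qed.

Lemma bsol_lin k v w : bsol v -> bsol w -> bsol (addm k v w).
Proof.
intros [p1 [[vx [vt [d1 [d2 q1]]]] [M1 m1]]] [p2 [[wx [wt [d3 [d4 q2]]]] [M2 m2]]]. split; [|split].
- intros. unfold addm. rewrite p1, p2. reflexivity.
- exists (addm k vx wx), (addm k vt wt). split; [|split].
  + intros. unfold addm. apply (derivable_pt_lim_plus (fun x => v x y) (fun x => k * w x y)); [apply d1|].
    apply (derivable_pt_lim_scal (fun x => w x y)). apply d3.
  + intros. unfold addm. apply (derivable_pt_lim_plus (fun t => v x (t, s)) (fun t => k * w x (t, s))); [apply d2|].
    apply (derivable_pt_lim_scal (fun t => w x (t, s))). apply d4.
  + intros x t. destruct (q1 x t) as [h1 h2]. destruct (q2 x t) as [h3 h4]. unfold pde, addm. rewrite h1, h2, h3, h4. split; ring.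
- exists (M1 + Rabs k * M2). intros x y. unfold addm. apply abs_plus_le; [apply m1|].
  apply abs_mult_le; [apply Rle_refl|apply m2].
Qed.

Lemma bsol_shift h v : bsol v -> bsol (fun x y => v (x + h) y).
Proof.
intros [p1 [[vx [vt [d1 [d2 q1]]]] [M1 m1]]]. split; [|split].
- intros. apply p1.
- exists (fun x y => vx (x + h) y), (fun x y => vt (x + h) y). split; [|split].
  + intros. apply (derivable_pt_lim_eq _ _ (vx (x + h) y * (1 + 0))); [ring|].
    apply (derivable_pt_lim_comp (fun x => x + h) (fun x => v x y)); [|apply d1].
    apply derivable_pt_lim_plus; [apply derivable_pt_lim_id|apply derivable_pt_lim_const].
  + intros. apply d2.
  + intros x t. apply (q1 (x + h) t).
- exists M1. intros. apply m1.
Qed.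

Definition cmp (v : Fn) (s : bool) (x t : R) := v x (t, s).
Lemma bsol_sepb v : bsol v -> exists M, forall s, sepb (cmp v s) M.
Proof.
intros [_ [[vx [vt [d1 [d2 _]]]] [M m]]]. exists M. intros s. split; [|split].
- intros t x. apply (derivable_pt_lim_continuity_pt _ _ _ (d1 x (t, s))).
- intros x t. apply (derivable_pt_lim_continuity_pt _ _ _ (d2 x t s)).
- intros. apply m.
Qed.

Lemma VA_lin n k v w : bsol v -> bsol w -> VA (cmp (addm k v w) true) (cmp (addm k v w) false) n 0 =
  VA (cmp v true) (cmp v false) n 0 + k * VA (cmp w true) (cmp w false) n 0.
Proof.
intros hv hw. destruct (bsol_sepb v hv) as [M1 s1]. destruct (bsol_sepb w hw) as [M2 s2]. unfold VA.
pose proof (Bm2_sec2 _ 0 (sepb_Bm2 _ _ (sepb_md1 _ _ M1 n (s1 true) (s1 false)))) as b1.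
pose proof (Bm2_sec2 _ 0 (sepb_Bm2 _ _ (sepb_md1 _ _ M2 n (s2 true) (s2 false)))) as b2.
rewrite <- J_scal by exact b2. rewrite <- J_plus; [|exact b1|apply Bm1_scal; exact b2].
apply J_ext. intros t. unfold md1, cmp, addm. ring.
Qed.

Lemma VB_lin n k v w : bsol v -> bsol w -> VB (cmp (addm k v w) true) (cmp (addm k v w) false) n 0 =
  VB (cmp v true) (cmp v false) n 0 + k * VB (cmp w true) (cmp w false) n 0.
Proof.
intros hv hw. destruct (bsol_sepb v hv) as [M1 s1]. destruct (bsol_sepb w hw) as [M2 s2]. unfold VB.
pose proof (Bm2_sec2 _ 0 (sepb_Bm2 _ _ (sepb_md2 _ _ M1 n (s1 true) (s1 false)))) as b1.
pose proof (Bm2_sec2 _ 0 (sepb_Bm2 _ _ (sepb_md2 _ _ M2 n (s2 true) (s2 false)))) as b2.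
rewrite <- J_scal by exact b2. rewrite <- J_plus; [|exact b1|apply Bm1_scal; exact b2].
apply J_ext. intros t. unfold md2, cmp, addm. ring.
Qed.

Hypothesis a0 : 0 < a.
Hypothesis nu0 : 0 <= nu.
Hypothesis nu1 : nu < 1.
Variables e1' e2' e1'' e2'' : R -> R.
Hypothesis de1 : forall t, derivable_pt_lim e1 t (e1' t).
Hypothesis de2 : forall t, derivable_pt_lim e2 t (e2' t).
Hypothesis de1' : forall t, derivable_pt_lim e1' t (e1'' t).
Hypothesis de2' : forall t, derivable_pt_lim e2' t (e2'' t).
Hypothesis ce1 : continuity e1''.
Hypothesis ce2 : continuity e2''.
Hypothesis pe1 : forall t, e1 (t + 2 * PI) = e1 t.
Hypothesis pe2 : forall t, e2 (t + 2 * PI) = e2 t.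

(** [N0] comes from [a] and the bounds on [e1], [e2] and their second derivatives, never from the
    bound of [v]; this uniformity is what yields a finite dimension. *)
Lemma finitely_determined : exists N0 : nat, forall v, bsol v ->
  (forall n, (Z.abs n <= Z.of_nat N0)%Z -> VA (cmp v true) (cmp v false) n 0 = 0 /\ VB (cmp v true) (cmp v false) n 0 = 0) -> v = zerof.
Proof.
pose proof PI_RGT_0 as pi0.
assert (c1 : continuity e1) by (intros t; apply (derivable_pt_lim_continuity_pt _ _ _ (de1 t))).
assert (c2 : continuity e2) by (intros t; apply (derivable_pt_lim_continuity_pt _ _ _ (de2 t))).
pose proof (period_deriv _ _ de1 pe1) as pe1'. pose proof (period_deriv _ _ de2 pe2) as pe2'.
pose proof (period_deriv _ _ de1' pe1') as pe1''. pose proof (period_deriv _ _ de2' pe2') as pe2''.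
destruct (periodic_bounded e1 c1 pe1) as [K1 hK1]. destruct (periodic_bounded e2 c2 pe2) as [K2 hK2].
destruct (periodic_bounded e1'' ce1 pe1'') as [K3 hK3]. destruct (periodic_bounded e2'' ce2 pe2'') as [K4 hK4].
set (Me := Rmax K1 K2). set (M2 := Rmax K3 K4).
assert (m1 : forall t, Rabs (e1 t) <= Me) by (intros; apply Rle_trans with K1; [auto|apply Rmax_l]).
assert (m2 : forall t, Rabs (e2 t) <= Me) by (intros; apply Rle_trans with K2; [auto|apply Rmax_r]).
assert (m3 : forall t, Rabs (e1'' t) <= M2) by (intros; apply Rle_trans with K3; [auto|apply Rmax_l]).
assert (m4 : forall t, Rabs (e2'' t) <= M2) by (intros; apply Rle_trans with K4; [auto|apply Rmax_r]).
pose proof (coef_bound e1 e1' e1'' Me M2 de1 de1' ce1 m1 m3 pe1 pe1') as cb1.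
pose proof (coef_bound e2 e2' e2'' Me M2 de2 de2' ce2 m2 m4 pe2 pe2') as cb2.
set (Ce := 2 * (Me + M2)).
assert (Ce0 : 0 <= Ce).
{ pose proof (m1 0). pose proof (m3 0). pose proof (Rabs_pos (e1 0)). pose proof (Rabs_pos (e1'' 0)). unfold Ce. lra. }
assert (b1 : Bm1 e1) by (apply (Bm1_cont e1 Me); assumption).
assert (b2 : Bm1 e2) by (apply (Bm1_cont e2 Me); assumption).
assert (sc : forall X Y k, Rabs X <= (Me + M2) * (2 * PI) * q2 k -> Rabs Y <= (Me + M2) * (2 * PI) * q2 k ->
   Rabs (/ (2 * PI) * (X + Y)) <= Ce * q2 k /\ Rabs (/ (2 * PI) * (X - Y)) <= Ce * q2 k).
{ intros X Y k hX hY. assert (i0 : 0 < / (2 * PI)) by (apply Rinv_0_lt_compat; lra).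
  rewrite !Rabs_mult, (Rabs_pos_eq (/ (2 * PI))) by lra.
  replace (Ce * q2 k) with (/ (2 * PI) * ((Me + M2) * (2 * PI) * q2 k + (Me + M2) * (2 * PI) * q2 k)) by (unfold Ce; field; lra).
  split; apply Rmult_le_compat_l; try lra; [apply abs_plus_le|apply abs_minus_le]; assumption. }
assert (hp : forall k, Rabs (cfp e1 e2 k) <= Ce * q2 k).
{ intros k. unfold cfp. rewrite J_plus by bm. apply sc; [apply cb1|apply cb2]. }
assert (hq : forall k, Rabs (cfq e1 e2 k) <= Ce * q2 k).
{ intros k. unfold cfq. rewrite J_minus by bm. apply sc; [apply cb2|apply cb1]. }
(* With [T = s = s0] the smallness condition reads [36 Ce / s0 <= a / 4], that is
   [144 Ce / a <= s0]. *)
destruct (INR_unbounded (1 + 144 * Ce / a)) as [s0 hs0].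
assert (q0 : 0 <= 144 * Ce / a) by (unfold Rdiv; apply Rmult_le_pos; [lra|left; apply Rinv_0_lt_compat; assumption]).
assert (s1 : (1 <= s0)%nat) by (apply INR_le; simpl; lra).
(* Large enough for both [T + 1 <= N0] and [s^2 <= 2 N0 - 3]. *)
exists (s0 * s0 + s0 + 3)%nat. intros v hv van.
pose proof hv as [p1 [[vx [vt [d1 [d2 q1]]]] [M m]]].
apply fun2_ext. intros x [t s].
destruct (solution_vanish a b nu e1 e2 Me Ce c1 c2 m1 m2 hp hq (cmp v true) (cmp v false) (cmp vx true) (cmp vx false) (cmp vt true) (cmp vt false) M)
  with (N0 := (s0 * s0 + s0 + 3)%nat) (T := s0) (s := INR s0) (x := x) (t := t) as [z1 z2]; unfold cmp in *; auto.
- intros; apply q1.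
- intros; apply q1.
- lra.
- replace (4 * Ce * (4 / INR s0 + 5 / INR s0)) with (36 * Ce / INR s0) by (field; lra).
  apply (Rmult_le_reg_r (INR s0)); [lra|]. replace (36 * Ce / INR s0 * INR s0) with (36 * Ce) by (field; lra).
  assert (g : 144 * Ce / a * a <= INR s0 * a) by (apply Rmult_le_compat_r; lra).
  replace (144 * Ce / a * a) with (144 * Ce) in g by (field; lra). lra.
- lia.
- rewrite <- mult_INR, INR_IZR_INZ. apply IZR_le. lia.
- destruct s; assumption.
Qed.

Lemma bsol_span : exists ws, (forall w, In w ws -> bsol w) /\ forall v, bsol v -> span ws v.
Proof.
destruct finitely_determined as [N0 det].
apply (separated_span _ (map (fun n v => VA (cmp v true) (cmp v false) n 0) (zr N0) ++ map (fun n v => VB (cmp v true) (cmp v false) n 0) (zr N0))).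
- apply bsol_lin.
- intros l hl k v w hv hw. apply in_app_or in hl. destruct hl as [hl|hl]; apply in_map_iff in hl; destruct hl as [n [<- _]].
  + apply VA_lin; assumption.
  + apply VB_lin; assumption.
- intros v hv z. apply det; [exact hv|]. intros n hn. split.
  + apply (z (fun v => VA (cmp v true) (cmp v false) n 0)). apply in_or_app. left.
    apply (in_map (fun n v => VA (cmp v true) (cmp v false) n 0)). apply zr_In. exact hn.
  + apply (z (fun v => VB (cmp v true) (cmp v false) n 0)). apply in_or_app. right.
    apply (in_map (fun n v => VB (cmp v true) (cmp v false) n 0)). apply zr_In. exact hn.
Qed.

Lemma bsol_dec v : bsol v -> dec (R * bool) bsol v zerof.
Proof.
intros hv. destruct bsol_span as [ws [h1 h2]].
apply (bounded_decomposition (R * bool) bsol bsol_0 bsol_lin bsol_shift) with (ws := ws); auto.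
- intros w [_ [[wx [wt [d1 _]]] _]] x y. exists (wx x y). apply d1.
- intros w [_ [_ hM]]. exact hM.
Qed.
End BoundedSolutions.

(** * Return to the half cylinder and to basic solutions *)

Section Cylinder.
Variables a b nu : R.
Variable c : R -> CC.
(** [e1 + i e2] is [i c]. *)
Let e1 t := - snd (c t).
Let e2 t := fst (c t).
Notation BS := (bsol a b nu e1 e2).

Definition to_cyl (v : Fn) (r t : R) : CC := (v (ln r) (t, true), v (ln r) (t, false)).

Lemma bsol_solution v : BS v -> is_solution a b nu c (to_cyl v).
Proof.
intros [p [[vx [vt [d1 [d2 q]]]] _]]. split.
- intros r t _. unfold to_cyl. rewrite !p. reflexivity.
- exists (fun r t => (vx (ln r) (t, true) * / r, vx (ln r) (t, false) * / r)), (fun r t => (vt (ln r) (t, true), vt (ln r) (t, false))).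
  intros r t r0. split; [|split].
  + split; simpl.
    * apply (derivable_pt_lim_comp ln (fun x => v x (t, true))); [apply derivable_pt_lim_ln; exact r0|apply d1].
    * apply (derivable_pt_lim_comp ln (fun x => v x (t, false))); [apply derivable_pt_lim_ln; exact r0|apply d1].
  + split; simpl; apply d2.
  + destruct (q (ln r) t) as [q1 q2']. unfold e1, e2 in *. unfold to_cyl, Cadd, Cmul, Cconj, Ci, RtoC, C0. simpl. rewrite q1, q2'.
    f_equal; field; lra.
Qed.

Lemma solution_bsol u : is_solution a b nu c u -> bounded_on_half_cyl u ->
  BS (fun x y => if snd y then fst (u (exp x) (fst y)) else snd (u (exp x) (fst y))).
Proof.
intros [per [ur [ut h]]] [M hM]. split; [|split].
- intros x t s. simpl. rewrite per by apply exp_pos. reflexivity.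
- exists (fun x (y : R * bool) => if snd y then fst (ur (exp x) (fst y)) * exp x else snd (ur (exp x) (fst y)) * exp x),
    (fun x (y : R * bool) => if snd y then fst (ut (exp x) (fst y)) else snd (ut (exp x) (fst y))). split; [|split].
  + intros x [t s]. destruct (h (exp x) t (exp_pos x)) as [[h1 h2] _]. destruct s; simpl.
    * apply (derivable_pt_lim_comp exp (fun r => fst (u r t))); [apply derivable_pt_lim_exp|exact h1].
    * apply (derivable_pt_lim_comp exp (fun r => snd (u r t))); [apply derivable_pt_lim_exp|exact h2].
  + intros x t s. destruct (h (exp x) t (exp_pos x)) as [_ [[h1 h2] _]]. destruct s; simpl; assumption.
  + intros x t. destruct (h (exp x) t (exp_pos x)) as [_ [_ q]]. unfold Cadd, Cmul, Cconj, Ci, RtoC, C0 in q. simpl in q.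
    injection q as q1 q2'. unfold pde, e1, e2. simpl. split; lra.
- exists M. intros x [t s]. specialize (hM (exp x) t (exp_pos x)). unfold Cnorm in hM.
  destruct (u (exp x) t) as [z1 z2] eqn:E. simpl in *. rewrite E. simpl in *.
  assert (g : forall z w, Rabs z <= sqrt (z * z + w * w)).
  { intros z w. rewrite <- sqrt_Rsqr_abs. apply sqrt_le_1_alt. unfold Rsqr. pose proof (Rle_0_sqr w) as s0. unfold Rsqr in s0. lra. }
  destruct s; [apply Rle_trans with (1 := g z1 z2)|apply Rle_trans with (1 := g z2 z1); rewrite (Rplus_comm (z2 * z2))]; exact hM.
Qed.

Lemma eig_basic tau h1 h2 : eig (R * bool) BS tau h1 h2 -> (exists x y, h1 x y <> 0) -> basic_solution a b nu c (to_cyl h1) (0, tau).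
Proof.
intros E [x0 [[t0 s0] n0]]. pose proof E as [b1 [b2 _]]. split; [apply bsol_solution; assumption|]. split.
- exists (exp x0), t0. split; [apply exp_pos|]. unfold to_cyl, C0. rewrite ln_exp. intros z. injection z as z1 z2. destruct s0; contradiction.
- assert (tr : forall x y, h1 x y = h1 0 y * cos (tau * x) - h2 0 y * sin (tau * x)).
  { apply (eig_trig (R * bool) BS) with (tau := tau); [|exact E]. intros w [_ [[wx [wt [d1 _]]] _]] x y. exists (wx x y). apply d1. }
  destruct b1 as [p1 _]. destruct b2 as [p2 _].
  set (A1 := fun t => h1 0 (t, true)). set (A2 := fun t => h1 0 (t, false)).
  set (B1 := fun t => - h2 0 (t, true)). set (B2 := fun t => - h2 0 (t, false)).
  (* With [A = A1 + i A2] and [B = B1 + i B2], [A cos + B sin] is [exp (i tau x) (A - i B) / 2] plus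
     [exp (- i tau x) (A + i B) / 2]. So [phi] is [(A - i B) / 2], and [psi] is the conjugate of
     [(A + i B) / 2]. *)
  exists (fun t => ((A1 t + B2 t) / 2, (A2 t - B1 t) / 2)), (fun t => ((A1 t - B2 t) / 2, - (A2 t + B1 t) / 2)).
  split; [|split].
  + intros t. unfold A1, A2, B1, B2. rewrite !p1, !p2. reflexivity.
  + intros t. unfold A1, A2, B1, B2. rewrite !p1, !p2. reflexivity.
  + intros r t _. unfold to_cyl. rewrite (tr (ln r)), (tr (ln r) (t, false)).
    unfold Cadd, Cmul, Cconj, Cpow. simpl. rewrite Rmult_0_l, exp_0. unfold A1, A2, B1, B2. f_equal; field.
Qed.

(** Only the real part [f1] of the decomposition is used. A term with [h1 = 0] is dropped, as a
    basic solution is nontrivial; all coefficients are 1, the scaling being carried by the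
    eigenvectors. *)
Lemma dec_basic f1 f2 : dec (R * bool) BS f1 f2 -> exists l : list ((R -> R -> CC) * CC * R),
  (forall x, In x l -> basic_solution a b nu c (fst (fst x)) (snd (fst x)) /\ Cre (snd (fst x)) = 0) /\
  (forall r t, to_cyl f1 r t = lin_comb l r t).
Proof.
induction 1 as [|tau h1 h2 f1 f2 E _ [l [hl el]]].
- exists []. split; [intros x []|reflexivity].
- destruct (classic (exists x y, h1 x y <> 0)) as [hn|hn].
  + exists ((to_cyl h1, (0, tau), 1) :: l). split.
    * intros x [<-|hx]; [|apply hl; exact hx]. simpl. split; [apply eig_basic with h2; assumption|reflexivity].
    * intros r t. simpl. rewrite <- el. unfold to_cyl, addm, Cadd, Cmul, RtoC. simpl. f_equal; ring.
  + exists l. split; [exact hl|]. intros r t. rewrite <- el. replace (addm 1 f1 h1) with f1; [reflexivity|].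
    apply fun2_ext. intros x y. unfold addm. destruct (Req_dec (h1 x y) 0) as [->|z]; [ring|]. exfalso; apply hn; exists x, y; exact z.
Qed.
End Cylinder.

Lemma Ck_continuous k f : Ck k f -> Ccontinuous f.
Proof.
destruct k as [|k]; [tauto|]. intros [f' [d _]]. split; intros x; destruct (d x) as [d1 d2]; [apply (derivable_pt_lim_continuity_pt _ _ _ d1)|apply (derivable_pt_lim_continuity_pt _ _ _ d2)].
Qed.

Theorem theorem6p8 (a b nu : R) (k : nat) (c : R -> CC)
  (ha : 0 < a) (hb : b <> 0) (hnu0 : 0 <= nu) (hnu1 : nu < 1)
  (hk : (2 <= k)%nat) (hcper : periodic c) (hcreg : Ck k c)
  (u : R -> R -> CC)
  (hu : is_solution a b nu c u) (hbd : bounded_on_half_cyl u) :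
  (exists l : list ((R -> R -> CC) * CC * R),
     (forall x, In x l ->
        basic_solution a b nu c (fst (fst x)) (snd (fst x)) /\
        Cre (snd (fst x)) = 0) /\
     (forall r t, 0 < r -> u r t = lin_comb l r t)) /\
  ((~ exists sigma, spectral_value a b nu c sigma /\ Cre sigma = 0) ->
     forall r t, 0 < r -> u r t = C0).
Proof.
assert (main : exists l : list ((R -> R -> CC) * CC * R),
     (forall x, In x l -> basic_solution a b nu c (fst (fst x)) (snd (fst x)) /\ Cre (snd (fst x)) = 0) /\
     (forall r t, 0 < r -> u r t = lin_comb l r t)).
(* The bound [2 <= k] provides the second derivative of [c], on which the decay of its Fourier
   coefficients rests. *)
{ destruct k as [|[|k]]; [lia|lia|]. destruct hcreg as [c' [dc [c'' [dc' kc]]]]. destruct (Ck_continuous _ _ kc) as [cc1 cc2].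
  destruct (dec_basic a b nu c (fun x y => if snd y then fst (u (exp x) (fst y)) else snd (u (exp x) (fst y))) zerof) as [l [h1 h2]].
  - apply (bsol_dec a b nu) with (e1' := fun t => - snd (c' t)) (e2' := fun t => fst (c' t)) (e1'' := fun t => - snd (c'' t)) (e2'' := fun t => fst (c'' t)); try assumption.
    + intros t. apply (derivable_pt_lim_opp (fun t => snd (c t))). apply dc.
    + intros t. apply dc.
    + intros t. apply (derivable_pt_lim_opp (fun t => snd (c' t))). apply dc'.
    + intros t. apply dc'.
    + apply (continuity_opp (fun t => snd (c'' t))). exact cc2.
    + intros t. rewrite hcper. reflexivity.
    + intros t. rewrite hcper. reflexivity.
    + apply solution_bsol; assumption.
  - exists l. split; [exact h1|]. intros r t r0. rewrite <- h2. unfold to_cyl. simpl. rewrite exp_ln by exact r0. destruct (u r t); reflexivity. }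
(* Any member of the list would exhibit a spectral value on the imaginary axis; otherwise the list
   is empty and its sum is 0. *)
split; [exact main|]. intros ns r t r0. destruct main as [[|x l] [h1 h2]].
- apply h2. exact r0.
- exfalso. apply ns. destruct (h1 x (or_introl eq_refl)) as [h3 h4]. exists (snd (fst x)). split; [exists (fst (fst x)); exact h3|exact h4].
Qed.
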